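(* Let $X$ be a finite-dimensional Alexandrov space with curvature bounded from below, say $X\in \mathrm{Alex}^n(\kappa)$, and let $f:X\to\mathbb{R}$ be an affine function that is measurable with respect to the $n$-dimensional Hausdorff measure on $X$. Then $f$ is Lipschitz continuous.
   Context: $\mathrm{Alex}^n(\kappa)$ denotes the class of complete geodesic metric spaces of Hausdorff dimension $n<\infty$ with curvature $\geq\kappa$ in the sense of Alexandrov (triangles are not thinner than comparison triangles in the model plane of constant curvature $\kappa$). A geodesic is a length-minimizing curve parametrized proportionally to arclength. A function $f:X\to\mathbb{R}$ on a geodesic metric space is affine if for every geodesic $\gamma:[a,b]\to X$ the function $f\circ\gamma$ is affine, i.e. $(f\circ\gamma)''=0$. *)

(* Defs.v *)
From mathcomp Require Import all_boot all_algebra all_classical all_reals all_analysis.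
Set Implicit Arguments. Unset Strict Implicit. Unset Printing Implicit Defensive.
Import GRing.Theory Num.Theory numFieldTopology.Exports numFieldNormedType.Exports.
Local Open Scope classical_set_scope.
Local Open Scope ring_scope.

Section AlexDefs.
Variable R : realType.

Definition is_metric (X : Type) (d : X -> X -> R) : Prop :=
  (forall x y, 0 <= d x y) /\ (forall x y, d x y = 0 <-> x = y) /\
  (forall x y, d x y = d y x) /\ (forall x y z, d x z <= d x y + d y z).

Definition complete_metric (X : Type) (d : X -> X -> R) : Prop :=
  forall u : nat -> X,
    (forall e : R, 0 < e -> exists N : nat, forall m k : nat,
        (N <= m)%N -> (N <= k)%N -> d (u m) (u k) < e) ->
    exists l : X, forall e : R, 0 < e -> exists N : nat, forall k : nat,
        (N <= k)%N -> d (u k) l < e.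

Definition is_geodesic (X : Type) (d : X -> X -> R) (gamma : R -> X) (a b : R) : Prop :=
  a <= b /\ exists c : R, 0 <= c /\
    forall s t, a <= s <= b -> a <= t <= b -> d (gamma s) (gamma t) = c * `|s - t|.

Definition geodesic_space (X : Type) (d : X -> X -> R) : Prop :=
  forall x y, exists gamma : R -> X,
    is_geodesic d gamma 0 1 /\ gamma 0 = x /\ gamma 1 = y.

(* kappa = 0 : the plane z = 0 in R^3 (Euclidean);
   kappa > 0 : sphere of radius 1/sqrt kappa in R^3;
   kappa < 0 : upper sheet of the hyperboloid x^2+y^2-z^2 = 1/kappa (Minkowski model). *)
Definition acosh (w : R) : R := ln (w + Num.sqrt (w ^+ 2 - 1)).

Definition model_pt (kappa : R) (u : R * R * R) : Prop :=
  let: (x, y, z) := u in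
  if kappa == 0 then z = 0
  else if 0 < kappa then x ^+ 2 + y ^+ 2 + z ^+ 2 = kappa^-1
  else x ^+ 2 + y ^+ 2 - z ^+ 2 = kappa^-1 /\ 0 < z.

Definition model_dist (kappa : R) (u v : R * R * R) : R :=
  let: (x1, y1, z1) := u in let: (x2, y2, z2) := v in
  if kappa == 0 then Num.sqrt ((x1 - x2) ^+ 2 + (y1 - y2) ^+ 2 + (z1 - z2) ^+ 2)
  else if 0 < kappa then acos (kappa * (x1 * x2 + y1 * y2 + z1 * z2)) / Num.sqrt kappa
  else acosh (kappa * (x1 * x2 + y1 * y2 - z1 * z2)) / Num.sqrt (- kappa).

(* For every geodesic triangle xyz (perimeter < 2pi/sqrt kappa if kappa > 0),
   every point p = gamma t on the side [yz], and every comparison triangle in the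
   model plane with the corresponding point p~ on [y~z~]:  |x p| >= |x~ p~|. *)
Definition curv_ge (X : Type) (d : X -> X -> R) (kappa : R) : Prop :=
  forall (x y z : X) (gamma : R -> X) (t : R),
    is_geodesic d gamma 0 1 -> gamma 0 = y -> gamma 1 = z -> 0 <= t <= 1 ->
    (0 < kappa -> d x y + d y z + d z x < 2 * pi / Num.sqrt kappa) ->
    forall xt yt zt pt : R * R * R,
      model_pt kappa xt -> model_pt kappa yt -> model_pt kappa zt -> model_pt kappa pt ->
      model_dist kappa xt yt = d x y -> model_dist kappa xt zt = d x z ->
      model_dist kappa yt zt = d y z ->
      model_dist kappa yt pt = t * d y z -> model_dist kappa pt zt = (1 - t) * d y z ->
      model_dist kappa xt pt <= d x (gamma t).

Definition diam (X : Type) (d : X -> X -> R) (A : set X) : \bar R :=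
  ereal_sup [set e | exists x y, A x /\ A y /\ e = (d x y)%:E].

Definition hcontent (X : Type) (d : X -> X -> R) (s : R) (A : set X) : \bar R :=
  if pselect (A = set0) then 0%E else (diam d A `^ s)%E.

Definition hausdorff_delta (X : Type) (d : X -> X -> R) (s delta : R) (A : set X)
  : \bar R :=
  ereal_inf [set (\sum_(i <oo) hcontent d s (F i))%E |
     F in [set F : nat -> set X |
            A `<=` \bigcup_i F i /\ (forall i, (diam d (F i) <= delta%:E)%E)]].

(* s-dimensional Hausdorff (outer) measure (unnormalized) *)
Definition hausdorff (X : Type) (d : X -> X -> R) (s : R) (A : set X) : \bar R :=
  ereal_sup [set hausdorff_delta d s delta A | delta in [set delta : R | 0 < delta]].

Definition hausdorff_dim (X : Type) (d : X -> X -> R) : \bar R :=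
  ereal_inf [set s%:E | s in [set s : R | 0 <= s /\ hausdorff d s setT = 0%E]].

Definition hmeasurable_set (X : Type) (d : X -> X -> R) (s : R) (A : set X) : Prop :=
  forall E : set X,
    hausdorff d s E = (hausdorff d s (E `&` A) + hausdorff d s (E `&` ~` A))%E.

Definition hmeasurable_fun (X : Type) (d : X -> X -> R) (s : R) (f : X -> R) : Prop :=
  forall U : set R, open U -> hmeasurable_set d s (f @^-1` U).

Definition Alex (X : Type) (d : X -> X -> R) (n : nat) (kappa : R) : Prop :=
  [/\ is_metric d, complete_metric d, geodesic_space d,
      hausdorff_dim d = (n%:R)%:E & curv_ge d kappa].

Definition affine_fun (X : Type) (d : X -> X -> R) (f : X -> R) : Prop :=
  forall (gamma : R -> X) (a b : R), is_geodesic d gamma a b ->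
    exists alpha beta : R, forall t, a <= t <= b -> f (gamma t) = alpha * t + beta.

Definition lipschitz_fun (X : Type) (d : X -> X -> R) (f : X -> R) : Prop :=
  exists L : R, forall x y, `|f x - f y| <= L * d x y.

End AlexDefs.

(* Main.v *)
Require Import Defs.
From mathcomp Require Import all_boot all_order all_algebra all_classical all_reals all_analysis.
From mathcomp Require Import ring lra.
Set Implicit Arguments. Unset Strict Implicit. Unset Printing Implicit Defensive.
Import Order.TTheory GRing.Theory Num.Theory numFieldTopology.Exports numFieldNormedType.Exports.
Local Open Scope classical_set_scope.
Local Open Scope ring_scope.

(** Curvature bounded below enters through Stewart-type inequalities at a small scale [r]:
    the contraction of a ball of radius [eta] towards a point [o] by a factor [t] decreases
    distances by at most a factor [t * (1 - O(eta ^ 2))]. A strainer of maximal length [m]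
    gives distance coordinates whose image contains a cube, and which have a Lipschitz
    inverse on a small ball; contractions transport this to all balls, so [m = n] and balls
    of radius [r / 2] have positive finite [n]-dimensional Hausdorff measure, at most [C * a ^ n]
    at radius [a].

    Let [f] be affine and measurable. Most points [w] near [x] have [|f w| <= k], and so
    has the midpoint of some such [w] and [x]; hence [f] is locally bounded. If [f] had
    a large slope along a short geodesic, the contractions of one fixed ball towards
    many points of that geodesic would be separated by level sets of [f], and their total
    measure would be too large; hence [f] is locally Lipschitz. Finally, suppose that [f]
    has slope at most [A] at all points of a ball inside the [eta]-ball around [c]. Contracted
    towards [c], that ball becomes a set of positive measure on which [f] is
    [A * (1 + O(eta ^ 2))]-Lipschitz; a larger slope at [c] would make this set porous,
    hence null. So slopes grow by a factor [1 + O(eta ^ 2)] over a distance [eta], and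
    this is bounded along chains of small steps. *)

(** * Hausdorff outer measure *)

(** Geodesics between two points need not be unique, so a contraction is an arbitrary choice of
    points and the image of a ball under it need not be measurable. Volumes are therefore outer
    measures, and additivity has only two sources: sets at positive distance from each other, and
    Caratheodory cuts of arbitrary sets by level sets of [f]. The second is how measurability of [f]
    enters.

    The quadratic order of the loss in a contraction is essential. A chain of about [D / eta] steps
    multiplies slopes by [(1 + O(eta ^ 2)) ^ (D / eta)], which tends to 1 with [eta], so that one
    constant serves all points. A loss of order [eta] would leave a factor [exp (O(D))] and only a
    local statement.

    The local Lipschitz constants of [f] are not uniform. In the porosity argument such a constant
    decides how porous the set is, but it disappears from the conclusion, so slopes can be carried
    along a chain although the constants cannot. *)

Section Hausdorff.
Variables (R : realType) (X : Type) (d : X -> X -> R).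
Hypothesis dm : is_metric d.

Let d_ge0 x y : 0 <= d x y. Proof. by case: dm. Qed.

Lemma diam_le (A : set X) (r : R) :
  (forall x y, A x -> A y -> d x y <= r) -> (diam d A <= r%:E)%E.
Proof.
by move=> h; apply: ge_ereal_sup => _ [x [y [Ax [Ay ->]]]]; rewrite lee_fin h.
Qed.

Lemma dist_le_diam (A : set X) x y : A x -> A y -> ((d x y)%:E <= diam d A)%E.
Proof. by move=> Ax Ay; apply: ereal_sup_ubound; exists x, y. Qed.

Lemma diam_ge0 (A : set X) x : A x -> (0 <= diam d A)%E.
Proof.
by move=> Ax; apply: le_trans (dist_le_diam Ax Ax); rewrite lee_fin.
Qed.

Lemma hcontent_ge0 s A : (0 <= hcontent d s A)%E.
Proof. by rewrite /hcontent; case: pselect => //= ?; exact: poweR_ge0. Qed.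

Lemma hcontent0 s : hcontent d s set0 = 0%E.
Proof. by rewrite /hcontent; case: pselect. Qed.

Lemma hcontent_scale (s c : R) (A B : set X) : 0 <= s -> 0 < c ->
  (forall x y, A x -> A y -> exists x' y', [/\ B x', B y' & d x y <= c * d x' y']) ->
  (hcontent d s A <= (c `^ s)%:E * hcontent d s B)%E.
Proof.
move=> s0 c0 h; rewrite /hcontent; case: pselect => A0.
  by apply: mule_ge0; [rewrite lee_fin powR_ge0|case: pselect => //= ?; exact: poweR_ge0].
have [x Ax] : exists x, A x.
  by apply: contrapT => nA; apply: A0; rewrite predeqE => x; split => // Ax; apply: nA; exists x.
have [x' [_ [Bx' _ _]]] := h x x Ax Ax.
case: pselect => B0; first by rewrite B0 in Bx'.
rewrite -poweR_EFin -poweRM; [|by rewrite lee_fin ltW|exact: (diam_ge0 Bx')].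
apply: gt0_ler_poweR => //.
- by rewrite in_itv /= (diam_ge0 Ax) leey.
- rewrite in_itv /= leey andbT; apply: mule_ge0; first by rewrite lee_fin ltW.
  exact: diam_ge0 Bx'.
apply: ge_ereal_sup => _ [y [z [Ay [Az ->]]]].
have [y' [z' [By' Bz' le]]] := h y z Ay Az.
apply: (@le_trans _ _ (c * d y' z')%:E); first by rewrite lee_fin.
by rewrite EFinM lee_pmul2l ?lte_fin //; exact: dist_le_diam.
Qed.

Lemma hcontent_le s r (A : set X) : 0 <= s -> 0 <= r ->
  (forall x y, A x -> A y -> d x y <= r) -> (hcontent d s A <= (r `^ s)%:E)%E.
Proof.
move=> s0 r0 h; rewrite /hcontent; case: pselect => A0.
  by rewrite lee_fin powR_ge0.
have [x Ax] : exists x, A x.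
  by apply: contrapT => nA; apply: A0; rewrite predeqE => x; split => // Ax; apply: nA; exists x.
rewrite -poweR_EFin; apply: gt0_ler_poweR => //.
- by rewrite in_itv /= (diam_ge0 Ax) leey.
- by rewrite in_itv /= leey andbT lee_fin.
exact: diam_le.
Qed.

Lemma hausdorff_delta_le_cover s delta (A : set X) (F : nat -> set X) :
  A `<=` \bigcup_i F i -> (forall i, (diam d (F i) <= delta%:E)%E) ->
  (hausdorff_delta d s delta A <= \sum_(i <oo) hcontent d s (F i))%E.
Proof. by move=> AF Fd; apply: ereal_inf_lbound; exists F. Qed.

Lemma hausdorff_delta_cover s delta (A : set X) v :
  (hausdorff_delta d s delta A < v)%E -> exists F : nat -> set X,
  [/\ A `<=` \bigcup_i F i, (forall i, (diam d (F i) <= delta%:E)%E) &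
   (\sum_(i <oo) hcontent d s (F i) < v)%E].
Proof. by move=> /ereal_inf_lt [_ [F [AF Fd] <-] lt]; exists F. Qed.

Lemma hausdorff_delta_ge0 s delta A : (0 <= hausdorff_delta d s delta A)%E.
Proof.
apply: le_ereal_inf_tmp => _ [F _ <-]; apply: nneseries_ge0 => i _ _.
exact: hcontent_ge0.
Qed.

Lemma hausdorff_le s A v :
  (forall delta, 0 < delta -> (hausdorff_delta d s delta A <= v)%E) ->
  (hausdorff d s A <= v)%E.
Proof. by move=> h; apply: ge_ereal_sup => _ [delta d0 <-]; apply: h. Qed.

Lemma hausdorff_delta_le s delta A : 0 < delta ->
  (hausdorff_delta d s delta A <= hausdorff d s A)%E.
Proof. by move=> d0; apply: ereal_sup_ubound; exists delta. Qed.

Lemma hausdorff_ge0 s A : (0 <= hausdorff d s A)%E.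
Proof.
by apply: le_trans (hausdorff_delta_le s A ltr01); exact: hausdorff_delta_ge0.
Qed.

Lemma le_hausdorff s (A B : set X) : A `<=` B ->
  (hausdorff d s A <= hausdorff d s B)%E.
Proof.
move=> AB; apply: hausdorff_le => delta d0.
apply: le_trans (hausdorff_delta_le s B d0).
apply: le_ereal_inf_tmp => _ [F [BF Fd] <-].
by apply: hausdorff_delta_le_cover => // x /AB /BF.
Qed.

Lemma hausdorff_set0 s : hausdorff d s set0 = 0%E.
Proof.
apply/eqP; rewrite eq_le hausdorff_ge0 andbT; apply: hausdorff_le => delta d0.
have := @hausdorff_delta_le_cover s delta set0 (fun=> set0).
rewrite eseries0; last by move=> *; exact: hcontent0.
by apply => // i; exact: diam_le.
Qed.

(** Covers of the [A k] that are optimal up to [e / 2 ^ k.+1] are merged into one sequence along a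
    bijection [g] of [nat] with [nat * nat]. *)
Lemma hausdorff_delta_sigma s delta (A : nat -> set X) : 0 <= s ->
  (hausdorff_delta d s delta (\bigcup_i A i) <=
   \sum_(i <oo) hausdorff_delta d s delta (A i))%E.
Proof.
move=> s0; set mu := hausdorff_delta d s delta.
have [[i ioo]|] := pselect (exists i, mu (A i) = +oo%E).
  rewrite (eseries_pinfty _ _ ioo) ?leey// => k _.
  by rewrite -ltNye (lt_le_trans _ (hausdorff_delta_ge0 _ _ _)).
rewrite -forallNE => Aoo.
apply/lee_addgt0Pr => e e0.
apply: le_trans (epsilon_trick _ _ (ltW e0)); last first.
  by move=> k; exact: hausdorff_delta_ge0.
have /choice [G PG] : forall k, exists F : nat -> set X,
    [/\ A k `<=` \bigcup_i F i, (forall i, (diam d (F i) <= delta%:E)%E) &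
   (\sum_(i <oo) hcontent d s (F i) <= mu (A k) + (e / (2 ^ k.+1)%:R)%:E)%E].
  move=> k; have [|F [AF Fd /ltW Fs]] := @hausdorff_delta_cover s delta (A k)
     (mu (A k) + (e / (2 ^ k.+1)%:R)%:E)%E; last by exists F.
  rewrite -/(mu (A k)) lteDl ?lte_fin; first by rewrite divr_gt0 // ltr0n expn_gt0.
  rewrite ge0_fin_numE ?hausdorff_delta_ge0 //.
  by rewrite ltey; apply/eqP/Aoo.
apply: (@le_trans _ _ (\sum_(i <oo) \sum_(j <oo) hcontent d s (G i j))%E); last first.
  apply: lee_nneseries => [i _ _|i _].
    by apply: nneseries_ge0 => *; exact: hcontent_ge0.
  by case: (PG i).
have /card_esym/ppcard_eqP[g] := card_nat2.
have := @hausdorff_delta_le_cover s delta (\bigcup_i A i) (fun k => G (g k).1 (g k).2).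
have -> : (\sum_(i <oo) hcontent d s (G (g i).1 (g i).2) =
           \sum_(i <oo) \sum_(j <oo) hcontent d s (G i j))%E.
  rewrite !nneseries_esumT /=; last 2 first.
  - by move=> *; apply: nneseries_ge0 => *; exact: hcontent_ge0.
  - by move=> *; exact: hcontent_ge0.
  transitivity (\esum_(k in [set: nat * nat]) hcontent d s (G k.1 k.2))%E.
    by rewrite (reindex_esum setT setT g) // => *; exact: hcontent_ge0.
  rewrite (_ : [set: nat * nat] = [set: nat] `*`` (fun=> [set: nat])); last first.
    by rewrite predeqE => -[]; split.
  rewrite -(@esum_esum _ _ _ setT (fun=> setT) (fun i j => hcontent d s (G i j))).
    apply: eq_esum => i _; rewrite nneseries_esumT // => *; exact: hcontent_ge0.
  by move=> *; exact: hcontent_ge0.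
apply.
- move=> x [i _ Ax]; have [AG _ _] := PG i; have [j _ Gx] := AG _ Ax.
  by exists (g^-1%FUN (i, j)) => //=; rewrite invK ?inE.
- by move=> i; case: (PG (g i).1).
Qed.

Lemma hausdorff_sigma s (A : nat -> set X) : 0 <= s ->
  (hausdorff d s (\bigcup_i A i) <= \sum_(i <oo) hausdorff d s (A i))%E.
Proof.
move=> s0; apply: hausdorff_le => delta d0.
apply: le_trans (hausdorff_delta_sigma delta A s0) _.
apply: lee_nneseries => [*|*]; first exact: hausdorff_delta_ge0.
exact: hausdorff_delta_le.
Qed.

Lemma hausdorff_setU s (A B : set X) : 0 <= s ->
  (hausdorff d s (A `|` B) <= hausdorff d s A + hausdorff d s B)%E.
Proof.
move=> s0; pose G i := if i is 0%N then A else if i is 1%N then B else set0.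
have -> : A `|` B = \bigcup_i G i.
  rewrite predeqE => x; split=> [[Ax|Bx]|]; [by exists 0%N|by exists 1%N|].
  by case=> -[|[|i]] _ //= h; [left|right].
apply: le_trans (hausdorff_sigma G s0) _.
rewrite (@nneseries_split _ _ 0%N 2); last by move=> *; exact: hausdorff_ge0.
rewrite add0n big_nat_recr //= big_nat1 eseries0 ?adde0 //.
by case=> [|[|k]] //= _ _; exact: hausdorff_set0.
Qed.

(** A covering set of diameter below [r] cannot meet both [A] and [B], so a fine cover of the union
    splits into a cover of each. *)
Lemma hausdorff_separated s (A B : set X) r : 0 <= s -> 0 < r ->
  (forall x y, A x -> B y -> r <= d x y) ->
  (hausdorff d s A + hausdorff d s B <= hausdorff d s (A `|` B))%E.
Proof.
move=> s0 r0 AB.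
have key e1 e2 : 0 < e1 -> 0 < e2 ->
   (hausdorff_delta d s e1 A + hausdorff_delta d s e2 B <= hausdorff d s (A `|` B))%E.
  move=> e10 e20; pose e := Num.min (Num.min e1 e2) (r / 2).
  have e0 : 0 < e by rewrite !lt_min e10 e20 /= divr_gt0.
  have ee1 : e <= e1 by rewrite !ge_min lexx.
  have ee2 : e <= e2 by rewrite !ge_min lexx orbT.
  have er : e < r.
    by apply: (@le_lt_trans _ _ (r / 2)); [rewrite ge_min lexx orbT|lra].
  apply: le_trans (hausdorff_delta_le s _ e0).
  apply: le_ereal_inf_tmp => _ [F [ABF Fd] <-].
  pose part C i := if pselect (exists2 x, C x & F i x) then F i else set0.
  have pd C i e' : e <= e' -> (diam d (part C i) <= e'%:E)%E.
    move=> le; rewrite /part; case: pselect => [?|?] /=; last exact: diam_le.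
    by apply: le_trans (Fd i) _; rewrite lee_fin.
  have cov C : C `<=` A `|` B -> C `<=` \bigcup_i part C i.
    move=> CA x Cx; have [i _ Fx] := ABF x (CA x Cx); exists i => //.
    by rewrite /part; case: pselect => // -[]; exists x.
  apply: (@le_trans _ _ (\sum_(i <oo) hcontent d s (part A i) +
                         \sum_(i <oo) hcontent d s (part B i))%E).
    by apply: leeD; apply: hausdorff_delta_le_cover => [|i]; try exact: pd;
       apply: cov => x; [left|right].
  rewrite -nneseriesD; try by move=> *; exact: hcontent_ge0.
  apply: lee_nneseries => [i _ _|i _]; first by apply: adde_ge0; exact: hcontent_ge0.
  rewrite /part; case: pselect => [[x Ax Fx]|?]; case: pselect => [[y By Fy]|?] /=;
    rewrite ?hcontent0 ?adde0 ?add0e ?hcontent_ge0 //.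
  exfalso; have := le_trans (dist_le_diam Fx Fy) (Fd i).
  by rewrite lee_fin leNgt (lt_le_trans er) // AB.
(* The suprema over the two scales are taken one at a time; moving a term across the inequality
   requires it to be finite, so an infinite right-hand side is set apart. *)
have key2 e1 : 0 < e1 ->
   (hausdorff_delta d s e1 A + hausdorff d s B <= hausdorff d s (A `|` B))%E.
  move=> e10.
  have [->|fin] := eqVneq (hausdorff d s (A `|` B)) +oo%E; first exact: leey.
  have fA : hausdorff_delta d s e1 A \is a fin_num.
    rewrite ge0_fin_numE ?hausdorff_delta_ge0 //.
    apply: le_lt_trans (_ : _ <= hausdorff d s (A `|` B))%E _; last by rewrite ltey.
    apply: le_trans (hausdorff_delta_le s A e10) _.
    by apply: le_hausdorff => x; left.
  rewrite addeC -leeBrDr //; apply: hausdorff_le => e2 e20.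
  by rewrite leeBrDr // addeC; exact: key.
have [->|fin] := eqVneq (hausdorff d s (A `|` B)) +oo%E; first exact: leey.
have fB : hausdorff d s B \is a fin_num.
  rewrite ge0_fin_numE ?hausdorff_ge0 //.
  apply: le_lt_trans (_ : _ <= hausdorff d s (A `|` B))%E _; last by rewrite ltey.
  by apply: le_hausdorff => x; right.
rewrite -leeBrDr //; apply: hausdorff_le => e1 e10.
by rewrite leeBrDr //; exact: key2.
Qed.

(** A cover of [B] pulls back along [phi] to a cover of [A] whose diameters grow at most by the
    factor [c^-1]. *)
Lemma hausdorff_expand (s c : R) (phi : X -> X) (A B : set X) : 0 <= s -> 0 < c ->
  (forall x, A x -> B (phi x)) ->
  (forall x y, A x -> A y -> c * d x y <= d (phi x) (phi y)) ->
  ((c `^ s)%:E * hausdorff d s A <= hausdorff d s B)%E.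
Proof.
move=> s0 c0 AB dphi.
have cs0 : 0 < c `^ s by apply: powR_gt0.
rewrite muleC -lee_pdivlMr //; apply: hausdorff_le => e e0.
rewrite lee_pdivlMr //.
apply: le_trans (hausdorff_delta_le s B (mulr_gt0 c0 e0)).
apply: le_ereal_inf_tmp => _ [F [BF Fd] <-].
pose G i := A `&` (phi @^-1` F i).
have Gd i : (diam d (G i) <= e%:E)%E.
  apply: diam_le => x y [Ax Fx] [Ay Fy].
  have := le_trans (dist_le_diam (A := F i) Fx Fy) (Fd i); rewrite lee_fin => h.
  have := le_trans (dphi _ _ Ax Ay) h.
  by rewrite ler_pM2l.
rewrite muleC -lee_pdivlMl //.
apply: le_trans (hausdorff_delta_le_cover (F := G) s _ Gd) _.
  by move=> x Ax; have [i _ Fi] := BF _ (AB _ Ax); exists i.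
rewrite lee_pdivlMl // -nneseriesZl; last by move=> *; exact: hcontent_ge0.
apply: lee_nneseries => [i _ _|i _].
  by apply: mule_ge0; [rewrite lee_fin ltW|exact: hcontent_ge0].
rewrite -lee_pdivlMl // -powRN.
apply: le_trans (@hcontent_scale s c^-1 (G i) (F i) s0 _ _) _; rewrite ?invr_gt0 //.
  move=> x y [Ax Fx] [Ay Fy]; exists (phi x), (phi y); split => //.
  by rewrite ler_pdivlMl //; apply: dphi.
apply: lee_wpmul2r; first exact: hcontent_ge0.
by rewrite lee_fin -[c^-1]powR_inv1 ?(ltW c0) // -powRrM mulN1r.
Qed.

(** For a set of diameter at most [del], the power [s'] of the diameter is at most [del ^ (s' - s)]
    times its power [s]. *)
Lemma hausdorff_eq0_dim s s' (A : set X) : 0 <= s -> s < s' ->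
  (hausdorff d s A < +oo)%E -> hausdorff d s' A = 0%E.
Proof.
move=> s0 ss' fin; apply/eqP; rewrite eq_le hausdorff_ge0 andbT.
have : hausdorff d s A \is a fin_num by rewrite ge0_fin_numE ?hausdorff_ge0.
move=> /fineK; set v := fine _ => vE.
have v0 : 0 <= v by rewrite /v fine_ge0 // hausdorff_ge0.
apply: hausdorff_le => e e0; apply/lee_addgt0Pr => eps eps0; rewrite add0e.
(* The second bound makes [del ^ (s' - s)] at most [eps / (v + 1)], where [v + 1] bounds the
   [s]-content of the cover chosen next. *)
pose del := Num.min e ((eps / (v + 1)) `^ (s' - s)^-1).
have del0 : 0 < del.
  by rewrite lt_min e0 /= powR_gt0 // divr_gt0 // ltr_wpDl.
have dele : del <= e by rewrite ge_min lexx.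
have [F [AF Fd Fs]] : exists F : nat -> set X,
  [/\ A `<=` \bigcup_i F i, (forall i, (diam d (F i) <= del%:E)%E) &
   (\sum_(i <oo) hcontent d s (F i) < (v + 1)%:E)%E].
  apply: hausdorff_delta_cover; apply: le_lt_trans (hausdorff_delta_le s A del0) _.
  by rewrite -vE lte_fin ltrDl.
apply: le_trans (@hausdorff_delta_le_cover s' e A F AF _) _.
  by move=> i; apply: le_trans (Fd i) _; rewrite lee_fin.
apply: (@le_trans _ _ ((eps / (v + 1))%:E * \sum_(i <oo) hcontent d s (F i))%E).
  rewrite -nneseriesZl; last by move=> *; exact: hcontent_ge0.
  apply: lee_nneseries => [*|i _]; first exact: hcontent_ge0.
  rewrite /hcontent; case: pselect => F0; first by rewrite mule0.
  have [x Fx] : exists x, F i x.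
    by apply: contrapT => nA; apply: F0; rewrite predeqE => x; split => // Ax; apply: nA; exists x.
  have := Fd i; have := diam_ge0 Fx; case: (diam d (F i)) => [r| |] //.
  rewrite !lee_fin => r0 rd.
  have -> : s' = (s' - s) + s by rewrite subrK.
  rewrite powRD; last by apply/implyP; rewrite subrK => /eqP h; exfalso; lra.
  apply: ler_wpM2r; first exact: powR_ge0.
  apply: (@le_trans _ _ (del `^ (s' - s))).
    by apply: ge0_ler_powR; rewrite ?nnegrE ?subr_ge0 ?(ltW ss') // ltW.
  apply: (@le_trans _ _ (((eps / (v + 1)) `^ (s' - s)^-1) `^ (s' - s))).
    apply: ge0_ler_powR; rewrite ?nnegrE ?powR_ge0 ?subr_ge0 ?(ltW ss') ?(ltW del0) //.
    by rewrite ge_min lexx orbT.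
  rewrite -powRrM mulVf ?powRr1 // ?subr_eq0 ?gt_eqF //.
  by rewrite divr_ge0 ?ltW // ltr_wpDl.
apply: (@le_trans _ _ ((eps / (v + 1))%:E * (v + 1)%:E)%E).
  by apply: lee_wpmul2l; [rewrite lee_fin divr_ge0 ?ltW // ltr_wpDl|exact: ltW].
by rewrite -EFinM lee_fin divfK // gt_eqF // ltr_wpDl.
Qed.

Lemma hausdorff_le_finite_cover s (A : set X) v : 0 <= s ->
  (forall e, 0 < e -> exists N r (F : nat -> set X),
    [/\ 0 <= r <= e, A `<=` (fun x => exists2 i, (i < N)%N & F i x),
      (forall i x y, F i x -> F i y -> d x y <= r) & N%:R * r `^ s <= v]) ->
  (hausdorff d s A <= v%:E)%E.
Proof.
move=> s0 h; apply: hausdorff_le => e e0.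
have [N [r [F [/andP[r0 re] AF Fd Nv]]]] := h e e0.
pose G i := if (i < N)%N then F i else set0.
apply: le_trans (@hausdorff_delta_le_cover s e A G _ _) _.
- by move=> x /AF [i iN Fx]; exists i => //; rewrite /G iN.
- move=> i; rewrite /G; case: ifP => _; apply: diam_le => // x y Fx Fy.
  by apply: (le_trans _ re); exact: (Fd i).
rewrite (@nneseries_split _ _ 0%N N); last by move=> *; exact: hcontent_ge0.
rewrite [X in (_ + X)%E]eseries0 ?adde0; last first.
  by move=> i; rewrite /= add0n /G leqNgt => /negbTE -> _; exact: hcontent0.
apply: (@le_trans _ _ (\sum_(0 <= i < 0 + N) (r `^ s)%:E)%E).
  apply: lee_sum => i _; rewrite /G; case: ifP => _.
    by apply: hcontent_le => // x y; exact: Fd.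
  by rewrite hcontent0 lee_fin powR_ge0.
by rewrite sumEFin lee_fin sumr_const_nat add0n subn0 -mulr_natl.
Qed.

End Hausdorff.

(** * Betweenness and geodesics *)

Section Between.
Variables (R : realType) (X : Type) (d : X -> X -> R).
Hypothesis dm : is_metric d.

(** Such triples replace parametrized geodesics in all later estimates; [between_geodesic] recovers
    a geodesic through the middle point. *)
Definition between (x y z : X) : Prop := d x y + d y z = d x z.

Lemma dist_ge0 x y : 0 <= d x y. Proof. by case: dm. Qed.
Lemma distxx x : d x x = 0. Proof. by case: dm => _ [h _]; apply/h. Qed.
Lemma dist_eq0 x y : d x y = 0 -> x = y. Proof. by case: dm => _ [h _] /h. Qed.
Lemma distC x y : d x y = d y x. Proof. by case: dm => _ [_ [h _]]. Qed.
Lemma dist_tri y x z : d x z <= d x y + d y z. Proof. by case: dm => _ [_ [_ h]]. Qed.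

Lemma geodesic_point : geodesic_space d -> forall y z u, 0 <= u <= d y z ->
  exists q, d y q = u /\ d q z = d y z - u.
Proof.
move=> geo y z u /andP[u0 uc].
have [g [[_ [c [c0 gd]]] [g0 g1]]] := geo y z.
have cE : c = d y z.
  by rewrite -g0 -g1 gd ?lexx ?ler01 // sub0r normrN1 mulr1.
have [c00|cn0] := eqVneq (d y z) 0.
  have /dist_eq0 yz : d y z = 0 by [].
  have u00 : u = 0 by apply/eqP; rewrite eq_le u0 -c00 uc.
  by exists y; rewrite u00 distxx subr0.
have cp : 0 < d y z by rewrite lt_def cn0 dist_ge0.
have t0 : 0 <= u / d y z by rewrite divr_ge0 // dist_ge0.
have t1 : u / d y z <= 1 by rewrite ler_pdivrMr // mul1r.
have tE : d y z * (u / d y z) = u by rewrite mulrC divfK.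
set t := u / d y z in t0 t1 tE; exists (g t); split.
  by rewrite -{1}g0 gd ?lexx ?ler01 ?t0 ?t1 // sub0r normrN ger0_norm // cE.
rewrite -{1}g1 gd ?lexx ?ler01 ?t0 ?t1 // distrC ger0_norm ?subr_ge0 // cE.
by rewrite mulrBr mulr1 tE.
Qed.

(** Equality in the triangle inequality makes the concatenation of a geodesic from [y] to [q] and
    one from [q] to [z] a geodesic. The cases [q = y] and [q = z] come first because the
    reparametrization divides by [t] and [1 - t]. *)
Lemma between_geodesic : geodesic_space d -> forall y q z, between y q z ->
  exists g t, [/\ is_geodesic d g 0 1, g 0 = y, g 1 = z, 0 <= t <= 1 &
    g t = q /\ t * d y z = d y q].
Proof.
move=> geo y q z yqz; rewrite /between in yqz.
have [q0|u0] := eqVneq (d y q) 0.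
  have [g [gg [g0 g1]]] := geo y z.
  by exists g, 0; split; rewrite ?lexx ?ler01 ?mul0r ?q0 // g0; split => //; exact: dist_eq0.
have [q0|v0] := eqVneq (d q z) 0.
  have [g [gg [g0 g1]]] := geo y z.
  exists g, 1; split; rewrite ?lexx ?ler01 ?mul1r //; split; last by rewrite -yqz q0 addr0.
  by rewrite g1; apply/esym/dist_eq0.
have up : 0 < d y q by rewrite lt_def u0 dist_ge0.
have vp : 0 < d q z by rewrite lt_def v0 dist_ge0.
have [g [[_ [a [_ gd]]] [g0 g1]]] := geo y q.
have [h [[_ [b [_ hd]]] [h0 h1]]] := geo q z.
have aE : a = d y q by rewrite -g0 -g1 gd ?lexx ?ler01 // sub0r normrN1 mulr1.
have bE : b = d q z by rewrite -h0 -h1 hd ?lexx ?ler01 // sub0r normrN1 mulr1.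
set u := d y q in aE up yqz u0 *; set v := d q z in bE vp yqz v0 *.
have c0 : 0 < d y z by rewrite -yqz addr_gt0.
set c := d y z in c0 yqz *.
have cn0 : c != 0 by rewrite gt_eqF.
pose t := u / c.
have tp : 0 < t by rewrite divr_gt0.
have t1 : t < 1 by rewrite ltr_pdivrMr // mul1r -yqz ltrDl.
pose k s := if s <= t then g (s / t) else h ((s - t) / (1 - t)).
have tu : c * t = u by rewrite /t mulrC divfK.
have tv : c * (1 - t) = v by rewrite mulrBr tu mulr1 -yqz; ring.
have in1 s : 0 <= s -> s <= t -> 0 <= s / t <= 1.
  by move=> s0 st; rewrite divr_ge0 ?(ltW tp) //= ler_pdivrMr // mul1r.
have t1' : 0 < 1 - t by rewrite subr_gt0.
have in2 s : t < s -> s <= 1 -> 0 <= (s - t) / (1 - t) <= 1.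
  move=> s0 st; rewrite divr_ge0 ?subr_ge0 ?(ltW s0) ?(ltW t1) //=.
  by rewrite ler_pdivrMr // mul1r lerD2r.
have gu x y' : u * `|x / t - y' / t| = c * `|x - y'|.
  rewrite -mulrBl normrM (ger0_norm (_ : 0 <= t^-1)) ?invr_ge0 ?ltW // -tu.
  by field; rewrite gt_eqF.
have hv x y' : v * `|(x - t) / (1 - t) - (y' - t) / (1 - t)| = c * `|x - y'|.
  rewrite -mulrBl normrM (ger0_norm (_ : 0 <= (1 - t)^-1)) ?invr_ge0 ?ltW // -tv.
  rewrite (_ : x - t - (y' - t) = x - y'); last by ring.
  by field; rewrite gt_eqF.
(* The upper bound passes through [q]; the lower bound holds because a shortcut would make the way
   from [y] to [z] shorter than [c]. *)
have mixed s s' : 0 <= s -> s <= t -> t < s' -> s' <= 1 ->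
    d (g (s / t)) (h ((s' - t) / (1 - t))) = c * `|s - s'|.
  move=> s0 st ts s1.
  have i0 : 0 <= (0 : R) <= 1 by rewrite lexx ler01.
  have i1 : 0 <= (1 : R) <= 1 by rewrite lexx ler01.
  have e1 : d (g (s / t)) q = c * (t - s).
    rewrite -g1 gd ?in1 // aE (_ : 1 = t / t); last by rewrite divff ?gt_eqF.
    by rewrite gu distrC ger0_norm ?subr_ge0.
  have e2 : d y (g (s / t)) = c * s.
    rewrite -[y]g0 gd ?in1 // aE (_ : 0 = 0 / t); last by rewrite mul0r.
    by rewrite gu distrC subr0 ger0_norm.
  have e3 : d q (h ((s' - t) / (1 - t))) = c * (s' - t).
    rewrite -h0 hd ?in2 // bE (_ : 0 = (t - t) / (1 - t)); last by rewrite subrr mul0r.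
    by rewrite hv distrC ger0_norm ?subr_ge0 // ltW.
  have e4 : d (h ((s' - t) / (1 - t))) z = c * (1 - s').
    rewrite -{1}h1 hd ?in2 // bE -[X in _ - X](@divff _ (1 - t)) ?gt_eqF //.
    by rewrite hv distrC ger0_norm ?subr_ge0.
  rewrite distrC ger0_norm; last by rewrite subr_ge0 (le_trans st) // ltW.
  apply/eqP; rewrite eq_le; apply/andP; split.
    by have := dist_tri q (g (s / t)) (h ((s' - t) / (1 - t))); rewrite e1 e3; nra.
  have := dist_tri (g (s / t)) y z.
  have := dist_tri (h ((s' - t) / (1 - t))) (g (s / t)) z.
  by rewrite e2 e4 -/c; nra.
exists k, t; split.
- split; first exact: ler01.
  exists c; split; first exact: ltW.
  move=> s s' /andP[s0 s1] /andP[s'0 s'1]; rewrite /k.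
  have [st|ts] := leP s t; have [st'|ts'] := leP s' t.
  + by rewrite gd ?in1 // aE gu.
  + exact: mixed.
  + by rewrite distC mixed // distrC.
  + by rewrite hd ?in2 // bE hv.
- by rewrite /k (ltW tp) mul0r.
- by rewrite /k leNgt t1 /= divff ?gt_eqF.
- by rewrite (ltW tp) (ltW t1).
- by rewrite /k lexx divff ?gt_eqF // mulrC.
Qed.

Lemma affine_between f : geodesic_space d -> affine_fun d f ->
  forall y q z, between y q z -> d y z * f q = d q z * f y + d y q * f z.
Proof.
move=> geo af y q z yqz.
have [g [t [gg g0 g1 t01 [gt tE]]]] := between_geodesic geo yqz.
have [al [be h]] := af _ _ _ gg.
have -> : f y = be by rewrite -g0 h ?lexx ?ler01 // mulr0 add0r.
have -> : f z = al + be by rewrite -g1 h ?lexx ?ler01 // mulr1.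
have -> : f q = al * t + be by rewrite -gt h.
have -> : d q z = d y z - d y q by rewrite -yqz; ring.
by rewrite -tE; ring.
Qed.

End Between.

(** * Comparison geometry *)

Section Model.
Variable R : realType.

(* [sn] and [1 - k * md] are the generalized sine and cosine of curvature [k];
   [md] is the primitive of [sn] that vanishes at 0, so [md u = u ^+ 2 / 2] for [k = 0]. *)
Definition model_laws (k : R) (sn md : R -> R) : Prop :=
  (forall u v, sn (u - v) = sn u * (1 - k * md v) - (1 - k * md u) * sn v) /\
  (forall u v, md (u - v) = md u + md v - k * md u * md v - sn u * sn v).

(** Both errors are two orders above the main terms; this is the origin of the factor
    [1 - O(eta ^ 2)] for contractions. *)
Definition model_bounds (r C : R) (sn md : R -> R) : Prop :=
  forall u, 0 <= u <= r -> `|sn u - u| <= C * u ^+ 3 /\ `|md u - u ^+ 2 / 2| <= C * u ^+ 4.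

(** With [a = d x y], [b = d x z], [c = d y z], [u = d y q], [v = d q z], [p = d x q], the flat
    case, doubled, reads [a ^ 2 * v + b ^ 2 * u - c * u * v <= p ^ 2 * c]. In the plane this is an
    equality, Stewart's theorem; the general form is its analogue in curvature [k]. *)
Definition stewart (X : Type) (d : X -> X -> R) (r : R) (sn md : R -> R) : Prop :=
  forall x y z q, between d y q z -> d x y <= r -> d x z <= r -> d y z <= r ->
    md (d x y) * sn (d q z) + (md (d x z) - md (d y z)) * sn (d y q)
      + sn (d y z) * md (d y q) <= md (d x q) * sn (d y z).

(** The mean value theorem is bootstrapped: rough bounds for [sn] and [md] give
    [1 - k * md u = 1 + O(u ^ 2)], hence the cubic error of [sn], hence the quartic error of
    [md]. *)
Lemma model_bounds_derive (k : R) (sn md : R -> R) :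
  (forall u : R, is_derive u 1 sn (1 - k * md u)) ->
  (forall u : R, is_derive u 1 md (sn u)) -> sn 0 = 0 -> md 0 = 0 ->
  exists r C, [/\ 0 < r, 0 <= C & model_bounds r C sn md].
Proof.
move=> dsn dmd sn0 md0.
have dcont (f df : R -> R) a b : (forall u : R, is_derive u 1 f (df u)) ->
    {within `[a, b], continuous f}.
  move=> h; apply: continuous_subspaceT => x.
  by apply/differentiable_continuous/derivable1_diffP; case: (h x).
have mvt (f df : R -> R) u : (forall u : R, is_derive u 1 f (df u)) -> 0 <= u ->
    exists2 c, 0 <= c <= u & f u - f 0 = df c * u.
  move=> h u0; have [c cu ->] := MVT_segment u0 (fun x _ => h x) (dcont f df 0 u h).
  by exists c; rewrite ?subr0.
(* Continuity of [md] at 0 gives a first interval on which [k * md] is at most 1 in absolute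
   value. *)
have /cvgrPdist_lt : md u @[u --> (0 : R)] --> md 0.
  by apply/differentiable_continuous/derivable1_diffP; case: (dmd 0).
rewrite md0 => /(_ (1 + `|k|)^-1) [|e /= e0 he].
  by rewrite invr_gt0 ltr_wpDr.
have k0 : 0 <= `|k| by [].
have small u : 0 <= u <= e / 2 -> `|k * md u| <= 1.
  move=> /andP[u0 ue].
  have /he : `|0 - u| < e by rewrite sub0r normrN ger0_norm //; lra.
  rewrite sub0r normrN -[X in _ < X]mul1r ltr_pdivlMr ?ltr_wpDr // normrM => h.
  have m0 : 0 <= `|md u| by []. nra.
have snb u : 0 <= u <= e / 2 -> 0 <= sn u <= 2 * u.
  move=> /andP[u0 ue]; have [c /andP[c0 cu]] := mvt _ _ u dsn u0.
  rewrite sn0 subr0 => ->; have := small c; rewrite c0 (le_trans cu ue) => /(_ isT).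
  by rewrite ler_norml => /andP[? ?]; apply/andP; split; nra.
have mdb u : 0 <= u <= e / 2 -> 0 <= md u <= 2 * u ^+ 2.
  move=> /andP[u0 ue]; have [c /andP[c0 cu]] := mvt _ _ u dmd u0.
  rewrite md0 subr0 => ->; have := snb c; rewrite c0 (le_trans cu ue) => /(_ isT) /andP[? ?].
  by apply/andP; split; nra.
have csb u : 0 <= u <= e / 2 -> `|1 - k * md u - 1| <= `|k| * (2 * u ^+ 2).
  move=> h; rewrite (_ : 1 - k * md u - 1 = - (k * md u)); last by ring.
  rewrite normrN normrM; apply: ler_wpM2l => //.
  by case/andP: (mdb u h) => h1 h2; rewrite ger0_norm.
exists (e / 2), (2 * `|k|); split; [by rewrite divr_gt0|by rewrite mulr_ge0|].
have sn3 u : 0 <= u <= e / 2 -> `|sn u - u| <= 2 * `|k| * u ^+ 3.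
  move=> /andP[u0 ue]; have [c /andP[c0 cu]] := mvt _ _ u dsn u0.
  rewrite sn0 subr0 => ->; have := csb c; rewrite c0 (le_trans cu ue) => /(_ isT) h.
  rewrite (_ : _ * u - u = (1 - k * md c - 1) * u); last by ring.
  rewrite normrM (ger0_norm u0); apply: le_trans (ler_wpM2r u0 h) _.
  rewrite (_ : 2 * `|k| * u ^+ 3 = `|k| * (2 * u ^+ 2) * u); last by ring.
  apply: ler_wpM2r => //; apply: ler_wpM2l => //; apply: ler_wpM2l => //.
  by rewrite ler_sqr ?nnegrE // (le_trans c0).
move=> u h; split; first exact: sn3.
case/andP: (h) => u0 ue.
have [|c /andP[c0 cu]] := mvt (fun x => md x - x ^+ 2 / 2) (fun x => sn x - x) u _ u0.
  by move=> x; apply: is_derive_eq; rewrite /GRing.scale /= ; field.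
rewrite md0 expr0n /= mul0r !subr0 => ->.
rewrite normrM (ger0_norm u0) (_ : _ * u ^+ 4 = 2 * `|k| * u ^+ 3 * u); last by ring.
apply: ler_wpM2r => //; apply: le_trans (sn3 c _) _; first by rewrite c0 (le_trans cu).
apply: ler_wpM2l; first by rewrite mulr_ge0.
by apply: lerXn2r; rewrite ?nnegrE // (le_trans c0).
Qed.

End Model.

Section Stewart.
Variables (R : realType) (X : Type) (d : X -> X -> R).
Hypothesis dm : is_metric d.
Hypothesis geo : geodesic_space d.

Lemma stewart_flat : curv_ge d 0 -> forall r,
  stewart d r (fun u => u) (fun u => u ^+ 2 / 2).
Proof.
move=> cv r x y z q yqz _ _ _.
have [c0|cn0] := eqVneq (d y z) 0.
  have := dist_ge0 dm y q; have := dist_ge0 dm q z; move: yqz; rewrite /between c0 => h h1 h2.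
  have -> : d y q = 0 by lra.
  have -> : d q z = 0 by lra.
  by rewrite !mulr0 !mul0r !addr0.
have [g [t [gg g0 g1 t01 [gt tE]]]] := between_geodesic dm geo yqz.
set c := d y z in cn0 tE *; set a := d x y; set b := d x z; set u := d y q in tE *.
have c0 : 0 < c by rewrite lt_def cn0 dist_ge0.
have a0 : 0 <= a by exact: dist_ge0.
have b0 : 0 <= b by exact: dist_ge0.
have u0 : 0 <= u by exact: dist_ge0.
have v0 : 0 <= d q z by exact: dist_ge0.
have vE : d q z = c - u by rewrite /c /u -yqz; ring.
have abc : b <= a + c by exact: dist_tri.
have acb : a <= b + c by rewrite /a /b /c (distC dm y z); exact: dist_tri.
have cab : c <= a + b by rewrite /a /b /c (distC dm x y); exact: dist_tri.
(* The comparison triangle has [y] at the origin and [z] on the first axis; [x1] is the abscissa of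
   the third vertex by the law of cosines. The triangle inequalities, in the form of Heron's
   formula, make its squared height nonnegative. *)
pose x1 := (a ^+ 2 + c ^+ 2 - b ^+ 2) / (2 * c).
have xE : 2 * c * x1 = a ^+ 2 + c ^+ 2 - b ^+ 2.
  by rewrite /x1 mulrC divfK // mulf_neq0 // pnatr_eq0.
have y2 : 0 <= a ^+ 2 - x1 ^+ 2.
  have h : 0 <= ((a + c) ^+ 2 - b ^+ 2) * (b ^+ 2 - (a - c) ^+ 2).
    by apply: mulr_ge0; rewrite subr_sqr; apply: mulr_ge0; lra.
  have e : ((a + c) ^+ 2 - b ^+ 2) * (b ^+ 2 - (a - c) ^+ 2) =
           (a ^+ 2 - x1 ^+ 2) * (2 * c) ^+ 2.
    have -> : (a ^+ 2 - x1 ^+ 2) * (2 * c) ^+ 2 = a ^+ 2 * (2 * c) ^+ 2 - (2 * c * x1) ^+ 2.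
      by ring.
    by rewrite xE; ring.
  by move: h; rewrite e pmulr_lge0 // exprn_gt0 // mulr_gt0.
pose y1 := Num.sqrt (a ^+ 2 - x1 ^+ 2).
have yE : y1 ^+ 2 = a ^+ 2 - x1 ^+ 2 by rewrite sqr_sqrtr.
have sq v w : 0 <= w -> v = w ^+ 2 -> Num.sqrt v = w.
  by move=> w0 ->; rewrite sqrtr_sqr ger0_norm.
have := cv x y z g t gg g0 g1 t01 _ (x1, y1, 0) (0, 0, 0) (c, 0, 0) (u, 0, 0).
rewrite /model_pt /model_dist eqxx ltxx gt => h.
have {h} h : Num.sqrt ((x1 - u) ^+ 2 + (y1 - 0) ^+ 2 + (0 - 0) ^+ 2) <= d x q.
  apply: h => //.
  - by apply: sq => //; rewrite -/a !subr0 yE; ring.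
  - by apply: sq => //; rewrite -/b !subr0 yE; lra.
  - by apply: sq; rewrite -/c ?(ltW c0) //; ring.
  - by apply: sq; rewrite -/c tE //; ring.
  - by apply: sq; rewrite -/c mulrBl mul1r tE; [rewrite -vE|ring].
have {h} : (x1 - u) ^+ 2 + y1 ^+ 2 <= d x q ^+ 2.
  have := dist_ge0 dm x q => p0.
  rewrite -[X in X <= _](@sqr_sqrtr _ ((x1 - u) ^+ 2 + y1 ^+ 2)); last first.
    by rewrite addr_ge0 // sqr_ge0.
  rewrite ler_sqr ?nnegrE ?sqrtr_ge0 //.
  by move: h; rewrite !subr0 expr0n /= addr0.
rewrite yE vE => h; have := ler_wpM2r (ltW c0) h.
have -> : ((x1 - u) ^+ 2 + (a ^+ 2 - x1 ^+ 2)) * c = a ^+ 2 * c + u ^+ 2 * c - (2 * c * x1) * u.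
  by ring.
by rewrite xE; lra.
Qed.

Lemma le_cos (u v : R) : u \in `[0, pi] -> v \in `[0, pi] -> u <= v -> cos v <= cos u.
Proof. by move=> hu hv uv; rewrite leNgt ltr_cos // -leNgt. Qed.

(** The comparison point of [y] is the north pole, those of [z] and [q] lie on one meridian, and
    that of [x] comes from the spherical law of cosines. Sides of at most [pi / (2 * k)] keep all
    angles that occur in [[0, pi]], where [cos] decreases, and the perimeter below [2 * pi / k]. *)
Lemma stewart_sphere kappa : 0 < kappa -> curv_ge d kappa ->
  let k := Num.sqrt kappa in
  stewart d (pi / (2 * k)) (fun u => sin (k * u) / k) (fun u => (1 - cos (k * u)) / k ^+ 2).
Proof.
move=> kp cv k x y z q yqz.
have k0 : 0 < k by rewrite sqrtr_gt0.
have kn0 : k != 0 by rewrite gt_eqF.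
have kE : k ^+ 2 = kappa by rewrite sqr_sqrtr // ltW.
rewrite !ler_pdivlMr ?mulr_gt0 //.
have [c0|cn0] := eqVneq (d y z) 0.
  have := dist_ge0 dm y q; have := dist_ge0 dm q z; move: yqz; rewrite /between c0 => h h1 h2 _ _ _.
  have -> : d y q = 0 by lra.
  have -> : d q z = 0 by lra.
  by rewrite !(mulr0, sin0, mul0r, addr0).
have [g [t [gg g0 g1 t01 [gt tE]]]] := between_geodesic dm geo yqz.
set c := d y z in cn0 tE *; set a := d x y; set b := d x z; set u := d y q in tE *.
move=> ar br cr.
have c0 : 0 < c by rewrite lt_def cn0 dist_ge0.
have a0 : 0 <= a by exact: dist_ge0.
have b0 : 0 <= b by exact: dist_ge0.
have u0 : 0 <= u by exact: dist_ge0.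
have v0 : 0 <= d q z by exact: dist_ge0.
have vE : d q z = c - u by rewrite /c /u -yqz; ring.
have abc : b <= a + c by exact: dist_tri.
have acb : a <= b + c by rewrite /a /b /c (distC dm y z); exact: dist_tri.
have cab : c <= a + b by rewrite /a /b /c (distC dm x y); exact: dist_tri.
have p0 : 0 <= d x q by exact: dist_ge0.
have pau : d x q <= a + u by exact: dist_tri.
have pp : 0 < pi :> R by exact: pi_gt0.
have inpi v : 0 <= v -> 2 * k * v <= 2 * pi -> k * v \in `[0, pi].
  by move=> v0' h; rewrite in_itv /= mulr_ge0 ?(ltW k0) //=; lra.
have Sc : 0 < sin (k * c).
  apply: sin_gt0_pi; rewrite mulr_gt0 //=; lra.
have Sa : 0 <= sin (k * a) by apply: sin_ge0_pi; rewrite mulr_ge0 ?(ltW k0) //=; lra.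
set A := k * a in Sa *; set C := k * c in Sc *; set B := k * b.
have le1 : cos (A + C) <= cos B.
  apply: le_cos.
  - by apply: inpi => //; lra.
  - by rewrite /A /C -mulrDr; apply: inpi; [apply: addr_ge0 => //; exact: ltW|lra].
  - by rewrite /A /B /C -mulrDr ler_pM2l.
have le2 : cos B <= cos (A - C).
  have -> : cos (A - C) = cos (k * `|a - c|).
    rewrite /A /C -mulrBr; have [h|h] := ger0P (a - c) => //.
    by rewrite mulrN cosN.
  apply: le_cos.
  - apply: inpi => //; have : `|a - c| <= b by rewrite ler_norml; apply/andP; split; lra.
    move=> h; have := ler_wpM2l (ltW k0) h; lra.
  - by apply: inpi => //; lra.
  - by rewrite ler_pM2l // ler_norml; apply/andP; split; lra.
rewrite cosD in le1; rewrite cosB in le2.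
pose x1 := (cos B - cos A * cos C) / sin C.
have xE : x1 * sin C = cos B - cos A * cos C by rewrite /x1 divfK // gt_eqF.
clearbody x1.
(* The triangle inequalities [le1] and [le2] say that [x1] is at most [sin A] in absolute value, so
   the comparison point fits on the sphere. *)
have y2 : 0 <= sin A ^+ 2 - x1 ^+ 2.
  have h1 : - sin A <= x1 by rewrite -(ler_pM2r Sc) xE mulNr; lra.
  have h2 : x1 <= sin A by rewrite -(ler_pM2r Sc) xE; lra.
  by rewrite subr_sqr mulr_ge0 //; lra.
pose y1 := Num.sqrt (sin A ^+ 2 - x1 ^+ 2).
have yE : y1 ^+ 2 = sin A ^+ 2 - x1 ^+ 2 by rewrite sqr_sqrtr.
clearbody y1.
have kne : (kappa == 0) = false by rewrite gt_eqF.
have dE v w : 0 <= w -> 2 * k * w <= 2 * pi -> v = cos (k * w) -> acos v / k = w.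
  move=> w0 wp ->; rewrite cosK ?inpi //.
  by rewrite mulrC mulKf.
have := cv x y z g t gg g0 g1 t01 _ (x1 / k, y1 / k, cos A / k)
   (0, 0, k^-1) (sin C / k, 0, cos C / k) (sin (k * u) / k, 0, cos (k * u) / k).
rewrite /model_pt /model_dist kne kp -/k gt => h.
have {h} h : acos (kappa * (x1 / k * (sin (k * u) / k) + y1 / k * 0 + cos A / k * (cos (k * u) / k))) / k <= d x q.
  apply: h.
  - move=> _; rewrite -/a -/c (distC dm z x) -/b ltr_pdivlMr // ; lra.
  - rewrite !expr_div_n yE (_ : sin A ^+ 2 = 1 - cos A ^+ 2) -?kE; first by field.
    by have := cos2Dsin2 A; lra.
  - by rewrite expr0n /= !add0r exprVn kE.
  - by rewrite expr0n /= addr0 !exprMn !exprVn kE -mulrDl addrC cos2Dsin2 mul1r.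
  - by rewrite expr0n /= addr0 !exprMn !exprVn kE -mulrDl addrC cos2Dsin2 mul1r.
  - apply: dE => //; rewrite -/a; first lra.
    by rewrite -/A -kE; field.
  - apply: dE => //; rewrite -/b; first lra.
    rewrite -/b -/B -kE (_ : cos B = x1 * sin C + cos A * cos C); first by field.
    by rewrite xE subrK.
  - apply: dE; rewrite -/c; [exact: ltW|lra|].
    by rewrite -/C -kE; field.
  - rewrite tE -/u; apply: dE => //; first by nra.
    by rewrite -kE; field.
  - rewrite mulrBl mul1r tE -vE; apply: dE => //; first by nra.
    by rewrite vE (mulrBr k) cosB -/C -kE; field.
set W := (X in acos X) in h.
have WE : W = x1 * sin (k * u) + cos A * cos (k * u).
  by rewrite /W -kE; field.
(* Cauchy-Schwarz, with [x1 ^ 2 + cos A ^ 2 <= 1] from [y2]; it puts [W] in the domain of [acos]. *)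
have W1 : -1 <= W <= 1.
  suff : W ^+ 2 <= 1 by move=> h1; apply/andP; split; nra.
  rewrite WE.
  have := cos2Dsin2 A; have := cos2Dsin2 (k * u) => e1 e2.
  set S := sin (k * u) in e1 *; set T := cos (k * u) in e1 *.
  have := sqr_ge0 (x1 * T - cos A * S) => e3.
  have : (x1 ^+ 2 + cos A ^+ 2) * (S ^+ 2 + T ^+ 2) = (x1 * S + cos A * T) ^+ 2 + (x1 * T - cos A * S) ^+ 2 by ring.
  rewrite [S ^+ 2 + _]addrC e1; lra.
have {h} h : cos (k * d x q) <= W.
  rewrite -[W]acosK ?in_itv //=.
  apply: le_cos.
  - by rewrite in_itv /= acos_ge0 // acos_lepi.
  - by apply: inpi => //; nra.
  - by rewrite [_ * d x q]mulrC -ler_pdivrMr.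
have e : forall v, (1 - v) / k ^+ 2 * (sin C / k) = ((1 - v) * sin C) / k ^+ 3.
  by move=> v; field.
rewrite vE (mulrBr k) sinB -/A -/B -/C.
set S := sin (k * u) in WE *; set T := cos (k * u) in WE *.
rewrite -subr_ge0.
suff -> : (1 - cos (k * d x q)) / k ^+ 2 * (sin C / k) -
   ((1 - cos A) / k ^+ 2 * ((sin C * T - cos C * S) / k) +
    ((1 - cos B) / k ^+ 2 - (1 - cos C) / k ^+ 2) * (S / k) +
    sin C / k * ((1 - T) / k ^+ 2)) = (W - cos (k * d x q)) * sin C / k ^+ 3.
  by rewrite divr_ge0 ?exprn_ge0 ?(ltW k0) // mulr_ge0 ?subr_ge0 // ltW.
rewrite WE.
have -> : cos B = x1 * sin C + cos A * cos C by rewrite xE subrK.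
by field.
Qed.

Definition ch (u : R) : R := (expR u + expR (- u)) / 2.
Definition sh (u : R) : R := (expR u - expR (- u)) / 2.

Lemma ch2Bsh2 u : ch u ^+ 2 - sh u ^+ 2 = 1.
Proof.
have := expRxMexpNx_1 u; rewrite /ch /sh.
set E := expR u; set F := expR (- u) => h.
have -> : ((E + F) / 2) ^+ 2 - ((E - F) / 2) ^+ 2 = E * F by field.
exact: h.
Qed.

Lemma chB u v : ch (u - v) = ch u * ch v - sh u * sh v.
Proof. by rewrite /ch /sh opprB !expRD; field. Qed.
Lemma chD u v : ch (u + v) = ch u * ch v + sh u * sh v.
Proof. by rewrite /ch /sh opprD !expRD; field. Qed.
Lemma shB u v : sh (u - v) = sh u * ch v - ch u * sh v.
Proof. by rewrite /ch /sh opprB !expRD; field. Qed.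
Lemma ch0 : ch 0 = 1. Proof. by rewrite /ch oppr0 expR0; field. Qed.
Lemma sh0 : sh 0 = 0. Proof. by rewrite /sh oppr0 expR0 subrr mul0r. Qed.
Lemma chN u : ch (- u) = ch u. Proof. by rewrite /ch opprK addrC. Qed.

Lemma sh_ge0 u : 0 <= u -> 0 <= sh u.
Proof.
by move=> u0; rewrite /sh divr_ge0 // subr_ge0 ler_expR; lra.
Qed.
Lemma sh_gt0 u : 0 < u -> 0 < sh u.
Proof.
by move=> u0; rewrite /sh divr_gt0 // subr_gt0 ltr_expR; lra.
Qed.
Lemma ch_gt0 u : 0 < ch u.
Proof. by rewrite /ch divr_gt0 // addr_gt0 // expR_gt0. Qed.

Lemma le_ch u v : 0 <= u -> u <= v -> ch u <= ch v.
Proof.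
move=> u0 uv; have h1 := sh_ge0 u0; have h2 : 0 <= v - u by lra.
rewrite -[v](subrK u) chD; have h3 := sh_ge0 h2; have h4 := ch_gt0 u.
have h5 : 1 <= ch (v - u).
  have := ch2Bsh2 (v - u); have := ch_gt0 (v - u) => h5 h6.
  have := sqr_ge0 (sh (v - u)); nra.
nra.
Qed.

Lemma acosh_ch u : 0 <= u -> acosh (ch u) = u.
Proof.
move=> u0; rewrite /acosh.
have -> : ch u ^+ 2 - 1 = sh u ^+ 2 by rewrite -(ch2Bsh2 u); ring.
rewrite sqrtr_sqr ger0_norm ?sh_ge0 //.
by rewrite (_ : ch u + sh u = expR u) ?expRK // /ch /sh; field.
Qed.

(** The configuration of the spherical case, with the comparison point of [y] at the vertex of the
    hyperboloid. Since [ch] increases on the whole half-line, [r] is arbitrary. *)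
Lemma stewart_hyperbolic kappa : kappa < 0 -> curv_ge d kappa ->
  let k := Num.sqrt (- kappa) in forall r,
  stewart d r (fun u => sh (k * u) / k) (fun u => (ch (k * u) - 1) / k ^+ 2).
Proof.
move=> kp cv k r x y z q yqz.
have k0 : 0 < k by rewrite sqrtr_gt0 oppr_gt0.
have kn0 : k != 0 by rewrite gt_eqF.
have kE : kappa = - k ^+ 2 by rewrite sqr_sqrtr ?oppr_ge0 ?opprK // ltW.
have [c0|cn0] := eqVneq (d y z) 0.
  have := dist_ge0 dm y q; have := dist_ge0 dm q z; move: yqz; rewrite /between c0 => h h1 h2 _ _ _.
  have -> : d y q = 0 by lra.
  have -> : d q z = 0 by lra.
  by rewrite !(mulr0, sh0, mul0r, addr0).
have [g [t [gg g0 g1 t01 [gt tE]]]] := between_geodesic dm geo yqz.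
set c := d y z in cn0 tE *; set a := d x y; set b := d x z; set u := d y q in tE *.
move=> _ _ _.
have c0 : 0 < c by rewrite lt_def cn0 dist_ge0.
have a0 : 0 <= a by exact: dist_ge0.
have b0 : 0 <= b by exact: dist_ge0.
have u0 : 0 <= u by exact: dist_ge0.
have v0 : 0 <= d q z by exact: dist_ge0.
have vE : d q z = c - u by rewrite /c /u -yqz; ring.
have abc : b <= a + c by exact: dist_tri.
have acb : a <= b + c by rewrite /a /b /c (distC dm y z); exact: dist_tri.
have cab : c <= a + b by rewrite /a /b /c (distC dm x y); exact: dist_tri.
have p0 : 0 <= d x q by exact: dist_ge0.
have kv v : 0 <= v -> 0 <= k * v by move=> ?; rewrite mulr_ge0 // ltW.
have Sc : 0 < sh (k * c) by apply: sh_gt0; rewrite mulr_gt0.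
have Sa : 0 <= sh (k * a) by apply: sh_ge0; exact: kv.
set A := k * a in Sa *; set C := k * c in Sc *; set B := k * b.
have le1 : ch B <= ch (A + C).
  by apply: le_ch; [exact: kv|rewrite /A /B /C -mulrDr ler_pM2l].
have le2 : ch (A - C) <= ch B.
  have -> : ch (A - C) = ch (k * `|a - c|).
    rewrite /A /C -mulrBr; have [h|h] := ger0P (a - c) => //.
    by rewrite mulrN chN.
  apply: le_ch; first exact: kv.
  by rewrite ler_pM2l // ler_norml; apply/andP; split; lra.
rewrite chD in le1; rewrite chB in le2.
pose x1 := (ch A * ch C - ch B) / sh C.
have xE : x1 * sh C = ch A * ch C - ch B by rewrite /x1 divfK // gt_eqF.
clearbody x1.
have y2 : 0 <= sh A ^+ 2 - x1 ^+ 2.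
  have h1 : - sh A <= x1 by rewrite -(ler_pM2r Sc) xE mulNr; lra.
  have h2 : x1 <= sh A by rewrite -(ler_pM2r Sc) xE; lra.
  by rewrite subr_sqr mulr_ge0 //; lra.
pose y1 := Num.sqrt (sh A ^+ 2 - x1 ^+ 2).
have yE : y1 ^+ 2 = sh A ^+ 2 - x1 ^+ 2 by rewrite sqr_sqrtr.
clearbody y1.
have kne : (kappa == 0) = false by rewrite lt_eqF.
have kpn : (0 < kappa) = false by rewrite ltNge (ltW kp).
have dE v w : 0 <= w -> v = ch (k * w) -> acosh v / k = w.
  move=> w0 ->; rewrite acosh_ch ?kv //.
  by rewrite mulrC mulKf.
have cs w : sh w ^+ 2 = ch w ^+ 2 - 1 by rewrite -(ch2Bsh2 w); ring.
have := cv x y z g t gg g0 g1 t01 _ (x1 / k, y1 / k, ch A / k)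
   (0, 0, k^-1) (sh C / k, 0, ch C / k) (sh (k * u) / k, 0, ch (k * u) / k).
rewrite /model_pt /model_dist kne kpn -/k gt => h.
have {h} h : acosh (kappa * (x1 / k * (sh (k * u) / k) + y1 / k * 0 - ch A / k * (ch (k * u) / k))) / k <= d x q.
  apply: h.
  - by move=> h; exfalso; lra.
  - split; last by rewrite divr_gt0 // ch_gt0.
    have := cs A; move: (ch A) (sh A) yE => ca sa e1 e2.
    by rewrite kE !expr_div_n e1 e2; field.
  - split; last by rewrite invr_gt0.
    by rewrite kE; field.
  - split; last by rewrite divr_gt0 // ch_gt0.
    have := cs C; move: (ch C) (sh C) => cc sc e.
    by rewrite kE !expr_div_n e; field.
  - split; last by rewrite divr_gt0 // ch_gt0.
    have := cs (k * u); move: (ch (k * u)) (sh (k * u)) => cc sc e.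
    by rewrite kE !expr_div_n e; field.
  - apply: dE => //.
    by rewrite -/A kE; field.
  - apply: dE => //.
    rewrite -/b -/B kE (_ : ch B = ch A * ch C - x1 * sh C); first by field.
    by rewrite xE; ring.
  - apply: dE; first exact: ltW.
    by rewrite -/C kE; field.
  - rewrite tE -/u; apply: dE => //.
    by rewrite kE; field.
  - rewrite mulrBl mul1r tE -vE; apply: dE => //.
    by rewrite vE (mulrBr k) chB -/C kE; field.
set W := (X in acosh X) in h.
have WE : W = ch A * ch (k * u) - x1 * sh (k * u).
  by rewrite /W kE; field.
(* [W >= 1] is not known beforehand, so [acosh] is not inverted at [W]. With [P = k * d x q], if
   [W > ch P] then [W + sqrt (W ^ 2 - 1) > ch P + sh P = expR P], against [h]. *)
have {h} h : W <= ch (k * d x q).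
  rewrite leNgt; apply/negP => Wgt.
  have P0 : 0 <= k * d x q by exact: kv.
  move: h; rewrite ler_pdivrMr // mulrC -ler_expR /acosh lnK; last first.
    rewrite posrE; apply: ltr_wpDr; first exact: sqrtr_ge0.
    exact: lt_trans (ch_gt0 _) Wgt.
  have -> : expR (k * d x q) = ch (k * d x q) + sh (k * d x q) by rewrite /ch /sh; field.
  apply/negP; rewrite -ltNge; apply: ltr_leD => //.
  rewrite -[sh _]ger0_norm ?sh_ge0 // -sqrtr_sqr cs.
  apply: ler_wsqrtr; rewrite lerD2r ler_sqr ?nnegrE; [exact: ltW|exact: ltW (ch_gt0 _)|].
  exact: ltW (lt_trans (ch_gt0 _) Wgt).
rewrite vE (mulrBr k) shB -/A -/B -/C.
set S := sh (k * u) in WE *; set T := ch (k * u) in WE *.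
rewrite -subr_ge0.
suff -> : (ch (k * d x q) - 1) / k ^+ 2 * (sh C / k) -
   ((ch A - 1) / k ^+ 2 * ((sh C * T - ch C * S) / k) +
    ((ch B - 1) / k ^+ 2 - (ch C - 1) / k ^+ 2) * (S / k) +
    sh C / k * ((T - 1) / k ^+ 2)) = (ch (k * d x q) - W) * sh C / k ^+ 3.
  by rewrite divr_ge0 ?exprn_ge0 ?(ltW k0) // mulr_ge0 ?subr_ge0 // ltW.
rewrite WE.
have -> : ch B = ch A * ch C - x1 * sh C by rewrite xE; ring.
by field.
Qed.

Lemma curv_ge_stewart kappa : curv_ge d kappa -> exists k r C sn md,
  [/\ 0 < r, 0 <= C, model_laws k sn md, model_bounds r C sn md & stewart d r sn md].
Proof.
move=> cv; have [k0|kp|kn] := ltgtP kappa 0; last 1 first.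
- rewrite kn in cv; exists 0, 1, 0, (fun u => u), (fun u => u ^+ 2 / 2); split => //.
  + by split => u v; field.
  + by move=> u _; rewrite !subrr normr0 !mul0r.
  + exact: stewart_flat.
- have := stewart_hyperbolic k0 cv; set k := Num.sqrt _ => /= st.
  have kp : 0 < k by rewrite sqrtr_gt0 oppr_gt0.
  have kn0 : k != 0 by rewrite gt_eqF.
  have [||||r [C [r0 C0 bd]]] := @model_bounds_derive R (- k ^+ 2)
     (fun u => sh (k * u) / k) (fun u => (ch (k * u) - 1) / k ^+ 2).
  + by move=> u; rewrite /sh; apply: is_derive_eq; rewrite /GRing.scale /= /ch; field.
  + by move=> u; rewrite /ch; apply: is_derive_eq; rewrite /GRing.scale /= /sh; field.
  + by rewrite mulr0 sh0 mul0r.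
  + by rewrite mulr0 ch0 subrr mul0r.
  exists (- k ^+ 2), r, C, (fun u => sh (k * u) / k), (fun u => (ch (k * u) - 1) / k ^+ 2).
  split => //; split => u v.
    by rewrite mulrBr shB; field.
  by rewrite mulrBr chB; field.
- have := stewart_sphere kp cv; set k := Num.sqrt _ => /= st.
  have k0 : 0 < k by rewrite sqrtr_gt0.
  have kn0 : k != 0 by rewrite gt_eqF.
  have [||||r [C [r0 C0 bd]]] := @model_bounds_derive R (k ^+ 2)
     (fun u => sin (k * u) / k) (fun u => (1 - cos (k * u)) / k ^+ 2).
  + by move=> u; apply: is_derive_eq; rewrite /GRing.scale /=; field.
  + by move=> u; apply: is_derive_eq; rewrite /GRing.scale /=; field.
  + by rewrite mulr0 sin0 mul0r.
  + by rewrite mulr0 cos0 subrr mul0r.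
  exists (k ^+ 2), (Num.min r (pi / (2 * k))), C, (fun u => sin (k * u) / k), (fun u => (1 - cos (k * u)) / k ^+ 2).
  split => //.
  + by rewrite lt_min r0 divr_gt0 ?pi_gt0 // mulr_gt0.
  + split => u v; first by rewrite mulrBr sinB; field.
    by rewrite mulrBr cosB; field.
  + by move=> u /andP[u0]; rewrite le_min => /andP[ur _]; apply: bd; rewrite u0.
  + move=> x y z q yqz; rewrite !le_min => /andP[_ h1] /andP[_ h2] /andP[_ h3].
    exact: st.
Qed.

End Stewart.

Section ModelEstimates.
Variables (R : realType) (k C rho : R) (sn md : R -> R).
Hypothesis laws : model_laws k sn md.
Hypothesis bounds : model_bounds rho C sn md.
Hypothesis rho0 : 0 < rho.
Hypothesis C0 : 0 <= C.
Hypothesis small : (C + `|k|) * rho ^+ 2 <= 1 / 100.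

Lemma model_small (u : R) : 0 <= u <= rho -> C * u ^+ 2 <= 1 / 100 /\ `|k| * u ^+ 2 <= 1 / 100.
Proof.
move=> /andP[u0 ur].
have h : u ^+ 2 <= rho ^+ 2 by rewrite ler_sqr ?nnegrE // ltW.
have k0 : 0 <= `|k| by [].
have h1 := ler_wpM2l C0 h; have h2 := ler_wpM2l k0 h.
have u2 := sqr_ge0 u; have := mulr_ge0 C0 (le_trans u2 h); have := mulr_ge0 k0 (le_trans u2 h).
by move: small; rewrite mulrDl => ? ? ?; split; lra.
Qed.

Lemma sn_bounds (u : R) : 0 <= u -> u <= rho -> 99 / 100 * u <= sn u <= 101 / 100 * u.
Proof.
move=> u0 ur; have h : 0 <= u <= rho by rewrite u0.
have [+ _] := bounds h; have [+ _] := model_small h => s.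
have -> : C * u ^+ 3 = C * u ^+ 2 * u by ring.
by rewrite ler_norml => /andP[h1 h2]; apply/andP; split; nra.
Qed.

Lemma md_bounds (u : R) : 0 <= u -> u <= rho -> 49 / 100 * u ^+ 2 <= md u <= 51 / 100 * u ^+ 2.
Proof.
move=> u0 ur; have h : 0 <= u <= rho by rewrite u0.
have [_ +] := bounds h; have [+ _] := model_small h => s.
have -> : C * u ^+ 4 = C * u ^+ 2 * u ^+ 2 by ring.
have u2 := sqr_ge0 u.
by rewrite ler_norml => /andP[h1 h2]; apply/andP; split; nra.
Qed.

Lemma sn0 : sn 0 = 0.
Proof.
have [|+ _] := @bounds 0; first by rewrite lexx ltW.
by rewrite subr0 expr0n mulr0 normr_le0 => /eqP.
Qed.

Lemma md0 : md 0 = 0.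
Proof.
have [|_] := @bounds 0; first by rewrite lexx ltW.
by rewrite !expr0n mul0r subr0 mulr0 normr_le0 => /eqP.
Qed.

Lemma snN u : sn (- u) = - sn u.
Proof. by case: laws => h _; have := h 0 u; rewrite sub0r sn0 md0 => ->; ring. Qed.

Lemma mdN u : md (- u) = md u.
Proof. by case: laws => _ h; have := h 0 u; rewrite sub0r sn0 md0 => ->; ring. Qed.

Lemma mdD u v : md (u + v) = md u + md v - k * md u * md v + sn u * sn v.
Proof. by case: laws => _ h; rewrite -[v in LHS]opprK h snN mdN; ring. Qed.

Lemma snD u v : sn (u + v) = sn u * (1 - k * md v) + (1 - k * md u) * sn v.
Proof. by case: laws => h _; rewrite -[v in LHS]opprK h snN mdN; ring. Qed.

Lemma md_norm u : md `|u| = md u.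
Proof. by case: (ger0P u) => // _; rewrite mdN. Qed.

Lemma cs_bounds (u : R) : 0 <= u -> u <= rho -> 99 / 100 <= 1 - k * md u <= 101 / 100.
Proof.
move=> u0 ur; have h : 0 <= u <= rho by rewrite u0.
have := md_bounds u0 ur; have [_ s] := model_small h => /andP[h1 h2].
have u2 := sqr_ge0 u.
have : `|k * md u| <= 1 / 100.
  rewrite normrM (ger0_norm (_ : 0 <= md u)); last by lra.
  have k0 : 0 <= `|k| by []; nra.
by rewrite ler_norml => /andP[h3 h4]; apply/andP; split; lra.
Qed.

(** With [w = v - u] the law of [md] turns the difference into
    [sn v * sn w - (1 - k * md v) * md w], about [v * w - w ^ 2 / 2]; as [w <= v], this lies about
    between half of [v * w] and [v * w]. *)
Lemma md_sub u v : 0 <= u -> u <= v -> v <= rho ->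
  2 / 5 * (v * (v - u)) <= md v - md u <= 11 / 10 * (v * (v - u)).
Proof.
move=> u0 uv vr; have [_ law] := laws.
have v0 : 0 <= v by lra.
set w := v - u; have w0 : 0 <= w by rewrite /w; lra.
have wv : w <= v by rewrite /w; lra.
have -> : u = v - w by rewrite /w; ring.
rewrite law.
have /andP[s1 s2] := sn_bounds v0 vr.
have /andP[s3 s4] := sn_bounds w0 (le_trans wv vr).
have /andP[m1 m2] := md_bounds w0 (le_trans wv vr).
have /andP[c1 c2] := cs_bounds v0 vr.
have -> : md v - (md v + md w - k * md v * md w - sn v * sn w) =
   sn v * sn w - (1 - k * md v) * md w by ring.
move: (sn v) (sn w) (md w) (1 - k * md v) s1 s2 s3 s4 m1 m2 c1 c2 => S T M P *.
have e1 : 99 / 100 * v * (99 / 100 * w) <= S * T by apply: ler_pM; rewrite ?mulr_ge0.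
have e2 : S * T <= 101 / 100 * v * (101 / 100 * w).
  by apply: ler_pM => //; apply: le_trans; [|eassumption| |eassumption]; rewrite mulr_ge0.
have w2 : w ^+ 2 <= v * w by rewrite expr2 ler_wpM2r.
have w20 := sqr_ge0 w.
have e3 : P * M <= 101 / 100 * (51 / 100 * w ^+ 2) by apply: ler_pM => //; lra.
have e4 : 0 <= P * M by apply: mulr_ge0; lra.
by apply/andP; split; lra.
Qed.

Lemma le_md u v : 0 <= u -> u <= v -> v <= rho -> md u <= md v.
Proof.
move=> u0 uv vr; have /andP[h _] := md_sub u0 uv vr.
have : 0 <= v * (v - u) by apply: mulr_ge0; lra.
lra.
Qed.

End ModelEstimates.

(** * Distance estimates at small scale *)

Section LocalGeometry.
Variables (R : realType) (X : Type) (d : X -> X -> R).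

(** In curvature 0 the factor is [t] itself; the loss is quadratic in the size of the configuration
    because curvature scales like an inverse square of length. *)
Definition contraction_expands (r K : R) : Prop :=
  forall o y z y' z' t eta, 0 <= t <= 1 -> eta <= r -> d o y <= eta -> d o z <= eta ->
    between d o y' y -> between d o z' z -> d o y' = t * d o y -> d o z' = t * d o z ->
    t * (1 - K * eta ^+ 2) * d y z <= d y' z'.

(** Division by [d y q * d y z] turns this into a comparison of slopes of [d e]: the slope over the
    initial piece is at least that over the whole segment, up to [K / l] times the length. The
    second derivative of a distance function is of order [1 / l] at distance [l]. *)
Definition dist_semiconcave (r K : R) : Prop :=
  forall e y q z l, 0 < l -> l <= d e y -> d e y <= r -> d e z <= r -> d y z <= r ->
    between d y q z ->
    d y q * (d e z - d e y) - K / l * (d y q * d y z ^+ 2) <= d y z * (d e q - d e y).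

(** By the law of cosines, [d x z >= d y z - tau] bounds the cosine of the comparison angle at [y]
    by about [tau / d x y + d x y / (2 * d y z)], and this cosine controls how fast the distance to
    [x] drops on the way to [z]. *)
Definition dist_derivative_bound (r : R) : Prop :=
  forall x y q z tau, 0 < d x y -> 0 < d y z -> 0 <= tau -> d x y <= r -> d x z <= r -> d y z <= r ->
    between d y q z -> d y z - tau <= d x z ->
    d x y - 3 * d y q * (tau / d x y + d x y / d y z) <= d x q.

(** Apollonius' theorem on medians, which in the plane is an equality without the last term. *)
Definition midpoint_bound (r K : R) : Prop :=
  forall w y q z u, 0 < u -> u <= r -> d y q = u -> d q z = u -> d y z = 2 * u ->
    d w q <= 2 * u ->
    d w y ^+ 2 + d w z ^+ 2 <= 2 * d w q ^+ 2 + 2 * u ^+ 2 + K * u ^+ 4.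

(** If the path from [x] through [q] to [y] is straight up to an excess [e], then so, nearly, is its
    part with legs [u]: monotonicity of comparison angles. *)
Definition hinge_bound (r K : R) : Prop :=
  forall q x y x' y' u l e, 0 < u -> 0 < l -> 0 <= e -> l <= d q x -> l <= d q y ->
    d q x <= r -> d q y <= r ->
    between d q x' x -> between d q y' y -> d q x' = u -> d q y' = u ->
    d q x + d q y - e <= d x y ->
    4 * u ^+ 2 - 5 * (e / l) * u ^+ 2 - K * u ^+ 4 <= d x' y' ^+ 2.

(* [sn] and [md] belong to curvature [k]; the smallness of [rho] makes the model plane
   almost flat at scale [rho]. *)
Definition model_geometry (k C rho : R) (sn md : R -> R) : Prop :=
  [/\ is_metric d, model_laws k sn md, model_bounds rho C sn md, 0 < rho &
    [/\ 0 <= C, (C + `|k|) * rho ^+ 2 <= 1 / 100 & stewart d rho sn md]].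

End LocalGeometry.

(** Monotonicity of the comparison angle at [o], freed of angles: in the flat case
    [(c ^ 2 - (a - b) ^ 2) / (2 * a * b)] is one minus its cosine, for sides [a], [b] at [o] and [c]
    opposite. Stewart's inequality is used twice, moving first [y] to [y'] and then [z] to [z']. *)
Lemma hinge_model (R : realType) (X : Type) (d : X -> X -> R) (k C rho : R)
    (sn md : R -> R) : model_geometry d k C rho sn md ->
  forall o y z y' z', between d o y' y -> between d o z' z ->
  0 < d o y -> 0 < d o z -> d o y <= rho / 2 -> d o z <= rho / 2 ->
  sn (d o y') * sn (d o z') * (md (d y z) - md (d o y - d o z))
    + sn (d o y) * sn (d o z) * md (d o y' - d o z')
  <= md (d y' z') * (sn (d o y) * sn (d o z)).
Proof.
move=> [dm laws bounds rho0 [C0 small st]].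
have sn_b := sn_bounds bounds rho0 C0 small.
have md_b := md_bounds bounds rho0 C0 small.
have cs_b := cs_bounds bounds rho0 C0 small.
have dge0 := dist_ge0 dm.
move=> o y z y' z' by' bz' al0 be0 alr ber.
have [lsn lmd] := laws.
have u0 := dge0 o y'; have v0 := dge0 o z'; have u0' := dge0 y' y; have v0' := dge0 z' z.
have yz : d y z <= rho.
  by apply: le_trans (dist_tri dm o y z) _; rewrite (distC dm y o); lra.
have y'z : d y' z <= rho.
  apply: le_trans (dist_tri dm o y' z) _; rewrite (distC dm y' o).
  by move: by'; rewrite /between; lra.
have E1 := @st z o y y' by'; have E2 := @st y' o z z' bz'.
have {E1}E1 : md (d o z) * sn (d y' y) + (md (d y z) - md (d o y)) * sn (d o y')
      + sn (d o y) * md (d o y') <= md (d y' z) * sn (d o y).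
  have := E1; rewrite (distC dm z o) (distC dm z y) (distC dm z y'); apply => //; lra.
have {E2}E2 : md (d o y') * sn (d z' z) + (md (d y' z) - md (d o z)) * sn (d o z')
      + sn (d o z) * md (d o z') <= md (d y' z') * sn (d o z).
  have := E2; rewrite (distC dm y' o); apply => //; first by move: by'; rewrite /between; lra.
  lra.
have yE : d y' y = d o y - d o y' by rewrite -by'; ring.
have zE : d z' z = d o z - d o z' by rewrite -bz'; ring.
rewrite yE lsn in E1; rewrite zE lsn in E2; rewrite !lmd.
have yr : d o y <= rho by lra.
have zr : d o z' <= rho by move: bz'; rewrite /between; lra.
have /andP[a1 _] := sn_b _ (dge0 o y) yr.
have /andP[v1 _] := sn_b _ v0 zr.
have a0 : 0 <= sn (d o y) by lra.
have sv0 : 0 <= sn (d o z') by lra.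
have F1 := ler_wpM2r sv0 E1; have F2 := ler_wpM2r a0 E2.
move: F1 F2; move: (sn (d o y)) (sn (d o z)) (sn (d o y')) (sn (d o z')) (md (d o y)) (md (d o z))
  (md (d o y')) (md (d o z')) (md (d y z)) (md (d y' z)) (md (d y' z')) => a b u v A B U V m n p F1 F2.
lra.
Qed.

(** Here [x] is [C * eta ^ 2], [c] and [c'] are the distances before and after contraction, [w] is
    the difference of the distances to [o], and [mc], [mc'], [mw], [mtw] are the values of [md] at
    [c], [c'], [w], [t * w]. The factor [1 - 16 * x] comes from two uses of [contraction_ratio]; the
    rest of the loss covers the errors of [md]. *)
Lemma contraction_arith (R : realType) (t x c c' w mc mc' mw mtw : R) :
  0 <= t -> 0 <= x -> 4 * x <= 1 / 100 -> 0 <= c -> 0 <= c' ->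
  `|mc - c ^+ 2 / 2| <= 4 * x * c ^+ 2 -> `|mc' - c' ^+ 2 / 2| <= 4 * x * c' ^+ 2 ->
  `|mw - w ^+ 2 / 2| <= 4 * x * w ^+ 2 -> `|mtw - (t * w) ^+ 2 / 2| <= 4 * x * (t * w) ^+ 2 ->
  t ^+ 2 * (1 - 16 * x) * (mc - mw) + mtw <= mc' -> t * (1 - 20 * x) * c <= c'.
Proof.
move=> t0 x0 x1 c0 c0'; rewrite !ler_norml.
move=> /andP[b7 _] /andP[_ b4] /andP[_ b6] /andP[b1 _] h.
have t2 := sqr_ge0 t; have c2 := sqr_ge0 c; have x2 := sqr_ge0 x.
have g0 : 0 <= t ^+ 2 * (1 - 16 * x) by apply: mulr_ge0 => //; clear - x1; lra.
have h3 : t ^+ 2 * (1 - 16 * x) * mc <= mc'.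
  suff : t ^+ 2 * (1 - 16 * x) * mw <= mtw by clear - h; lra.
  have g1 : mw <= w ^+ 2 * (1 / 2 + 4 * x) by clear - b6; lra.
  apply: le_trans (ler_wpM2l g0 g1) _.
  have g2 : (1 - 16 * x) * (1 / 2 + 4 * x) <= 1 / 2 - 4 * x by clear - x0 x2; lra.
  have g3 := ler_wpM2l (mulr_ge0 t2 (sqr_ge0 w)) g2.
  by move: b1 g3; rewrite exprMn; clear; lra.
have h4 : t ^+ 2 * c ^+ 2 * ((1 - 16 * x) * (1 / 2 - 4 * x)) <= mc'.
  apply: le_trans h3.
  have g1 : c ^+ 2 * (1 / 2 - 4 * x) <= mc by clear - b7; lra.
  by have := ler_wpM2l g0 g1; clear; lra.
have h5 : mc' <= c' ^+ 2 * (1 / 2 + 4 * x) by clear - b4; lra.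
have h6 : (1 - 20 * x) ^+ 2 * (1 / 2 + 4 * x) <= (1 - 16 * x) * (1 / 2 - 4 * x).
  by clear - x0 x1 x2; nra.
have h7 : (t * (1 - 20 * x) * c) ^+ 2 <= c' ^+ 2.
  have p0 : 0 < 1 / 2 + 4 * x by clear - x0; lra.
  rewrite -(ler_pM2r p0) !exprMn.
  apply: le_trans h5; apply: le_trans h4.
  by have := ler_wpM2l (mulr_ge0 t2 c2) h6; clear; lra.
move: h7; rewrite ler_sqr ?nnegrE //; apply: mulr_ge0 => //; apply: mulr_ge0 => //.
by clear - x1; lra.
Qed.

Lemma contraction_ratio (R : realType) (t x v s s' e e' : R) : 0 <= t -> 0 <= x -> 4 * x <= 1 / 100 ->
  0 <= v -> `|s - v| <= e -> `|s' - t * v| <= e' -> e <= 4 * x * v -> e' <= 4 * x * (t * v) ->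
  t * (1 - 8 * x) * s <= s'.
Proof.
move=> t0 x0 x1 v0; rewrite !ler_norml => /andP[_ h4] /andP[h1 _] e1 e2.
have q0 : 0 <= t * (1 - 8 * x) by apply: mulr_ge0 => //; clear - x1; lra.
have h : s <= v + 4 * x * v by clear - h4 e1; lra.
apply: (le_trans (ler_wpM2l q0 h)).
rewrite (_ : t * (1 - 8 * x) * (v + 4 * x * v) = t * v * ((1 - 8 * x) * (1 + 4 * x))); last by ring.
have h6 : (1 - 8 * x) * (1 + 4 * x) <= 1 - 4 * x.
  by have := sqr_ge0 x; clear - x0; lra.
by have := ler_wpM2l (mulr_ge0 t0 v0) h6; clear - h1 e2; lra.
Qed.

Lemma contraction_expandsP (R : realType) (X : Type) (d : X -> X -> R) (k C rho : R) (sn md : R -> R) :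
  model_geometry d k C rho sn md -> contraction_expands d (rho / 2) (20 * C).
Proof.
move=> G; move: (G); move=> [dm laws bounds rho0 [C0 small st]].
have sn_b := sn_bounds bounds rho0 C0 small.
have md_b := md_bounds bounds rho0 C0 small.
have cs_b := cs_bounds bounds rho0 C0 small.
have dge0 := dist_ge0 dm.
move=> o y z y' z' t eta /andP[t0 t1] er ye ze by' bz' yt zt.
have y0 := dge0 o y; have z0 := dge0 o z.
have eta0 : 0 <= eta := le_trans y0 ye.
have x0 : 0 <= C * eta ^+ 2 by rewrite mulr_ge0 // sqr_ge0.
(* All distances under [md] and [sn] are at most [2 * eta], hence the factor 4 in the relative
   errors. *)
have sm (w : R) : 0 <= w -> w <= 2 * eta -> C * w ^+ 2 <= 4 * (C * eta ^+ 2).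
  move=> w0 we; have : w ^+ 2 <= (2 * eta) ^+ 2 by rewrite ler_sqr ?nnegrE // mulr_ge0.
  by move=> /(ler_wpM2l C0); rewrite exprMn; clear; lra.
have x1 : 4 * (C * eta ^+ 2) <= 1 / 100.
  have [|h _] := model_small rho0 C0 small (u := 2 * eta); first by rewrite mulr_ge0 //=; clear - er; lra.
  by move: h; rewrite exprMn; clear; lra.
set xx := C * eta ^+ 2 in x0 sm x1 *.
have -> : 20 * C * eta ^+ 2 = 20 * xx by rewrite /xx; ring.
have c0 := dge0 y z; have c0' := dge0 y' z'.
have [al0|aln0] := eqVneq (d o y) 0.
  have oy : o = y by exact: (dist_eq0 dm).
  have oy' : o = y' by apply: (dist_eq0 dm); rewrite yt al0 mulr0.
  rewrite -oy -oy' zt; have := mulr_ge0 (mulr_ge0 t0 z0) x0; clear; lra.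
have [be0|ben0] := eqVneq (d o z) 0.
  have oz : o = z by exact: (dist_eq0 dm).
  have oz' : o = z' by apply: (dist_eq0 dm); rewrite zt be0 mulr0.
  rewrite -oz -oz' (distC dm y) (distC dm y') yt; have := mulr_ge0 (mulr_ge0 t0 y0) x0; clear; lra.
have al0 : 0 < d o y by rewrite lt_def aln0.
have be0 : 0 < d o z by rewrite lt_def ben0.
have := hinge_model G by' bz' al0 be0; rewrite !(le_trans _ er) // => /(_ isT isT).
rewrite yt zt -mulrBr -(md_norm laws bounds rho0 (t * (d o y - d o z))) -(md_norm laws bounds rho0 (d o y - d o z)).
rewrite normrM (ger0_norm t0).
have w0 := normr_ge0 (d o y - d o z).
have wc : `|d o y - d o z| <= d y z.
  rewrite ler_norml; have := dist_tri dm y o z; have := dist_tri dm z o y.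
  by rewrite (distC dm z y); clear => ? ?; apply/andP; split; lra.
have ce : d y z <= 2 * eta.
  by apply: le_trans (dist_tri dm o y z) _; rewrite (distC dm y o); clear - ye ze; lra.
have le1 v : 0 <= v -> t * v <= v by move=> v0; rewrite ler_piMl.
have ce' : d y' z' <= 2 * eta.
  apply: le_trans (dist_tri dm o y' z') _; rewrite (distC dm y' o) yt zt.
  by have := le1 _ y0; have := le1 _ z0; clear - ye ze; lra.
have tw := le1 _ w0; have tw0 := mulr_ge0 t0 w0.
have er' : 2 * eta <= rho by clear - er; lra.
have B v : 0 <= v -> v <= 2 * eta -> `|md v - v ^+ 2 / 2| <= 4 * xx * v ^+ 2.
  move=> v0 ve; have [|_] := @bounds v; first by rewrite v0 (le_trans ve).
  move=> h; apply: le_trans h _; rewrite (_ : C * v ^+ 4 = C * v ^+ 2 * v ^+ 2); last by ring.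
  by apply: ler_wpM2r; [exact: sqr_ge0|exact: sm].
have ratio v : 0 < v -> v <= eta -> t * (1 - 8 * xx) * sn v <= sn (t * v).
  move=> v0 ve; have v2e : v <= 2 * eta by clear - ve eta0; lra.
  have tv0 : 0 <= t * v by rewrite mulr_ge0 // ltW.
  have tve := le_trans (le1 _ (ltW v0)) v2e.
  have [|e1 _] := @bounds v; first by rewrite ltW // (le_trans v2e).
  have [|e2 _] := @bounds (t * v); first by rewrite tv0 (le_trans tve).
  apply: (contraction_ratio t0 x0 x1 (ltW v0) e1 e2).
    rewrite (_ : C * v ^+ 3 = C * v ^+ 2 * v); last by ring.
    by apply: ler_wpM2r; [exact: ltW|apply: sm => //; exact: ltW].
  rewrite (_ : C * (t * v) ^+ 3 = C * (t * v) ^+ 2 * (t * v)); last by ring.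
  by apply: ler_wpM2r => //; apply: sm.
have half v : v <= eta -> v <= rho by clear - er' eta0; lra.
have /andP[sa1 _] := sn_b _ (ltW al0) (half _ ye).
have /andP[sb1 _] := sn_b _ (ltW be0) (half _ ze).
have ra := ratio _ al0 ye; have rb := ratio _ be0 ze.
have sa0 : 0 < sn (d o y) by apply: lt_le_trans sa1; rewrite mulr_gt0.
have sb0 : 0 < sn (d o z) by apply: lt_le_trans sb1; rewrite mulr_gt0.
have sab := mulr_gt0 sa0 sb0.
have mdw := le_md laws bounds rho0 C0 small w0 wc (le_trans ce er').
have rab : t ^+ 2 * (1 - 16 * xx) * (sn (d o y) * sn (d o z)) <= sn (t * d o y) * sn (t * d o z).
  have q0 : 0 <= t * (1 - 8 * xx) by apply: mulr_ge0 => //; clear - x1; lra.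
  apply: le_trans (ler_pM (mulr_ge0 q0 (ltW sa0)) (mulr_ge0 q0 (ltW sb0)) ra rb).
  rewrite [X in _ <= X]mulrACA; apply: ler_wpM2r; first exact: ltW.
  rewrite [X in _ <= X]mulrACA -!expr2; apply: ler_wpM2l; first exact: sqr_ge0.
  by have := sqr_ge0 xx; clear; lra.
move=> h2; apply: (contraction_arith t0 x0 x1 (dge0 _ _) (dge0 _ _) (B _ (dge0 _ _) ce)
  (B _ (dge0 _ _) ce') (B _ w0 (le_trans wc ce)) (B _ tw0 (le_trans tw (le_trans wc ce)))).
rewrite -(ler_pM2r sab); apply: le_trans h2; rewrite mulrDl [md (t * _) * _]mulrC lerD2r.
have m0 : 0 <= md (d y z) - md `|d o y - d o z| by rewrite subr_ge0.
by apply: le_trans (ler_wpM2r m0 rab); rewrite le_eqVlt; apply/orP; left; apply/eqP; ring.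
Qed.

Lemma sn_norm_bound (R : realType) (k C rho : R) (sn md : R -> R) (w c : R) :
  model_laws k sn md -> model_bounds rho C sn md -> 0 < rho -> 0 <= C ->
  `|w| <= c -> c <= rho -> `|sn w - w| <= C * c ^+ 3.
Proof.
move=> laws bounds rho0 C0 wc cr.
have w3 : C * `|w| ^+ 3 <= C * c ^+ 3.
  by apply: ler_wpM2l => //; apply: lerXn2r; rewrite ?nnegrE // (le_trans _ wc).
apply: le_trans w3; move: wc; case: (ger0P w) => w0 wc.
  by have [|h _] := @bounds w; rewrite ?w0 ?(le_trans wc cr).
have [|h _] := @bounds (- w); first by rewrite oppr_ge0 (ltW w0) (le_trans wc cr).
rewrite -normrN (_ : - (sn w - w) = sn (- w) - - w) //.
by rewrite (snN laws bounds rho0); ring.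
Qed.

(** Set [a = d e y], [c = d y z], [u = d y q], [w = d e z - a], [w' = d e q - a]. When [md (a + w)]
    and [md (a + w')] are expanded by the addition law, the terms in [md a] collapse into the factor
    [P = 1 - k * md a], and Stewart's inequality bounds [sn a * (sn w' * sn c - sn u * sn w)] below
    by a multiple of [- u * c ^ 2]. Division by [sn a], at least of order [l], gives the claim. *)
Lemma dist_semiconcaveP (R : realType) (X : Type) (d : X -> X -> R) (k C rho : R) (sn md : R -> R) :
  model_geometry d k C rho sn md -> dist_semiconcave d (rho / 2) 1.
Proof.
move=> [dm laws bounds rho0 [C0 small st]].
have sn_b := sn_bounds bounds rho0 C0 small.
have md_b := md_bounds bounds rho0 C0 small.
have cs_b := cs_bounds bounds rho0 C0 small.
have dge0 := dist_ge0 dm.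
move=> e y q z l l0 ly yr zr cr bq.
have [c0|cn0] := eqVneq (d y z) 0.
  have h1 := dge0 y q; have h2 := dge0 q z; move: bq; rewrite /between c0 => h.
  have -> : d y q = 0 by clear - h h1 h2; lra.
  by rewrite !mul0r mulr0 subr0.
have half v : v <= rho / 2 -> v <= rho by move: rho0; clear; lra.
have S := @st e y z q bq (half _ yr) (half _ zr) (half _ cr).
have [lsn _] := laws.
have vE : d q z = d y z - d y q by rewrite -bq; ring.
have h1 := dge0 y q; have h2 := dge0 q z; have h3 := dge0 y z; have h4 := dge0 e y.
have uc : d y q <= d y z by rewrite -bq lerDl.
have wc : `|d e z - d e y| <= d y z.
  have t1 := dist_tri dm y e z; have t2 := dist_tri dm z e y; rewrite (distC dm z y) in t2.
  by rewrite ler_norml; apply/andP; split; [clear - t2|clear - t1]; lra.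
have wu : `|d e q - d e y| <= d y q.
  have t3 := dist_tri dm y e q; have t4 := dist_tri dm q e y; rewrite (distC dm q y) in t4.
  by rewrite ler_norml; apply/andP; split; [clear - t4|clear - t3]; lra.
rewrite vE lsn in S.
have c0 : 0 < d y z by rewrite lt_def cn0.
move: S cn0 c0 uc wc wu h1 h3 h4 ly (half _ yr) (half _ cr).
rewrite [in md (d e z)](_ : d e z = d e y + (d e z - d e y)); last by ring.
rewrite [in md (d e q)](_ : d e q = d e y + (d e q - d e y)); last by ring.
move: (d e y) (d y z) (d y q) (d e z - d e y) (d e q - d e y) => a c u w w'.
move=> S cn0 c0 uc wc wu h1 h3 h4 la ar crr {e y q z yr zr cr bq vE h2 half}.
rewrite !(mdD laws bounds rho0) in S.
have urr : u <= rho := le_trans uc crr.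
have /andP[sa _] := sn_b _ h4 ar.
have /andP[su1 su2] := sn_b _ h1 urr.
have /andP[sc1 sc2] := sn_b _ h3 crr.
have /andP[P1 P2] := cs_b _ h4 ar.
have /andP[mc1 mc2] := md_b _ h3 crr.
have mw0 : 0 <= md w.
  rewrite -(md_norm laws bounds rho0); have /andP[+ _] := md_b _ (normr_ge0 w) (le_trans wc crr).
  by apply: le_trans; rewrite mulr_ge0 // sqr_ge0.
have mw' : md w' <= md u.
  by rewrite -(md_norm laws bounds rho0); exact: (le_md laws bounds rho0 C0 small).
have ew := sn_norm_bound laws bounds rho0 C0 wc crr; have ew' := sn_norm_bound laws bounds rho0 C0 wu urr.
have [|ec _] := @bounds c; first by rewrite h3.
have [|eu _] := @bounds u; first by rewrite h1.
set P := 1 - k * md a in P1 P2.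
have su0 : 0 <= sn u by clear - su1 h1; lra.
have sc0 : 0 <= sn c by clear - sc1 h3; lra.
have mc0 : 0 <= md c by apply: le_trans mc1; rewrite mulr_ge0 // sqr_ge0.
have P0 : 0 <= P by clear - P1; lra.
have key : - (101 / 100 * (101 / 100 * u * (51 / 100 * c ^+ 2))) <= sn a * (sn w' * sn c - sn u * sn w).
  have k1 : P * (sn u * (md w - md c) + sn c * (md u - md w')) <= sn a * (sn w' * sn c - sn u * sn w).
    by move: S; rewrite /P; clear; lra.
  apply: le_trans k1.
  have k2 : - (sn u * md c) <= sn u * (md w - md c) + sn c * (md u - md w').
    rewrite mulrBr -addrA [- _ + _]addrC addrA lerDr addr_ge0 //; first exact: mulr_ge0.
    by rewrite mulr_ge0 // subr_ge0.
  have k3 : sn u * md c <= 101 / 100 * u * (51 / 100 * c ^+ 2) by apply: ler_pM.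
  apply: le_trans (ler_wpM2l P0 k2).
  by rewrite mulrN lerN2; apply: ler_pM => //; exact: mulr_ge0.
have uc0 : 0 <= u * c ^+ 2 by rewrite mulr_ge0 // sqr_ge0.
have uc0' : 0 <= u * c ^+ 2 / l by rewrite divr_ge0 ?(ltW l0).
set Z := u * c ^+ 2 / l in uc0'.
have ZE : u * c ^+ 2 = Z * l by rewrite /Z divfK // gt_eqF.
have key2 : - (54 / 100 * Z) <= sn w' * sn c - sn u * sn w.
  have la' : 99 / 100 * l <= sn a by clear - la sa; lra.
  move: key; move: (sn w' * sn c - sn u * sn w) (sn a) la' => T A la' key.
  rewrite leNgt; apply/negP => neg.
  have n1 : T <= 0 by clear - neg uc0'; lra.
  have n2 : A * T <= 99 / 100 * l * T by rewrite ler_wnM2r.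
  have n3 : 99 / 100 * l * T < 99 / 100 * l * - (54 / 100 * Z).
    by rewrite ltr_pM2l // mulr_gt0.
  have n4 : 0 <= Z * l by rewrite mulr_ge0 // ltW.
  move: key; rewrite (_ : 101 / 100 * (101 / 100 * u * (51 / 100 * c ^+ 2)) = 101 / 100 * (101 / 100 * (51 / 100)) * (u * c ^+ 2)); last by ring.
  by rewrite ZE; clear - n2 n3 n4; lra.
have Ccl : C * c * l <= 1 / 100.
  have e1 : c * l <= rho * rho by apply: ler_pM => //; [exact: ltW|exact: le_trans la ar].
  have e2 := ler_wpM2l C0 e1.
  have e3 : 0 <= `|k| * rho ^+ 2 by rewrite mulr_ge0 // sqr_ge0.
  by move: small e2 e3; rewrite mulrDl expr2 mulrA; clear; lra.
have CZ : C * c ^+ 3 * u <= 1 / 100 * Z.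
  rewrite -(ler_pM2r l0) (_ : C * c ^+ 3 * u * l = C * c * l * (u * c ^+ 2)); last by ring.
  rewrite (_ : 1 / 100 * Z * l = 1 / 100 * (u * c ^+ 2)); last by rewrite ZE; ring.
  exact: ler_wpM2r.
have cub : u ^+ 3 * c <= c ^+ 3 * u.
  have sqc : u ^+ 2 <= c ^+ 2 by rewrite ler_sqr ?nnegrE.
  by have := ler_wpM2l (mulr_ge0 h1 h3) sqc; clear; lra.
have Ccub := ler_wpM2l C0 cub.
have A1 : `|sn c * sn w' - c * w'| <= 101 / 100 * c * (C * u ^+ 3) + C * c ^+ 3 * u.
  rewrite (_ : sn c * sn w' - c * w' = sn c * (sn w' - w') + (sn c - c) * w'); last by ring.
  by apply: le_trans (ler_normD _ _) _; rewrite !normrM (ger0_norm sc0); apply: lerD; apply: ler_pM.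
have A2 : `|sn u * sn w - u * w| <= 101 / 100 * u * (C * c ^+ 3) + C * u ^+ 3 * c.
  rewrite (_ : sn u * sn w - u * w = sn u * (sn w - w) + (sn u - u) * w); last by ring.
  by apply: le_trans (ler_normD _ _) _; rewrite !normrM (ger0_norm su0); apply: lerD; apply: ler_pM.
have -> : 1 / l * (u * c ^+ 2) = Z by rewrite /Z; field; rewrite gt_eqF.
move: A1 A2 key2 CZ Ccub uc0'; rewrite !ler_norml; clear.
by move=> /andP[? ?] /andP[? ?] ? ? ? ?; lra.
Qed.

Lemma dist_derivative_boundP (R : realType) (X : Type) (d : X -> X -> R) (k C rho : R) (sn md : R -> R) :
  model_geometry d k C rho sn md -> dist_derivative_bound d (rho / 2).
Proof.
move=> [dm laws bounds rho0 [C0 small st]].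
have sn_b := sn_bounds bounds rho0 C0 small.
have md_b := md_bounds bounds rho0 C0 small.
have cs_b := cs_bounds bounds rho0 C0 small.
have dge0 := dist_ge0 dm.
move=> x y q z tau a0 c0 tau0 ar br cr bq hb.
have half v : v <= rho / 2 -> v <= rho by move: rho0; clear; lra.
have S := @st x y z q bq (half _ ar) (half _ br) (half _ cr).
have [lsn _] := laws.
have vE : d q z = d y z - d y q by rewrite -bq; ring.
have h1 := dge0 y q; have h3 := dge0 x z; have p0 := dge0 x q.
have uc : d y q <= d y z by rewrite -bq lerDl.
rewrite vE lsn in S.
move: S a0 c0 (half _ ar) (half _ br) (half _ cr) hb h1 h3 p0 uc.
move: (d x y) (d x z) (d y z) (d y q) (d x q) => a b c u p.
move=> S a0 c0 arr brr crr hb h1 h3 p0 uc {x y q z ar br cr bq vE half st}.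
have urr := le_trans uc crr.
have /andP[su1 su2] := sn_b _ h1 urr.
have /andP[sc1 sc2] := sn_b _ (ltW c0) crr.
have /andP[P1 P2] := cs_b _ (ltW a0) arr.
have /andP[Pc1 Pc2] := cs_b _ (ltW c0) crr.
have /andP[mu1 mu2] := md_b _ h1 urr.
have /andP[ma1 ma2] := md_b _ (ltW a0) arr.
have ct : 0 <= c * tau by rewrite mulr_ge0 // ltW.
have su0 : 0 <= sn u by apply: le_trans su1; rewrite mulr_ge0.
have sc0 : 0 <= sn c by apply: le_trans sc1; rewrite mulr_ge0 // ltW.
have mu0 : 0 <= md u by apply: le_trans mu1; rewrite mulr_ge0 // sqr_ge0.
have ma0 : 0 <= md a by apply: le_trans ma1; rewrite mulr_ge0 // sqr_ge0.
have mbc : - (11 / 10 * (c * tau)) <= md b - md c.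
  have [cb|bc] := lerP c b.
    have := le_md laws bounds rho0 C0 small (ltW c0) cb brr.
    by clear - ct; lra.
  have /andP[_ h] := md_sub laws bounds rho0 C0 small h3 (ltW bc) crr.
  have : c * (c - b) <= c * tau by apply: ler_wpM2l; [exact: ltW|clear - hb; lra].
  by clear - h; lra.
have [ap|pa] := lerP a p.
  apply: le_trans ap; rewrite gerBl; apply: mulr_ge0; first by rewrite mulr_ge0.
  by rewrite addr_ge0 // divr_ge0 // ltW.
have key : - (sn u * (11 / 10 * (c * tau) + 101 / 100 * (51 / 100 * a ^+ 2))) <= (md p - md a) * sn c.
  have e1 : 0 <= (1 - k * md a) * (sn c * md u).
    by apply: mulr_ge0; [clear - P1; lra|exact: mulr_ge0].
  have e2 : md a * (1 - k * md c) <= 101 / 100 * (51 / 100 * a ^+ 2).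
    by rewrite mulrC; apply: ler_pM => //; clear - Pc1; lra.
  have e3 : sn u * (- (11 / 10 * (c * tau)) - 101 / 100 * (51 / 100 * a ^+ 2)) <=
     sn u * (md b - md c - md a * (1 - k * md c)).
    by apply: ler_wpM2l => //; clear - mbc e2; lra.
  by clear - e1 e3 S; lra.
have /andP[m1 _] := md_sub laws bounds rho0 C0 small p0 (ltW pa) arr.
set T := tau / a; set V := a / c.
have TE : tau = T * a by rewrite /T divfK // gt_eqF.
have VE : a = V * c by rewrite /V divfK // gt_eqF.
have T0 : 0 <= T by rewrite divr_ge0 // ltW.
have V0 : 0 <= V by rewrite divr_ge0 // ltW.
clearbody T V.
have k1 : (md a - md p) * sn c <= 101 / 100 * u * (c * a * (11 / 10 * T + 52 / 100 * V)).
  have -> : c * a * (11 / 10 * T + 52 / 100 * V) = 11 / 10 * (c * tau) + 52 / 100 * a ^+ 2.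
    have -> : a ^+ 2 = V * c * a by rewrite -VE expr2.
    by rewrite TE; field.
  have s0 : 0 <= 11 / 10 * (c * tau) + 52 / 100 * a ^+ 2.
    by apply: addr_ge0; apply: mulr_ge0 => //; rewrite sqr_ge0.
  have s1 := mulr_ge0 su0 (sqr_ge0 a).
  by have := ler_wpM2r s0 su2; clear - key s1; lra.
have ap0 : 0 <= a - p by rewrite subr_ge0 ltW.
have k2 : 2 / 5 * (a * (a - p)) * (99 / 100 * c) <= (md a - md p) * sn c.
  apply: ler_pM => //; first by apply: mulr_ge0 => //; apply: mulr_ge0 => //; exact: ltW.
  by apply: mulr_ge0 => //; exact: ltW.
have k3 : 396 / 1000 * (a - p) <= 101 / 100 * u * (11 / 10 * T + 52 / 100 * V).
  by rewrite -(ler_pM2r (mulr_gt0 c0 a0)); clear - k1 k2; lra.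
have uT : 0 <= u * T by rewrite mulr_ge0.
have uV : 0 <= u * V by rewrite mulr_ge0.
by clear - k3 uT uV; lra.
Qed.

(** By the doubling formula for [sn], Stewart's inequality at a midpoint is divisible by [sn u]. The
    constant 500 absorbs the Taylor errors of [md] at arguments up to [3 * u]. *)
Lemma midpoint_boundP (R : realType) (X : Type) (d : X -> X -> R) (k C rho : R) (sn md : R -> R) :
  model_geometry d k C rho sn md -> midpoint_bound d (rho / 4) (500 * (C + `|k|)).
Proof.
move=> [dm laws bounds rho0 [C0 small st]].
have sn_b := sn_bounds bounds rho0 C0 small.
have md_b := md_bounds bounds rho0 C0 small.
have cs_b := cs_bounds bounds rho0 C0 small.
have dge0 := dist_ge0 dm.
move=> w y q z u u0 ur yq qz yz wq.
have bq : between d y q z by rewrite /between yq qz yz; ring.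
have t1 := dist_tri dm q w y; have t2 := dist_tri dm q w z.
rewrite (distC dm q y) yq in t1; rewrite qz in t2.
have S := @st w y z q bq.
have {S}S : md (d w y) * sn (d q z) + (md (d w z) - md (d y z)) * sn (d y q)
      + sn (d y z) * md (d y q) <= md (d w q) * sn (d y z) by apply: S; rewrite ?yz; clear - t1 t2 wq ur u0; lra.
rewrite yq qz yz (_ : 2 * u = u + u) ?(snD laws bounds rho0) in S; last by ring.
have h1 := dge0 w y; have h2 := dge0 w z; have h3 := dge0 w q.
move: S t1 t2 h1 h2 h3 wq; set a := d w y; set b := d w z; set p := d w q.
clearbody a b p; move=> {bq yq qz yz} S t1 t2 h1 h2 h3 wq.
have u0' := ltW u0.
have ru m : 0 <= m -> m <= 4 -> m * u <= rho.
  by move=> m0 m4; apply: le_trans (ler_wpM2r u0' m4) _; clear - ur; lra.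
have urr : u <= rho by have := ru 1 ler01; rewrite mul1r; apply; clear; lra.
have /andP[su1 su2] := sn_b _ u0' urr.
have /andP[mu1 mu2] := md_b _ u0' urr.
have su0 : 0 < sn u by apply: lt_le_trans su1; rewrite mulr_gt0.
have {}S : md a + md b - md (u + u) + 2 * (1 - k * md u) * md u <= 2 * (1 - k * md u) * md p.
  by rewrite -(ler_pM2r su0); clear - S; lra.
have B v m : 0 <= v -> v <= m * u -> 0 <= m -> m <= 4 -> `|md v - v ^+ 2 / 2| <= C * (m ^+ 4 * u ^+ 4).
  move=> v0 vm m0 m4; have [|_ h] := @bounds v; first by rewrite v0 (le_trans vm) // ru.
  apply: le_trans h _; apply: ler_wpM2l => //; rewrite -exprMn.
  by apply: lerXn2r; rewrite ?nnegrE // mulr_ge0.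
have n34 : (3 : R) <= 4 by clear; lra.
have n24 : (2 : R) <= 4 by clear; lra.
have n14 : (1 : R) <= 4 by clear; lra.
have /andP[b5 _] : - (C * (3 ^+ 4 * u ^+ 4)) <= md a - a ^+ 2 / 2 <= C * (3 ^+ 4 * u ^+ 4).
  by rewrite -ler_norml; apply: B => //; clear - t1 wq; lra.
have /andP[b4 _] : - (C * (3 ^+ 4 * u ^+ 4)) <= md b - b ^+ 2 / 2 <= C * (3 ^+ 4 * u ^+ 4).
  by rewrite -ler_norml; apply: B => //; clear - t2 wq; lra.
have /andP[_ b3] : - (C * (2 ^+ 4 * u ^+ 4)) <= md p - p ^+ 2 / 2 <= C * (2 ^+ 4 * u ^+ 4).
  by rewrite -ler_norml; apply: B.
have /andP[b2 _] : - (C * (1 ^+ 4 * u ^+ 4)) <= md u - u ^+ 2 / 2 <= C * (1 ^+ 4 * u ^+ 4).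
  by rewrite -ler_norml; apply: B => //; rewrite mul1r.
have /andP[_ b1] : - (C * (2 ^+ 4 * u ^+ 4)) <= md (u + u) - (u + u) ^+ 2 / 2 <= C * (2 ^+ 4 * u ^+ 4).
  by rewrite -ler_norml; apply: B => //; [exact: addr_ge0|clear; lra].
have /andP[mp1 mp2] := md_b _ h3 (le_trans wq (ru 2 (ler0n _ _) n24)).
have pu : p ^+ 2 <= 4 * u ^+ 2.
  have : p ^+ 2 <= (2 * u) ^+ 2 by rewrite ler_sqr ?nnegrE // mulr_ge0.
  by rewrite exprMn; clear; lra.
have u2 := sqr_ge0 u; have p2 := sqr_ge0 p.
have k1 : `|k * md u * (md u - md p)| <= `|k| * (2 * u ^+ 4).
  rewrite -mulrA normrM; apply: ler_wpM2l => //.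
  rewrite normrM (_ : 2 * u ^+ 4 = 51 / 100 * u ^+ 2 * (200 / 51 * u ^+ 2)); last by field.
  apply: ler_pM => //; first by rewrite ger0_norm //; clear - mu1 u2; lra.
  by rewrite ler_norml; apply/andP; split; clear - mp1 mp2 mu1 mu2 pu u2 p2; lra.
move: k1; rewrite ler_norml => /andP[k1 k2].
have k0 : 0 <= `|k| * u ^+ 4 by rewrite mulr_ge0 // exprn_even_ge0.
have Cu0 : 0 <= C * u ^+ 4 by rewrite mulr_ge0 // exprn_even_ge0.
by clear - S b1 b2 b3 b4 b5 k1 k2 k0 Cu0; lra.
Qed.

(** In [hinge_model] with equal legs, [md (d x y)] is compared with [md (d q x + d q y)], whose
    difference to [md (d q x - d q y)] is [2 * sn (d q x) * sn (d q y)]; the excess [e] costs a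
    relative error of order [e / l]. *)
Lemma hinge_boundP (R : realType) (X : Type) (d : X -> X -> R) (k C rho : R) (sn md : R -> R) :
  model_geometry d k C rho sn md -> hinge_bound d (rho / 2) (500 * (C + `|k|)).
Proof.
move=> G; case: (G) => dm laws bounds rho0 [C0 small st].
have sn_b := sn_bounds bounds rho0 C0 small.
have md_b := md_bounds bounds rho0 C0 small.
have cs_b := cs_bounds bounds rho0 C0 small.
have dge0 := dist_ge0 dm.
move=> q x y x' y' u l e u0 l0 e0 lx ly xr yr bx' by' xu yu hs.
have al0 : 0 < d q x := lt_le_trans l0 lx.
have be0 : 0 < d q y := lt_le_trans l0 ly.
have := hinge_model G bx' by' al0 be0 xr yr; rewrite xu yu subrr (md0 bounds rho0) mulr0 addr0.
have t1 := dist_tri dm q x' y'; rewrite (distC dm x' q) xu yu in t1.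
have t2 := dist_tri dm q x y; rewrite (distC dm x q) in t2.
have s0 := dge0 x y; have c0 := dge0 x' y'; have := dge0 x' x; have := dge0 y' y.
have ux : u + d x' x = d q x by rewrite -xu bx'.
move: t1 t2 s0 c0 al0 be0 hs lx ly xr yr ux.
set al := d q x; set be := d q y; set s := d x y; set c' := d x' y'.
clearbody al be s c'; move=> t1 t2 s0 c0 al0 be0 hs lx ly xr yr ux y'0 x'0.
have [_ lmd] := laws; rewrite lmd.
have := mdD laws bounds rho0 al be.
have u0' := ltW u0.
have half v : v <= rho / 2 -> v <= rho by move: rho0; clear; lra.
have ur : u <= rho / 2 by clear - ux x'0 xr; lra.
have /andP[su1 su2] := sn_b _ u0' (half _ ur).
have /andP[sa1 _] := sn_b _ (ltW al0) (half _ xr).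
have /andP[sb1 _] := sn_b _ (ltW be0) (half _ yr).
have sa0 : 0 < sn al by apply: lt_le_trans sa1; rewrite mulr_gt0.
have sb0 : 0 < sn be by apply: lt_le_trans sb1; rewrite mulr_gt0.
have su0 : 0 < sn u by apply: lt_le_trans su1; rewrite mulr_gt0.
set Q := sn al * sn be.
have Q0 : 0 < Q by apply: mulr_gt0.
have abr : al + be <= rho by clear - xr yr; lra.
have /andP[_ m2] := md_sub laws bounds rho0 C0 small s0 t2 abr.
have m3 : (al + be) * (al + be - s) <= (al + be) * e.
  by apply: ler_wpM2l; [rewrite addr_ge0 // ltW|clear - hs; lra].
have m4 : 99 / 100 * al * (99 / 100 * be) <= Q.
  by apply: ler_pM => //; rewrite mulr_ge0 // ltW.
have m5 : l * (al + be) <= 2 * (al * be).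
  by have := ler_wpM2r (ltW be0) lx; have := ler_wpM2r (ltW al0) ly; clear; lra.
set W := e / l.
have WE : e = W * l by rewrite /W divfK // gt_eqF.
have W0 : 0 <= W by rewrite divr_ge0 // ltW.
have m6 : (al + be) * e <= 206 / 100 * (W * Q).
  have -> : (al + be) * e = W * (l * (al + be)) by rewrite {1}WE; ring.
  have : l * (al + be) <= 206 / 100 * Q by clear - m4 m5 Q0; lra.
  by move=> /(ler_wpM2l W0); clear; lra.
move=> mE hh.
have ssu : 0 <= sn u * sn u by apply: mulr_ge0; exact: ltW.
have h1 : sn u * sn u * (2 - 227 / 100 * W) <= md c'.
  have WQ : 0 <= W * Q by rewrite mulr_ge0 // ltW.
  rewrite -(ler_pM2r Q0); apply: le_trans hh.
  rewrite -[_ * _ * Q]mulrA; apply: ler_wpM2l => //.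
  by move: mE m2 m3 m6 WQ; rewrite -/Q; clearbody Q; clear; lra.
have [|_] := @bounds c'; first by rewrite c0 /=; clear - t1 ur; lra.
have [|+ _] := @bounds u; first by rewrite u0' half.
rewrite !ler_norml => /andP[b1 _] /andP[_ b2].
have c4 : c' ^+ 4 <= 16 * u ^+ 4.
  have : c' ^+ 4 <= (2 * u) ^+ 4.
    by apply: lerXn2r; rewrite ?nnegrE ?mulr_ge0 //; clear - t1; lra.
  by rewrite exprMn; clear; lra.
have Cc4 := ler_wpM2l C0 c4.
have l1 : u ^+ 2 - 2 * (C * u ^+ 4) <= sn u * sn u.
  have [|Cu2 _] := @model_small R k C rho rho0 C0 small u; first by rewrite u0' half.
  have e1 : 0 <= u - C * u ^+ 3.
    rewrite (_ : u - C * u ^+ 3 = u * (1 - C * u ^+ 2)); last by ring.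
    by apply: mulr_ge0 => //; clear - Cu2; lra.
  have e2 : u - C * u ^+ 3 <= sn u by clear - b1; lra.
  by have := ler_pM e1 e1 e2 e2; have := sqr_ge0 (C * u ^+ 3); clear; lra.
have l2 : sn u * sn u <= 103 / 100 * u ^+ 2.
  by have := ler_pM (ltW su0) (ltW su0) su2 su2; have := sqr_ge0 u; clear; lra.
have l3 := ler_wpM2r W0 l2.
have k0 : 0 <= `|k| * u ^+ 4 by rewrite mulr_ge0 // exprn_even_ge0.
have Cu0 : 0 <= C * u ^+ 4 by rewrite mulr_ge0 // exprn_even_ge0.
have Wu0 : 0 <= W * u ^+ 2 by rewrite mulr_ge0 // sqr_ge0.
by clear - h1 b2 Cc4 l1 l3 k0 Cu0 Wu0; lra.
Qed.

Definition local_geometry (R : realType) (X : Type) (d : X -> X -> R) (r K : R) : Prop :=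
  [/\ contraction_expands d r K, dist_semiconcave d r K, dist_derivative_bound d r,
      midpoint_bound d r K & hinge_bound d r K].

Lemma local_geometryP (R : realType) (X : Type) (d : X -> X -> R) kappa :
  is_metric d -> geodesic_space d -> curv_ge d kappa ->
  exists r K, [/\ 0 < r, 1 <= K, K * r ^+ 2 <= 1 / 2 & local_geometry d r K].
Proof.
move=> dm geo cv; have [k [r [C [sn [md [r0 C0 laws bounds st]]]]]] := curv_ge_stewart dm geo cv.
pose M := C + `|k| + 1.
have k0 : 0 <= `|k| by [].
have M1 : 1 <= M by rewrite /M; lra.
have M0 : 0 < M by lra.
pose rho := Num.min r (1 / (10 * M)).
have M10 : 0 < 1 / (10 * M) by apply: divr_gt0 => //; apply: mulr_gt0.
have rho0 : 0 < rho by rewrite lt_min r0.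
have rr : rho <= r by rewrite ge_min lexx.
have rM : rho * (10 * M) <= 1.
  by rewrite -ler_pdivlMr ?mulr_gt0 // ge_min lexx orbT.
have bounds' : model_bounds rho C sn md.
  by move=> u /andP[u0 ur]; apply: bounds; rewrite u0 (le_trans ur).
have st' : stewart d rho sn md.
  by move=> x y z q b h1 h2 h3; apply: st => //; apply: le_trans rr.
have sqM : M * rho ^+ 2 <= 1 / 100.
  have h : 0 <= rho * (10 * M) by rewrite mulr_ge0 ?mulr_ge0 // ltW.
  have : (rho * (10 * M)) * (rho * (10 * M)) <= 1 * 1 by apply: ler_pM.
  have e : 0 <= M * rho ^+ 2 by rewrite mulr_ge0 ?sqr_ge0 // ltW.
  have := ler_wpM2r e M1; lra.
have small : (C + `|k|) * rho ^+ 2 <= 1 / 100.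
  apply: le_trans sqM; apply: ler_wpM2r; [exact: sqr_ge0|rewrite /M; lra].
have G : model_geometry d k C rho sn md by split.
exists (rho / 16), (500 * M); split.
- by rewrite divr_gt0.
- lra.
- by rewrite exprMn; lra.
have e0 : rho / 16 <= rho / 2 by lra.
have e1 : rho / 16 <= rho / 4 by lra.
have K1 : 20 * C <= 500 * M by rewrite /M; lra.
have K2 : 500 * (C + `|k|) <= 500 * M by rewrite /M; lra.
split.
- move=> o y z y' z' t eta t01 er ye ze by' bz' yt zt.
  apply: le_trans (contraction_expandsP G t01 _ ye ze by' bz' yt zt).
    apply: ler_wpM2r; first exact: (dist_ge0 dm).
    apply: ler_wpM2l; first by case/andP: t01.
    by rewrite lerD2l lerN2; apply: ler_wpM2r; [exact: sqr_ge0|].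
  exact: le_trans e0.
- move=> e y q z l l0 ly yr zr cr bq.
  apply: le_trans (dist_semiconcaveP G l0 ly _ _ _ bq);
    try exact: le_trans e0.
  rewrite lerD2l lerN2; apply: ler_wpM2r.
    by apply: mulr_ge0; [exact: (dist_ge0 dm)|exact: sqr_ge0].
  by apply: ler_wpM2r; [rewrite invr_ge0 ltW|lra].
- move=> x y q z tau a0 c0 tau0 ar br cr bq hb.
  by apply: (dist_derivative_boundP G) bq hb => //; exact: le_trans e0.
- move=> w y q z u u0 ur yq qz yz wq.
  apply: le_trans (midpoint_boundP G u0 _ yq qz yz wq) _.
    exact: le_trans e1.
  by rewrite lerD2l; apply: ler_wpM2r; [rewrite exprn_even_ge0|].
- move=> q x y x' y' u l e u0 l0 ee lx ly xr yr bx' by' xu yu hs.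
  apply: le_trans (hinge_boundP G u0 l0 ee lx ly _ _ bx' by' xu yu hs);
    try exact: le_trans e0.
  by rewrite lerD2l lerN2; apply: ler_wpM2r; [rewrite exprn_even_ge0|].
Qed.

Definition geodesic_points (R : realType) (X : Type) (d : X -> X -> R) : Prop :=
  forall y z u, 0 <= u -> u <= d y z -> exists q, between d y q z /\ d y q = u.

(** From here on curvature is used only through this. The bound [K * r ^ 2 <= 1 / 2] lets
    contractions at scale [r] lose at most a factor 2, as in [contraction_half]. *)
Definition alex_local (R : realType) (X : Type) (d : X -> X -> R) (r K : R) : Prop :=
  [/\ is_metric d, geodesic_points d, 0 < r, 1 <= K &
      K * r ^+ 2 <= 1 / 2 /\ local_geometry d r K].

Lemma alex_localP (R : realType) (X : Type) (d : X -> X -> R) kappa :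
  is_metric d -> geodesic_space d -> curv_ge d kappa -> exists r K, alex_local d r K.
Proof.
move=> dm geo cv; have [r [K [r0 K1 Kr lg]]] := local_geometryP dm geo cv.
exists r, K; split => // y z u u0 uc.
have [|q [e1 e2]] := @geodesic_point R X d dm geo y z u; first by rewrite u0.
by exists q; split => //; rewrite /between e1 e2 addrC subrK.
Qed.

(** For distances [A], [B] from a point to the ends of a segment of half-length [u]: a displacement
    [s] from the midpoint raises their sum only by the second-order term [s ^ 2 / u]. *)
Lemma sum_le_of_sqr (R : realType) (A B u s K : R) : 0 <= A -> 0 <= B -> 0 < u -> 0 <= K ->
  A ^+ 2 + B ^+ 2 <= 2 * s ^+ 2 + 2 * u ^+ 2 + K * u ^+ 4 ->
  A + B <= 2 * u + s ^+ 2 / u + K * u ^+ 3.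
Proof.
move=> A0 B0 u0 K0 h.
have su : 0 <= s ^+ 2 / u by rewrite divr_ge0 ?sqr_ge0 // ltW.
have Ku : 0 <= K * u ^+ 3 by rewrite mulr_ge0 // exprn_ge0 // ltW.
set V := s ^+ 2 / u in su *; set W := K * u ^+ 3 in Ku *.
have VE : s ^+ 2 = V * u by rewrite /V divfK // gt_eqF.
have WE : K * u ^+ 4 = W * u by rewrite /W; ring.
have T0 : 0 <= 2 * u + V + W by clear - su Ku u0; lra.
have : (A + B) ^+ 2 <= (2 * u + V + W) ^+ 2.
  rewrite VE WE in h.
  have e1 : (A + B) ^+ 2 <= 2 * (A ^+ 2 + B ^+ 2) by have := sqr_ge0 (A - B); clear; lra.
  have e2 := sqr_ge0 (V + W).
  have e3 : 0 <= W * u by rewrite mulr_ge0 // ltW.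
  by clear - h e1 e2 e3; lra.
by rewrite ler_sqr ?nnegrE // addr_ge0.
Qed.

(* [q] is taken on [w x] near [w], so that [w] itself prolongs the geodesic from [x]
   through [q]; the direction from [q] to [y] is then almost that of [w]. *)
Lemma excess_growth (R : realType) (X : Type) (d : X -> X -> R) (r K k s rho : R) (x y z : X) :
  alex_local d r K -> 0 < k -> k <= 1 / 8 -> 0 < s -> s <= r / 4 ->
  d x z = s -> d y z = s -> d x y = 2 * s ->
  0 < rho -> rho * (80 * K) <= k ^+ 4 * s ->
  forall w v, d z w <= rho -> d z v <= rho ->
  d x v + d y v <= d x w + d y w + 8 * k * d w v.
Proof.
move=> [dm geo r0 K1 [Kr [_ conc _ midb hinge]]] k0 k8 s0 sr xz yz xy rho0 rhoK w v zw zv.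
have dge0 := dist_ge0 dm; have dC := distC dm; have tri := dist_tri dm.
have K0 : 0 <= K by clear - K1; lra.
have K00 : 0 < K by clear - K1; lra.
have k1 : k <= 1 by clear - k8; lra.
have k4 : 0 < k ^+ 4 by rewrite exprn_gt0.
have rhos : rho * 80 <= k ^+ 4 * s.
  by apply: le_trans rhoK; rewrite mulrA [X in _ <= X]mulrC ler_peMl // mulr_ge0 // ltW.
have rs : rho * 80 <= s.
  by apply: le_trans rhos _; rewrite ler_piMl ?(ltW s0) // exprn_ile1 // ltW.
have [wv0|wvn0] := eqVneq (d w v) 0.
  by rewrite wv0 mulr0 addr0 (dist_eq0 dm wv0).
set D := d w v in wvn0 *.
have D0 : 0 < D by rewrite lt_def wvn0 dge0.
have D2 : D <= 2 * rho.
  by apply: le_trans (tri z w v) _; rewrite (dC w z); clear - zw zv; lra.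
(* A fraction [k] of [D], so that replacing [w] by [q] costs at most [2 * u], a part of the allowed
   [8 * k * D]. *)
pose u := k * D.
have u0 : 0 < u by rewrite mulr_gt0.
have u4 : u <= rho / 4.
  by apply: (@le_trans _ _ (1 / 8 * (2 * rho))); [apply: ler_pM => //; exact: ltW|clear; lra].
have xw1 : s - rho <= d x w by have := tri w x z; rewrite xz (dC w z); clear - zw; lra.
have xw2 : d x w <= s + rho by have := tri z x w; rewrite xz; clear - zw; lra.
have [q [wqx wq]] : exists q, between d w q x /\ d w q = u.
  by apply: geo; [exact: ltW|rewrite (dC w x); clear - xw1 rs u4 rho0; lra].
have al : d q x = d x w - u by move: wqx; rewrite /between wq (dC w x); clear; lra.
have be1 : d q y <= d y w + u by have := tri w q y; rewrite (dC q w) wq (dC w y); clear; lra.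
have yw1 : s - rho <= d y w by have := tri w y z; rewrite yz (dC w z); clear - zw; lra.
have yw2 : d y w <= s + rho by have := tri z y w; rewrite yz; clear - zw; lra.
have be2 : d y w - u <= d q y by have := tri q y w; rewrite (dC y q) (dC q w) wq; clear; lra.
have [p [qpx qp]] : exists p, between d q p x /\ d q p = u.
  by apply: geo; [exact: ltW|rewrite al; clear - xw1 rs u4 rho0; lra].
have [b [qby qb]] : exists b, between d q b y /\ d q b = u.
  by apply: geo; [exact: ltW|clear - be2 yw1 rs u4 rho0; lra].
have px : d p x = d q x - u by move: qpx; rewrite /between qp; clear; lra.
have by' : d b y = d q y - u by move: qby; rewrite /between qb; clear; lra.
have wp : d w p = 2 * u.
  apply/eqP; rewrite eq_le; apply/andP; split.
    by have := tri q w p; rewrite wq qp; clear; lra.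
  by have := tri p w x; rewrite px al (dC w x); clear; lra.
pose l := s / 2.
have l0 : 0 < l by rewrite divr_gt0.
have lq : l <= d q x by rewrite /l al; clear - xw1 rs u4 rho0; lra.
have lqy : l <= d q y by rewrite /l; clear - be2 yw1 rs u4 rho0; lra.
have qxr : d q x <= r by rewrite al; clear - xw2 sr u0 rs s0; lra.
have qyr : d q y <= r by clear - be1 yw2 sr u4 rs s0; lra.
have hb : 4 * u ^+ 2 - 5 * (4 * rho / l) * u ^+ 2 - K * u ^+ 4 <= d p b ^+ 2.
  apply: (hinge q x y p b u l (4 * rho)) => //; first by rewrite mulr_ge0 // ltW.
  by rewrite xy al; clear - xw2 yw2 be1 rho0; lra.
have ur : u <= r by clear - u4 rs sr s0; lra.
have mb := midb b w q p u u0 ur wq qp wp.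
have {mb} mb : d b w ^+ 2 + d b p ^+ 2 <= 2 * d b q ^+ 2 + 2 * u ^+ 2 + K * u ^+ 4.
  by apply: mb; rewrite (dC b q) qb; clear - u0; lra.
have u2 : 0 <= u ^+ 2 := sqr_ge0 u.
have Ks : K * s ^+ 2 <= 1 / 2.
  apply: le_trans Kr; apply: ler_wpM2l => //; rewrite ler_sqr ?nnegrE ?(ltW s0) ?(ltW r0) //.
  by clear - sr s0 r0; lra.
have Kr2 : K * rho ^+ 2 * 6400 <= k ^+ 4 / 2.
  have e : (rho * 80) ^+ 2 <= k ^+ 4 * s ^+ 2.
    have e1 : (rho * 80) ^+ 2 <= (k ^+ 4 * s) * s.
      by rewrite expr2; apply: ler_pM => //; rewrite mulr_ge0 // ltW.
    by apply: le_trans e1 _; rewrite -mulrA -expr2.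
  have := ler_wpM2l K0 e; have := ler_wpM2l (ltW k4) Ks; clear; lra.
have Ku2 : K * u ^+ 2 <= K * rho ^+ 2.
  by apply: ler_wpM2l => //; rewrite ler_sqr ?nnegrE ?(ltW u0) ?(ltW rho0) //; clear - u4 rho0; lra.
(* The hinge at [q] has excess at most [4 * rho], so [b] is almost opposite to [p]; as [w] is
   exactly opposite, [midpoint_bound] puts [b] close to [w]. *)
have wb : d b w <= k ^+ 2 * u.
  have rl : 4 * rho / l * 10 <= k ^+ 4.
    rewrite (_ : 4 * rho / l * 10 = 40 * rho / l); last by ring.
    by rewrite ler_pdivrMr // /l; clear - rhos; lra.
  have e1 : d b w ^+ 2 <= (5 * (4 * rho / l) + 2 * (K * u ^+ 2)) * u ^+ 2.
    by move: mb hb; rewrite (dC b q) qb (dC b p); clear; lra.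
  have e2 : 5 * (4 * rho / l) + 2 * (K * u ^+ 2) <= k ^+ 4.
    by have := mulr_ge0 K0 (sqr_ge0 rho); clear - rl Kr2 Ku2; lra.
  have e3 := le_trans e1 (ler_wpM2r u2 e2).
  have : d b w ^+ 2 <= (k ^+ 2 * u) ^+ 2 by rewrite (_ : (k ^+ 2 * u) ^+ 2 = k ^+ 4 * u ^+ 2); [exact: e3|ring].
  by rewrite ler_sqr ?nnegrE // mulr_ge0 ?sqr_ge0 // ltW.
pose sg := k * u.
have sg0 : 0 < sg by rewrite mulr_gt0.
have qv1 : D - u <= d q v by have := tri q w v; rewrite wq -/D; clear; lra.
have qv2 : d q v <= D + u by have := tri w q v; rewrite (dC q w) wq -/D; clear; lra.
have uD : u <= D / 8 by rewrite /u mulrC ler_pM2l //; clear - k8; lra.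
have sgu : sg <= u by rewrite /sg ler_piMl // ltW.
have [z' [qzv qz]] : exists z', between d q z' v /\ d q z' = sg.
  by apply: geo; [exact: ltW|clear - qv1 uD sgu D0; lra].
have mz := midb z' w q p u u0 ur wq qp wp.
have {mz} mz : d z' w ^+ 2 + d z' p ^+ 2 <= 2 * sg ^+ 2 + 2 * u ^+ 2 + K * u ^+ 4.
  by move: mz; rewrite (dC z' q) qz; apply; clear - sgu u0; lra.
have AB := sum_le_of_sqr (dge0 _ _) (dge0 _ _) u0 K0 mz.
have sgE : sg ^+ 2 / u = sg * k by rewrite /sg; field; rewrite gt_eqF.
have Ku3 : K * u ^+ 3 <= sg * k.
  have e : K * u ^+ 2 <= k ^+ 2.
    apply: (le_trans Ku2).
    have : k ^+ 4 <= k ^+ 2 by rewrite (_ : k ^+ 4 = k ^+ 2 * k ^+ 2) ?ler_piMl ?sqr_ge0 ?exprn_ile1 // ?ltW //; ring.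
    by have := mulr_ge0 K0 (sqr_ge0 rho); clear - Kr2; lra.
  by have := ler_wpM2r (ltW u0) e; rewrite /sg; clear; lra.
(* The first-order change from [q] to a nearby point on the way to [v]: [x] is seen through [p], [y]
   through [b], and [b] is replaced by [w], so that [sum_le_of_sqr] applies to the segment from [w]
   to [p]. *)
have hz : d x z' + d y z' <= d x q + d y q + sg * (3 * k).
  have e1 := tri p x z'; have e2 := tri b y z'; have e3 := tri w b z'.
  rewrite (dC x p) px (dC p z') (dC q x) in e1; rewrite (dC y b) by' (dC q y) in e2.
  rewrite (dC w z') in e3.
  have e4 : k ^+ 2 * u = sg * k by rewrite /sg; ring.
  by clear - e1 e2 e3 AB wb Ku3 sgE e4; lra.
have qv0 : 0 < d q v by clear - qv1 uD D0; lra.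
have vx : d x v <= r by have := tri z x v; rewrite xz; clear - zv rs sr s0; lra.
have vy : d y v <= r by have := tri z y v; rewrite yz; clear - zv rs sr s0; lra.
have qvr : d q v <= r by clear - qv2 uD D2 rs sr s0; lra.
have c1 := conc x q z' v l l0; have c2 := conc y q z' v l l0.
rewrite (dC x q) in c1; rewrite (dC y q) in c2.
have {}c1 := c1 lq qxr vx qvr qzv; have {}c2 := c2 lqy qyr vy qvr qzv.
rewrite qz in c1 c2.
(* Semiconcavity of both distances extends the bound from the piece up to [z'] to the whole way from
   [q] to [v]. *)
have key : d x v + d y v - (d q x + d q y) <= d q v * (3 * k) + 2 * (K / l) * d q v ^+ 2.
  rewrite -(ler_pM2l sg0).
  rewrite (dC x q) (dC y q) in hz.
  have := ler_wpM2l (ltW qv0) hz; clear - c1 c2; lra.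
have Kl : 2 * (K / l) * d q v <= k.
  have e : K * rho * 80 <= k * s.
    apply: (@le_trans _ _ (k ^+ 4 * s)); first by move: rhoK; clear; lra.
    apply: ler_wpM2r; first exact: ltW.
    by rewrite (_ : k ^+ 4 = k ^+ 3 * k) ?ler_piMl ?(ltW k0) ?exprn_ile1 ?(ltW k0) //; ring.
  have e2 : d q v <= 3 * rho by clear - qv2 uD D2 rho0; lra.
  have e3 : 0 <= 2 * (K / l) by rewrite mulr_ge0 // divr_ge0 // ltW.
  apply: le_trans (ler_wpM2l e3 e2) _.
  rewrite (_ : 2 * (K / l) * (3 * rho) = (6 * (K * rho)) / l); last by ring.
  rewrite ler_pdivrMr // /l.
  by have := mulr_ge0 K0 (ltW rho0); clear - e; lra.
have key2 : d x v + d y v - (d q x + d q y) <= d q v * (4 * k).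
  apply: le_trans key _; have := ler_wpM2r (ltW qv0) Kl.
  by clear; lra.
have qvk : d q v * (4 * k) <= 9 / 2 * (k * D).
  have : d q v <= 9 / 8 * D by clear - qv2 uD; lra.
  by move=> /(ler_wpM2r (ltW k0)); clear; lra.
have : d q x + d q y <= d x w + d y w + 2 * u by rewrite al; clear - be1 u0; lra.
rewrite -mulrA; have kD : 0 <= k * D by rewrite mulr_ge0 // ltW.
by move=> e; rewrite /u in e; clear - e key2 qvk kD; lra.
Qed.

(** [excess_growth] with [8 * k = del], used in both directions. It makes the ends of a short
    geodesic a strainer pair at its midpoint. *)
Lemma excess_lipschitz (R : realType) (X : Type) (d : X -> X -> R) (r K del s : R) (x y z : X) :
  alex_local d r K -> 0 < del -> del <= 1 -> 0 < s -> s <= r / 4 ->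
  d x z = s -> d y z = s -> d x y = 2 * s ->
  exists2 rho, 0 < rho & forall w v, d z w <= rho -> d z v <= rho ->
  `|(d x w + d y w) - (d x v + d y v)| <= del * d w v.
Proof.
move=> G d0 d1 s0 sr xz yz xy; case: (G) => dm _ r0 K1 _.
have K0 : 0 < K by clear - K1; lra.
exists ((del / 8) ^+ 4 * s / (80 * K)).
  by rewrite divr_gt0 ?mulr_gt0 ?exprn_gt0 ?divr_gt0.
have h w v := excess_growth (k := del / 8) (rho := (del / 8) ^+ 4 * s / (80 * K))
   G _ _ s0 sr xz yz xy _ _ (w := w) (v := v).
have {}h w v : d z w <= (del / 8) ^+ 4 * s / (80 * K) ->
   d z v <= (del / 8) ^+ 4 * s / (80 * K) -> d x v + d y v <= d x w + d y w + del * d w v.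
  move=> zw zv; have e8 : 8 * (del / 8) = del by field.
  rewrite -[in X in _ <= X]e8; apply: h => //.
  - by rewrite divr_gt0.
  - by clear - d1; lra.
  - by rewrite divr_gt0 ?mulr_gt0 ?exprn_gt0 ?divr_gt0.
  - by rewrite divfK // gt_eqF // mulr_gt0.
move=> w v zw zv; have h1 := h w v zw zv; have h2 := h v w zv zw.
rewrite (distC dm v w) in h2; rewrite ler_norml.
by apply/andP; split; clear - h1 h2; lra.
Qed.

(** * Strainers *)

(* The pairs [e i false], [e i true] play the role of the strainer pairs of Burago, Gromov and
   Perelman; the angle conditions are replaced by their consequences for the distance functions
   on the ball of radius [rho] around [p]. *)
Definition strained (R : realType) (X : Type) (d : X -> X -> R) (r : R) (m : nat) (del : R)
  (p : X) (rho : R) (e : nat -> bool -> X) : Prop :=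
  [/\ 0 < rho, 16 * rho <= r,
   forall i b, (i < m)%N -> rho <= del * d p (e i b) /\ d p (e i b) + rho <= r / 2,
   forall i x y, (i < m)%N -> d p x <= rho -> d p y <= rho ->
     `|(d (e i false) x + d (e i true) x) - (d (e i false) y + d (e i true) y)| <= del * d x y &
   forall i j b b' x x', (i < m)%N -> (j < m)%N -> i <> j -> d p x <= rho ->
     between d x x' (e i b) -> d x x' <= rho ->
     d (e j b') x - del * d x x' <= d (e j b') x'].

Lemma le_strained (R : realType) (X : Type) (d : X -> X -> R) r m del del' p rho e :
  is_metric d -> del <= del' -> strained d r m del p rho e -> strained d r m del' p rho e.
Proof.
move=> dm le [r0 rr S0 S1 S2]; split => //.
- move=> i b im; have [h1 h2] := S0 i b im; split => //; apply: le_trans h1 _.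
  by apply: ler_wpM2r => //; exact: (dist_ge0 dm).
- move=> i x y im px py; apply: le_trans (S1 i x y im px py) _.
  by apply: ler_wpM2r => //; exact: (dist_ge0 dm).
- move=> i j b b' x x' im jm ij px bt xx; apply: le_trans (S2 i j b b' x x' im jm ij px bt xx).
  by rewrite lerD2l lerN2; apply: ler_wpM2r => //; exact: (dist_ge0 dm).
Qed.

(** If all coordinates vary little between [x] and [y], the geodesic joining them is almost
    orthogonal to the old pairs, so its ends form a further pair at its midpoint. Read backwards:
    for maximal [m] the coordinates are injective with Lipschitz inverse. *)
Lemma strained_step (R : realType) (X : Type) (d : X -> X -> R) (r K del : R) m p rho e (x y : X) :
  alex_local d r K -> 0 < del -> 70 * K * del <= 1 -> strained d r m del p rho e ->
  d p x <= rho / 4 -> d p y <= rho / 4 -> 0 < d x y ->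
  (forall i, (i < m)%N -> `|d (e i false) x - d (e i false) y| <= del * d x y) ->
  exists z rho' e', strained d r m.+1 (70 * K * del) z rho' e'.
Proof.
move=> G del0 Kd [rho0 rhor S0 S1 S2] px py xy0 Fxy.
case: (G) => dm geo r0 K1 [Kr [_ conc der _ _]].
have dge0 := dist_ge0 dm; have dC := distC dm; have tri := dist_tri dm.
have K0 : 0 < K by clear - K1; lra.
have del8 : del <= 1 / 40.
  by have := ler_wpM2r (ltW del0) K1; clear - Kd; lra.
have [z [bz xz]] : exists z, between d x z y /\ d x z = d x y / 2.
  by apply: geo; [rewrite divr_ge0|clear - xy0; lra].
pose s := d x y / 2.
have s0 : 0 < s by rewrite divr_gt0.
have xys : d x y = 2 * s by rewrite /s; field.
have {}xz : d x z = s by [].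
have zy : d z y = s by move: bz; rewrite /between xz xys; clear; lra.
have xyrho : d x y <= rho / 2.
  by apply: le_trans (tri p x y) _; rewrite (dC x p); clear - px py; lra.
have srho : s <= rho / 4 by clear - xyrho xys; lra.
have pz : d p z <= rho / 2.
  by apply: le_trans (tri x p z) _; rewrite xz; clear - px srho; lra.
have sr : s <= r / 4 by clear - srho rhor rho0; lra.
have D0 : 0 < 70 * K * del by rewrite !mulr_gt0.
have [rho1 rho10 exc] := excess_lipschitz G D0 Kd s0 sr xz (etrans (dC y z) zy) xys.
(* At most [rho1] for the excess of the new pair, and at most [del * s] because that pair is only
   [s] away from [z]. *)
pose rho' := Num.min rho1 (del * s).
have rho'0 : 0 < rho' by rewrite lt_min rho10 mulr_gt0.
have rho'1 : rho' <= rho1 by rewrite ge_min lexx.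
have rho'2 : rho' <= del * s by rewrite ge_min lexx orbT.
have rho's : rho' <= s / 40.
  by apply: (le_trans rho'2); rewrite [s / 40]mulrC ler_pM2r //; clear - del8; lra.
clearbody rho'.
have inP w : d z w <= rho' -> d p w <= rho.
  by move=> h; apply: le_trans (tri z p w) _; clear - h pz rho's srho rho0; lra.
have Kdel : del <= K * del by rewrite ler_peMl // ltW.
have dDel : del <= 70 * K * del by clear - Kdel del0; lra.
have px' : d p x <= rho by clear - px rho0; lra.
have py' : d p y <= rho by clear - py rho0; lra.
have pz' : d p z <= rho by clear - pz rho0; lra.
have far i b w : (i < m)%N -> d p w <= rho ->
    [/\ 0 < d p (e i b), d p (e i b) / 2 <= d (e i b) w, d (e i b) w <= r & rho <= del * d p (e i b)].
  move=> im pw; have [h1 h2] := S0 i b im.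
  have g0 : 0 < d p (e i b).
    by rewrite -(pmulr_rgt0 _ del0); apply: lt_le_trans h1.
  have h3 : del * d p (e i b) <= 1 / 40 * d p (e i b) by rewrite ler_pM2r.
  have t1 := tri w p (e i b); have t2 := tri p w (e i b).
  rewrite (dC w p) in t2; rewrite (dC (e i b) w); split => //.
    by clear - t1 h1 h3 pw g0; lra.
  by clear - t2 h2 pw r0; lra.
(* Semiconcavity with [l = d p (e i b) / 2]; the segment has length at most
   [rho <= del * d p (e i b)], so the error in the slope is [2 * K * del]. *)
have slope i b w o w' : (i < m)%N -> d p w <= rho -> d p o <= rho -> d w o <= rho ->
    between d w w' o ->
    d w w' * (d (e i b) o - d (e i b) w) - 2 * K * del * (d w w' * d w o)
      <= d w o * (d (e i b) w' - d (e i b) w).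
  move=> im pw po wo bt.
  have [g0 f1 f2 f3] := far i b w im pw; have [_ _ f4 _] := far i b o im po.
  have l0 : 0 < d p (e i b) / 2 by rewrite divr_gt0.
  have wor : d w o <= r by clear - wo rhor r0 rho0; lra.
  apply: le_trans (conc _ _ _ _ _ l0 f1 f2 f4 wor bt).
  rewrite lerD2l lerN2 (_ : K / (d p (e i b) / 2) = 2 * K / d p (e i b)); last first.
    by field; rewrite gt_eqF.
  rewrite mulrAC ler_pdivrMr //.
  have u0 := dge0 w w'; have c0 := dge0 w o.
  have h := ler_wpM2l (mulr_ge0 u0 c0) (le_trans wo f3).
  by have := ler_wpM2l (ltW K0) h; clear; lra.
have Gxy i b : (i < m)%N -> `|d (e i b) x - d (e i b) y| <= 2 * del * d x y.
  move=> im; have h1 := Fxy i im; have h2 := S1 i x y im px' py'.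
  have h3 : 0 <= del * d x y by rewrite mulr_ge0 // ltW.
  move: h1 h2; rewrite !ler_norml => /andP[h1 h1'] /andP[h2 h2'].
  by case: b; apply/andP; split; [clear - h1' h2 h2'|clear - h1 h2 h2'|clear - h1 h3|clear - h1' h3]; lra.
have zlow i b : (i < m)%N -> d (e i b) x - 4 * (K * del * s) <= d (e i b) z.
  move=> im; have h := slope i b x y z im px' py' _ bz.
  have {}h := h (le_trans xyrho _); have {}h := h ltac:(clear - rho0; lra).
  rewrite xz xys in h.
  have := Gxy i b im; rewrite xys ler_norml => /andP[h1 h2].
  have h3 : s * (d (e i b) y - d (e i b) x) / s - 2 * K * del * (2 * s) <= 2 * (d (e i b) z - d (e i b) x).
    rewrite -(ler_pM2l s0) mulrBr [s * (_ / s)]mulrC divfK ?gt_eqF //.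
    by clear - h; lra.
  move: h3; rewrite mulrAC divff ?gt_eqF // mul1r.
  have : del * s <= K * del * s by rewrite ler_pM2r.
  by clear - h2; lra.
(* Semiconcavity gives only lower bounds at [z]. The upper bound follows from the lower one for the
   opposite point, as the sum of the two distances is almost constant. *)
have zup i b : (i < m)%N -> d (e i b) z - 5 * (K * del * s) <= d (e i b) x.
  move=> im; have h1 := zlow i (~~ b) im; have := S1 i z x im pz' px'.
  have h3 : del * s <= K * del * s by rewrite ler_pM2r.
  rewrite (dC z x) xz ler_norml => /andP[_ h2].
  by case: b h1 => /= h1; clear - h1 h2 h3; lra.
have zupy i b : (i < m)%N -> d (e i b) z - 9 * (K * del * s) <= d (e i b) y.
  move=> im; have h1 := zup i b im; have := Gxy i b im.
  have h3 : del * s <= K * del * s by rewrite ler_pM2r.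
  rewrite xys ler_norml => /andP[h2 h2'].
  by clear - h1 h2' h3; lra.
pose e' i b := if (i < m)%N then e i b else if b then y else x.
have e'lt i b : (i < m)%N -> e' i b = e i b by rewrite /e' => ->.
have e'm b : e' m b = if b then y else x by rewrite /e' ltnn.
have newz b : d z (e' m b) = s by rewrite e'm; case: b; rewrite // dC.
have newp b : d p (e' m b) <= rho by rewrite e'm; case: b.
have newe i b b' w : (i < m)%N -> d z w <= rho' ->
    d (e i b) w - 10 * (K * del * s) <= d (e i b) (e' m b').
  move=> im zw; have t1 := tri z (e i b) w.
  have h0 : 0 <= K * del * s by rewrite !mulr_ge0 // ltW.
  have h3 : del * s <= K * del * s by rewrite ler_pM2r.
  have h4 : d (e i b) z - 9 * (K * del * s) <= d (e i b) (e' m b').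
    rewrite e'm; case: b'; first exact: zupy.
    by have := zup i b im; clear - h0; lra.
  by clear - h4 t1 zw rho'2 h3; lra.
have near_new b w : d z w <= rho' -> s / 2 <= d w (e' m b) /\ d w (e' m b) <= rho / 2.
  move=> zw; have t1 := tri w z (e' m b); have t2 := tri z w (e' m b).
  rewrite newz in t1 t2; rewrite (dC w z) in t2.
  by split; [clear - t1 zw rho's s0|clear - t2 zw rho's srho s0]; lra.
exists z, rho', e'; split => //.
- by clear - rho's srho rhor s0; lra.
- move=> i b; rewrite ltnS leq_eqVlt => /orP[/eqP ->|im].
    rewrite newz; split; last by clear - rho's sr s0 r0; lra.
    by apply: (le_trans rho'2); rewrite ler_pM2r.
  rewrite e'lt //; have [h1 h2] := S0 i b im.
  have [g0 f1 _ f3] := far i b z im pz'; rewrite (dC z (e i b)); split.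
    have : del * (d p (e i b) / 2) <= 70 * K * del * d (e i b) z.
      by apply: ler_pM; rewrite ?(ltW del0) // divr_ge0 // ltW.
    by clear - rho's srho f3 rho0; lra.
  have := tri p z (e i b); rewrite (dC z p) (dC z (e i b)).
  by clear - h2 pz rho's srho rho0; lra.
- move=> i w v; rewrite ltnS leq_eqVlt => /orP[/eqP ->|im] zw zv.
    by rewrite !e'm; apply: exc; [exact: le_trans rho'1|exact: le_trans rho'1].
  rewrite !e'lt //; apply: le_trans (S1 i w v im (inP _ zw) (inP _ zv)) _.
  exact: ler_wpM2r.
- move=> i j b b' w w'; rewrite !ltnS leq_eqVlt => /orP[/eqP ->|im];
    rewrite leq_eqVlt => /orP[/eqP ->|jm] // ij zw bt ww.
  (* Towards a new point: by [newe] an old distance drops little over the whole way, and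
     semiconcavity passes this on to the initial piece. *)
  + rewrite e'lt //; have [n1 n2] := near_new b w zw.
    have c0 : 0 < d w (e' m b) by clear - n1 s0; lra.
    have h := slope j b' w (e' m b) w' jm (inP _ zw) (newp b) ltac:(clear - n2 rho0; lra) bt.
    have h2 := newe j b' b w jm zw.
    have u0 := dge0 w w'.
    have sc : s <= 2 * d w (e' m b) by clear - n1; lra.
    rewrite -(ler_pM2l c0).
    have Ks := ler_wpM2l (mulr_ge0 (ltW K0) (ltW del0)) sc.
    have h3 : - (20 * (K * del * d w (e' m b))) <= d (e j b') (e' m b) - d (e j b') w.
      by clear - h2 Ks; lra.
    have h4 := ler_wpM2l u0 h3.
    have h5 : 0 <= K * del * d w (e' m b) * d w w' by rewrite !mulr_ge0 // ltW.
    by clear - h h4 h5; lra.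
  (* Towards an old point: [dist_derivative_bound] for the distance to a new point, with
     [tau = 10 * (K * del * s)] supplied by [newe]. *)
  + rewrite (e'lt i) // in bt; have [n1 n2] := near_new b' w zw.
    have [g0 f1 f2 f3] := far i b w im (inP _ zw).
    have a0 : 0 < d (e' m b') w by rewrite dC; clear - n1 s0; lra.
    have c0 : 0 < d w (e i b) by rewrite (dC w); apply: lt_le_trans f1; rewrite divr_gt0.
    have tau0 : 0 <= 10 * (K * del * s) by rewrite !mulr_ge0 // ltW.
    have ar : d (e' m b') w <= r by rewrite dC; clear - n2 rhor rho0; lra.
    have [_ _ br _] := far i b (e' m b') im (newp b').
    have h := der (e' m b') w w' (e i b) _ a0 c0 tau0 ar.
    rewrite (dC (e' m b') (e i b)) (dC w (e i b)) in h.
    have {}h := h br f2 bt (newe i b b' w im zw).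
    apply: le_trans h; rewrite lerD2l lerN2.
    have u0 := dge0 w w'.
    have q1 : 10 * (K * del * s) / d (e' m b') w <= 20 * (K * del).
      rewrite ler_pdivrMr // (dC (e' m b')).
      by have := ler_wpM2l (mulr_ge0 (ltW K0) (ltW del0)) n1; clear; lra.
    have q2 : d (e' m b') w / d (e i b) w <= K * del.
      rewrite ler_pdivrMr; last by rewrite dC.
      apply: (@le_trans _ _ (del * d (e i b) w)).
        rewrite (dC (e' m b')); have := ler_wpM2l (ltW del0) f1.
        by clear - n2 f3 rho0; lra.
      by rewrite ler_pM2r // dC.
    by have := ler_wpM2l u0 (lerD q1 q2); have := mulr_ge0 u0 (mulr_ge0 (ltW K0) (ltW del0)); clear; lra.
  + rewrite !e'lt // in bt *.
    have ww' : d w w' <= rho by clear - ww rho's srho s0 rho0; lra.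
    apply: le_trans (S2 i j b b' w w' im jm ij (inP _ zw) bt ww').
    by rewrite lerD2l lerN2; exact: ler_wpM2r.
Qed.

(** Moving towards [e i true] raises the coordinate [d (e i false)] and moving towards [e i false]
    lowers it, at almost unit speed. Another coordinate cannot drop much; it cannot rise much
    either, because the distance to the opposite point cannot drop much. *)
Lemma strained_move (R : realType) (X : Type) (d : X -> X -> R) (r K del : R) m p rho e i (x : X) t :
  alex_local d r K -> 0 < del -> del <= 1 -> strained d r m del p rho e -> (i < m)%N ->
  d p x <= rho / 2 -> `|t| <= rho / 2 ->
  exists2 x', d x x' <= `|t| & forall j, (j < m)%N ->
    `|d (e j false) x' - d (e j false) x - (if j == i then t else 0)| <= 2 * del * `|t|.
Proof.
move=> [dm geo r0 _ _] del0 del1 [rho0 rhor S0 S1 S2] im px tr.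
have dge0 := dist_ge0 dm; have dC := distC dm; have tri := dist_tri dm.
pose b := 0 <= t.
have px' : d p x <= rho by clear - px rho0; lra.
have te : `|t| <= d x (e i b).
  have [h1 _] := S0 i b im; have := tri x p (e i b).
  have : del * d p (e i b) <= d p (e i b) by rewrite ler_piMl.
  by clear - h1 px tr; lra.
have [x' [bt xx]] := geo x (e i b) `|t| (normr_ge0 _) te.
have px2 : d p x' <= rho by have := tri x p x'; rewrite xx; clear - px tr; lra.
have xr : d x x' <= rho by rewrite xx; clear - tr rho0; lra.
exists x'; first by rewrite xx.
have bE : d (e i b) x' - d (e i b) x = - `|t|.
  by move: bt; rewrite /between xx (dC x') (dC x); clear; lra.
have t0 := normr_ge0 t.
have dt0 := mulr_ge0 (ltW del0) t0.
move=> j jm; have := S1 j x' x jm px2 px'; rewrite (dC x' x) xx.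
rewrite ler_norml => /andP[s1 s2].
have [->|/eqP ji] := eqVneq j i.
  have := S1 i x' x im px2 px'; rewrite (dC x' x) xx ler_norml => /andP[{}s1 {}s2].
  move: bE; rewrite /b; case: (ger0P t) s1 s2 dt0 => h s1 s2 dt0 bE;
  rewrite ler_norml; apply/andP; split; clear - s1 s2 bE dt0; lra.
have l1 := S2 i j b false x x' im jm (fun h => ji (esym h)) px' bt xr.
have l2 := S2 i j b true x x' im jm (fun h => ji (esym h)) px' bt xr.
rewrite xx in l1 l2.
by rewrite subr0 ler_norml; apply/andP; split; clear - l1 l2 s1 s2 dt0; lra.
Qed.

(** A Newton-like round: the coordinates are corrected one after the other, each move adding an
    error of at most [2 * del * th] to every coordinate. The total [2 * m * del * th] is at most
    [th / 4]. *)
Lemma strained_round (R : realType) (X : Type) (d : X -> X -> R) (r K del : R) m p rho e (x : X) th v :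
  alex_local d r K -> 0 < del -> del <= 1 -> 8 * m%:R * del <= 1 ->
  strained d r m del p rho e -> 0 <= th -> th <= rho / 2 -> d p x + m%:R * th <= rho / 2 ->
  (forall i, (i < m)%N -> `|v i - d (e i false) x| <= th) ->
  exists2 x', d x x' <= m%:R * th &
    forall i, (i < m)%N -> `|v i - d (e i false) x'| <= th / 4.
Proof.
move=> G del0 del1 md S th0 thr px hv; case: (G) => dm _ _ _ _.
have tri := dist_tri dm.
pose t i := v i - d (e i false) x.
have gen k : (k <= m)%N -> exists2 x', d x x' <= k%:R * th & forall j, (j < m)%N ->
    `|d (e j false) x' - d (e j false) x - (if (j < k)%N then t j else 0)| <= k%:R * (2 * del * th).
  elim: k => [_|k IH km].
    exists x; first by rewrite (distxx dm) mul0r.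
    by move=> j jm; rewrite ltn0 !subr0 subrr normr0 mul0r.
  have [y xy hy] := IH (ltnW km).
  have kth : k%:R * th <= m%:R * th by rewrite ler_wpM2r // ler_nat ltnW.
  have py : d p y <= rho / 2 by have := tri x p y; clear - xy kth px; lra.
  have [y' yy hy'] := strained_move (t := t k) G del0 del1 S km py (le_trans (hv k km) thr).
  have tk : `|t k| <= th := hv k km.
  exists y'.
    by have := tri y x y'; rewrite -natr1 mulrDl mul1r; clear - xy yy tk; lra.
  move=> j jm; have h1 := hy j jm; have h2 := hy' j jm.
  rewrite -natr1 mulrDl mul1r.
  have -> : d (e j false) y' - d (e j false) x - (if (j < k.+1)%N then t j else 0) =
    (d (e j false) y - d (e j false) x - (if (j < k)%N then t j else 0)) +
    (d (e j false) y' - d (e j false) y - (if j == k then t k else 0)).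
    rewrite ltnS leq_eqVlt; have [->|jk] /= := eqVneq j k; first by rewrite ltnn; ring.
    by case: ifP => _; ring.
  apply: le_trans (ler_normD _ _) _; apply: lerD => //; apply: le_trans h2 _.
  by rewrite ler_pM2l // mulr_gt0.
have [x' xx h] := gen m (leqnn m).
exists x' => // i im; have := h i im; rewrite im /t => {}h.
rewrite (_ : v i - _ = - (d (e i false) x' - d (e i false) x - (v i - d (e i false) x))); last by ring.
by rewrite normrN; apply: le_trans h _; have := ler_wpM2r th0 md; clear; lra.
Qed.

Lemma geometric_small (R : realType) (a eps : R) : 0 <= a -> 0 < eps ->
  exists N, forall k, (N <= k)%N -> a / 4 ^+ k < eps.
Proof.
move=> a0 e0; have [N aN] : exists N : nat, a / eps < N%:R.
  exists (Num.bound (a / eps)); apply: archi_boundP; apply: divr_ge0 => //; exact: ltW.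
exists N => k Nk; have p0 : 0 < (4 : R) ^+ k by rewrite exprn_gt0.
rewrite ltr_pdivrMr // mulrC -ltr_pdivrMr //; apply: lt_le_trans aN _.
apply: (@le_trans _ _ k%:R); first by rewrite ler_nat.
elim: k {Nk p0} => [|k IH]; first by rewrite expr0 ler01.
have : (1 : R) <= 4 ^+ k by rewrite exprn_ege1 // ler1n.
by rewrite exprS -[k.+1]addn1 natrD; move: IH; clear; lra.
Qed.

(** Each round quarters the error, so the points form a Cauchy sequence, and its limit has the
    prescribed coordinates. *)
Lemma strained_onto (R : realType) (X : Type) (d : X -> X -> R) (r K del : R) m p rho e th v :
  alex_local d r K -> complete_metric d -> 0 < del -> del <= 1 -> 8 * m%:R * del <= 1 ->
  (0 < m)%N -> strained d r m del p rho e -> 0 <= th -> 4 * m%:R * th <= rho ->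
  (forall i, (i < m)%N -> `|v i - d (e i false) p| <= th) ->
  exists2 x, d p x <= 2 * m%:R * th & forall i, (i < m)%N -> d (e i false) x = v i.
Proof.
move=> G cpl del0 del1 md m0 S th0 thr hv; case: (G) => dm _ _ _ _.
have dge0 := dist_ge0 dm; have dC := distC dm; have tri := dist_tri dm.
pose a (k : nat) : R := th / 4 ^+ k.
have a0 k : 0 <= a k by rewrite divr_ge0 // exprn_ge0.
have aS k : a k.+1 = a k / 4 by rewrite /a exprS invfM [4^-1 * _]mulrC mulrA.
have m1 : 1 <= m%:R :> R by rewrite ler1n.
have ath k : a k <= th.
  by elim: k => [|k IH]; [rewrite /a expr0 divr1|rewrite aS; have := a0 k; clear - IH; lra].
have mth : m%:R * th <= rho / 4 by clear - thr; lra.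
(* The first bound telescopes: a round moves by at most [m * a k], which is at most
   [2 * m * (a k - a k.+1)]. *)
pose inv k x := d p x <= 2 * m%:R * (th - a k) /\
   forall i, (i < m)%N -> `|v i - d (e i false) x| <= a k.
have step (kx : nat * X) : exists x', inv kx.1 kx.2 ->
    d kx.2 x' <= m%:R * a kx.1 /\ inv kx.1.+1 x'.
  case: kx => k x /=; have [[px hx]|ninv] := pselect (inv k x); last by exists x.
  have ma := ler_wpM2l (le_trans ler01 m1) (ath k).
  have ma0 : 0 <= m%:R * a k by rewrite mulr_ge0.
  have am : a k <= m%:R * a k by rewrite ler_peMl.
  have b1 : a k <= rho / 2 by clear - mth am ma ma0; lra.
  have b2 : d p x + m%:R * a k <= rho / 2 by clear - px mth ma ma0; lra.
  have [x' xx hx'] := strained_round G del0 del1 md S (a0 k) b1 b2 hx.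
  exists x' => _; split => //; split; last by move=> i im; rewrite aS; exact: hx'.
  by have := tri x p x'; rewrite aS; clear - px xx ma0; lra.
have [g hg] := choice step.
pose u := fix u k := if k is k'.+1 then g (k', u k') else p.
have uinv k : inv k (u k).
  elim: k => [|k IH]; last by have [] := hg (k, u k) IH.
  split; first by rewrite /= (distxx dm) /a expr0 divr1 subrr mulr0.
  by move=> i im; rewrite /= /a expr0 divr1; exact: hv.
have ustep k : d (u k) (u k.+1) <= m%:R * a k by have [] := hg (k, u k) (uinv k).
have udist j k : (j <= k)%N -> d (u j) (u k) <= 2 * m%:R * a j.
  move=> /subnKC <-; move: (k - j)%N => n.
  suff : d (u j) (u (j + n)%N) <= 2 * m%:R * (a j - a (j + n)%N).
    by have := mulr_ge0 (le_trans ler01 m1) (a0 (j + n)%N); clear; lra.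
  elim: n => [|n IH]; first by rewrite addn0 (distxx dm) subrr mulr0.
  have := tri (u (j + n)%N) (u j) (u (j + n).+1); have := ustep (j + n)%N.
  have := mulr_ge0 (le_trans ler01 m1) (a0 (j + n)%N).
  by rewrite addnS aS; clear - IH; lra.
have small eps : 0 < eps -> exists N, forall k, (N <= k)%N -> 2 * m%:R * a k < eps.
  move=> e0; have mp : 0 < 2 * m%:R :> R by clear - m1; lra.
  have [N hN] := geometric_small th0 (divr_gt0 e0 mp).
  by exists N => k Nk; rewrite mulrC -ltr_pdivlMr //; exact: hN.
have [l hl] : exists l, forall eps, 0 < eps -> exists N : nat, forall k,
    (N <= k)%N -> d (u k) l < eps.
  apply: cpl => eps e0; have [N hN] := small (eps / 2) ltac:(by rewrite divr_gt0).
  exists N => j k Nj Nk; have [jk|/ltnW kj] := leqP j k.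
    by apply: le_lt_trans (udist _ _ jk) _; have := hN _ Nj; clear - e0; lra.
  by rewrite dC; apply: le_lt_trans (udist _ _ kj) _; have := hN _ Nk; clear - e0; lra.
exists l.
  apply/ler_addgt0Pr => eps e0; have [N hN] := hl _ e0.
  have := tri (u N) p l; have := hN N (leqnn N); have [h _] := uinv N.
  by have := mulr_ge0 (le_trans ler01 m1) (a0 N); clear - h; lra.
move=> i im; apply/eqP; rewrite -subr_eq0 -normr_le0; apply/ler_addgt0Pr => eps e0.
rewrite add0r; have [N hN] := hl (eps / 2) ltac:(by rewrite divr_gt0).
have [M hM] := small (eps / 2) ltac:(by rewrite divr_gt0).
pose k := maxn N M; have [_ /(_ i im) h] := uinv k.
have h1 := hN k (leq_maxl _ _); have h2 := hM k (leq_maxr _ _).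
have h3 : a k <= m%:R * a k by rewrite ler_peMl.
have t1 := tri (u k) (e i false) l; have t2 := tri l (e i false) (u k).
rewrite (dC l (u k)) in t2; move: h; rewrite !ler_norml => /andP[h h'].
have ak := a0 k.
by apply/andP; split; clear - ak h h' h1 h2 h3 t1 t2 e0; lra.
Qed.

(** * Coverings of a cube *)

Section BoxContent.
Variables (R : realType) (m : nat).

Definition clamp (s w x : R) : R := Num.min (Num.max x (s - w)) (s + w).

(* the length of the intersection of [l, l + a] with [s - w, s + w] *)
Definition seg_inter (l a s w : R) : R := clamp s w (l + a) - clamp s w l.

Lemma seg_inter_ge0 l a s w : 0 <= a -> 0 <= seg_inter l a s w.
Proof.
move=> a0; rewrite subr_ge0 /clamp; apply: le_min2 => //; apply: le_max2 => //.
by rewrite lerDl.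
Qed.

Lemma seg_inter_le l a s w : 0 <= w -> seg_inter l a s w <= 2 * w.
Proof.
move=> w0.
have h1 : clamp s w (l + a) <= s + w by rewrite ge_min lexx orbT.
have h2 : s - w <= clamp s w l by rewrite le_min le_max lexx orbT /=; lra.
rewrite /seg_inter; lra.
Qed.

Lemma seg_inter_full l a s w : 0 <= a -> s - w <= l -> l + a <= s + w ->
  seg_inter l a s w = a.
Proof.
move=> a0 h1 h2; have h3 : s - w <= l + a by lra.
have h4 : l <= s + w by lra.
rewrite /seg_inter /clamp (max_idPl h3) (max_idPl h1) (min_idPl h2) (min_idPl h4); ring.
Qed.

Lemma seg_inter_half l a s w :
  seg_inter l a s w = seg_inter l (a / 2) s w + seg_inter (l + a / 2) (a / 2) s w.
Proof. by rewrite /seg_inter (_ : l + a / 2 + a / 2 = l + a); [ring|field]. Qed.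

Definition cube_inter (l a s : nat -> R) (w : R) : R :=
  \prod_(j < m) seg_inter (l j) (a j) (s j) w.

Lemma cube_inter_ge0 l a s w : (forall j, 0 <= a j) -> 0 <= cube_inter l a s w.
Proof. by move=> a0; apply: prodr_ge0 => j _; exact: seg_inter_ge0. Qed.

Definition upd (f : nat -> R) (i : nat) (x : R) : nat -> R :=
  fun j => if j == i then x else f j.

Lemma prod_upd (F : nat -> R -> R) (f : nat -> R) (i : 'I_m) x :
  \prod_(j < m) F j (upd f i x j) = F i x * \prod_(j < m | j != i) F j (f j).
Proof.
rewrite (bigD1 i) //= /upd eqxx; congr (_ * _); apply: eq_bigr => j ji.
by rewrite -val_eqE /= in ji; rewrite (negbTE ji).
Qed.

Lemma cube_inter_half (l a s : nat -> R) (w : R) (i : 'I_m) :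
  cube_inter l a s w = cube_inter l (upd a i (a i / 2)) s w +
    cube_inter (upd l i (l i + a i / 2)) (upd a i (a i / 2)) s w.
Proof.
rewrite /cube_inter (bigD1 i) //= seg_inter_half // mulrDl.
congr (_ + _).
  by rewrite (prod_upd (fun j x => seg_inter (l j) x (s j) w)).
rewrite [RHS](bigD1 i) //= /upd eqxx; congr (_ * _); apply: eq_bigr => j ji.
by rewrite -val_eqE /= in ji; rewrite (negbTE ji).
Qed.

Variables (s : nat -> nat -> R) (w : nat -> R).

(** The cubes of half side [w k] around [s k] are too small in total to cover the box with lower
    corner [l] and sides [a]. Bisection preserves this and locates an uncovered point. *)
Definition meagre (l a : nat -> R) : Prop :=
  (\sum_(k <oo) (cube_inter l a (s k) (w k))%:E < (\prod_(j < m) a j)%:E)%E.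

Lemma meagre_half (l a : nat -> R) (i : 'I_m) : (forall j, 0 <= a j) -> meagre l a ->
  meagre l (upd a i (a i / 2)) \/ meagre (upd l i (l i + a i / 2)) (upd a i (a i / 2)).
Proof.
move=> a0 h; rewrite /meagre; apply: contrapT => /not_orP[/negP n1 /negP n2].
rewrite -!leNgt in n1 n2; move: h; apply/negP; rewrite -leNgt.
rewrite (eq_eseriesr (g := fun k => ((cube_inter l (upd a i (a i / 2)) (s k) (w k))%:E +
   (cube_inter (upd l i (l i + a i / 2)) (upd a i (a i / 2)) (s k) (w k))%:E)%E)); last first.
  by move=> k _; rewrite -EFinD -cube_inter_half.
have a0' j : 0 <= upd a i (a i / 2) j by rewrite /upd; case: eqP => // _; rewrite divr_ge0.
rewrite nneseriesD; try by move=> *; rewrite lee_fin cube_inter_ge0.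
apply: le_trans (leeD n1 n2); rewrite -EFinD lee_fin.
rewrite (prod_upd (fun _ x => x)) (bigD1 i) //=.
by rewrite -mulrDl -splitr.
Qed.

Lemma meagre_round (l : nat -> R) (a : R) : 0 <= a -> meagre l (fun=> a) ->
  exists2 l', (forall j, (j < m)%N -> l j <= l' j <= l j + a / 2) & meagre l' (fun=> a / 2).
Proof.
move=> a0 h.
have gen t : (t <= m)%N -> exists2 l', (forall j, (j < m)%N -> l j <= l' j <= l j + a / 2) /\
    (forall j, (t <= j)%N -> l' j = l j)
   & meagre l' (fun j => if (j < t)%N then a / 2 else a).
  elim: t => [_|t IH tm].
    by exists l => //; split => // j _; rewrite lexx lerDl divr_ge0.
  have [l1 [lb lequ] ml] := IH (ltnW tm).
  have a0' j : 0 <= (if (j < t)%N then a / 2 else a) by case: ifP => // _; rewrite divr_ge0.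
  have := meagre_half (Ordinal tm) a0' ml; rewrite /= ltnn.
  have -> : upd (fun j => if (j < t)%N then a / 2 else a) t (a / 2) =
            (fun j => if (j < t.+1)%N then a / 2 else a).
    by apply/funext => j; rewrite /upd [in RHS]ltnS [in RHS]leq_eqVlt; case: (j == t).
  case=> h1; [exists l1 => //|exists (upd l1 t (l1 t + a / 2)) => //].
    by split => // j tj; rewrite lequ // ltnW.
  split=> [j jm|j tj]; rewrite /upd; case: eqP => [jt|_].
  - by rewrite jt lequ // lexx andbT lerDl divr_ge0.
  - exact: lb.
  - by move: tj; rewrite jt ltnn.
  - by rewrite lequ // ltnW.
have [l' [h1 _] h2] := gen m (leqnn m); exists l' => //.
move: h2; rewrite /meagre /cube_inter.
under eq_eseriesr do under eq_bigr do rewrite ltn_ord.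
by under eq_bigr do rewrite ltn_ord.
Qed.

(** Nested meagre boxes shrink to [v]. Were [v] within [w k - ep k] of [s k] in all coordinates, a
    box of side below [ep k] would lie in the [k]-th cube, which alone would contribute the full
    volume of the box. *)
Lemma meagre_point (l ep : nat -> R) (L : R) : 0 < L -> (forall k, 0 < ep k) -> meagre l (fun=> L) ->
  exists2 v : nat -> R, (forall j, (j < m)%N -> l j <= v j <= l j + L) &
    forall k, exists2 j, (j < m)%N & w k - ep k < `|v j - s k j|.
Proof.
move=> L0 ep0 hL.
pose a n : R := L / 2 ^+ n.
have a0 n : 0 < a n by rewrite divr_gt0 // exprn_gt0.
have aS n : a n.+1 = a n / 2 by rewrite /a exprS invfM [2^-1 * _]mulrC mulrA.
have step (nl : nat * (nat -> R)) : exists l', meagre nl.2 (fun=> a nl.1) ->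
    (forall j, (j < m)%N -> nl.2 j <= l' j <= nl.2 j + a nl.1 / 2) /\ meagre l' (fun=> a nl.1.+1).
  case: nl => n l1 /=; have [ml|] := pselect (meagre l1 (fun=> a n)); last by exists l1.
  by have [l' h1 h2] := meagre_round (ltW (a0 n)) ml; exists l'; rewrite aS.
have [g hg] := choice step.
pose u := fix u n := if n is n'.+1 then g (n', u n') else l.
have um n : meagre (u n) (fun=> a n).
  elim: n => [|n IH]; first by rewrite /a expr0 divr1.
  by have [] := hg (n, u n) IH.
have ust n j : (j < m)%N -> u n j <= u n.+1 j <= u n j + a n / 2.
  by move=> jm; have [h _] := hg (n, u n) (um n); exact: h.
have mono j n p : (j < m)%N -> u n j <= u (n + p)%N j <= u n j + a n - a (n + p)%N.
  move=> jm; elim: p => [|p IH]; first by rewrite addn0 lexx /=; lra.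
  have := ust (n + p)%N j jm; rewrite addnS aS.
  by move: IH => /andP[? ?] /andP[? ?]; apply/andP; split; lra.
have cross j n p : (j < m)%N -> u n j <= u p j + a p.
  move=> jm; have [/subnKC <-|/ltnW /subnKC <-] := leqP n p.
    have /andP[h _] := mono j n (p - n)%N jm; have := a0 (n + (p - n))%N; lra.
  have /andP[_ h] := mono j p (n - p)%N jm; have := a0 (p + (n - p))%N; lra.
pose E j := [set u n j | n in setT].
pose v j := sup (E j).
have hasE j : E j !=set0 by exists (u 0%N j); exists 0%N.
have vub j n : (j < m)%N -> u n j <= v j.
  move=> jm; apply: ub_le_sup; last by exists n.
  by exists (u 0%N j + a 0%N) => _ [p _ <-]; exact: cross.
have vlb j n : (j < m)%N -> v j <= u n j + a n.
  by move=> jm; apply: ge_sup => // _ [p _ <-]; exact: cross.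
exists v.
  move=> j jm; have := vub j 0%N jm; have := vlb j 0%N jm.
  by rewrite /a expr0 divr1 /= => -> ->.
move=> k; apply: contrapT => nk.
have vs j : (j < m)%N -> `|v j - s k j| <= w k - ep k.
  by move=> jm; rewrite leNgt; apply/negP => h; apply: nk; exists j.
have [N aN] : exists N, a N < ep k.
  have [M LM] : exists M : nat, L / ep k < M%:R.
    by exists (Num.bound (L / ep k)); apply: archi_boundP; rewrite divr_ge0 ?ltW.
  exists M; rewrite /a ltr_pdivrMr ?exprn_gt0 // mulrC -ltr_pdivrMr //.
  by apply: lt_le_trans LM _; rewrite -natrX ler_nat ltnW // ltn_expl.
have : (cube_inter (u N) (fun=> a N) (s k) (w k) = \prod_(j < m) a N).
  apply: eq_bigr => j _; apply: seg_inter_full; first exact: ltW.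
  - have := vlb j N (ltn_ord j); have := vs j (ltn_ord j).
    by have := ler_norm (s k j - v j); rewrite distrC; lra.
  - have := vub j N (ltn_ord j); have := vs j (ltn_ord j).
    by have := ler_norm (v j - s k j); lra.
move=> full; have := um N; rewrite /meagre; apply/negP; rewrite -leNgt -full.
rewrite (@nneseriesD1 _ (fun k => (cube_inter (u N) (fun=> a N) (s k) (w k))%:E) k) //; last first.
  by move=> *; rewrite lee_fin cube_inter_ge0 // => *; exact: ltW.
by rewrite leeDl // nneseries_ge0 // => *; rewrite lee_fin cube_inter_ge0 // => *; exact: ltW.
Qed.

End BoxContent.

(** * Hausdorff measure of strained balls *)

Definition cball (R : realType) (X : Type) (d : X -> X -> R) (x : X) (rho : R) : set X :=
  [set y | d x y <= rho].

Lemma exprD_le2 (R : realType) (a b : R) m : 0 <= a -> 0 <= b ->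
  (a + b) ^+ m <= 2 ^+ m * (a ^+ m + b ^+ m).
Proof.
move=> a0 b0; wlog ab : a b a0 b0 / a <= b.
  move=> h; have [ab|/ltW ba] := leP a b; first exact: h.
  by rewrite addrC [a ^+ m + _]addrC; exact: h.
apply: (@le_trans _ _ ((2 * b) ^+ m)).
  by apply: lerXn2r; rewrite ?nnegrE ?addr_ge0 ?mulr_ge0 //; lra.
rewrite exprMn; apply: ler_wpM2l; first by rewrite exprn_ge0.
by rewrite lerDr exprn_ge0.
Qed.

(** Distance coordinates are 1-Lipschitz, so a cover of small total content gives cubes of small
    total volume around the images of its members, while the image of the ball contains a cube of
    side [L]. A point missed by the cubes has a preimage missed by the cover. *)
Lemma strained_hausdorff_gt0 (R : realType) (X : Type) (d : X -> X -> R) (r K del : R) m p rho e :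
  alex_local d r K -> complete_metric d -> 0 < del -> del <= 1 -> 8 * m%:R * del <= 1 ->
  (0 < m)%N -> strained d r m del p rho e ->
  (0 < hausdorff d m%:R (cball d p (rho / 2)))%E.
Proof.
move=> G cpl del0 del1 md m0 S; case: (G) => dm _ _ _ _; case: (S) => rho0 _ _ _ _.
rewrite lt_neqAle hausdorff_ge0 // andbT; apply/negP => /eqP H0.
have mp : 0 < m%:R :> R by rewrite ltr0n.
(* [4 * m * L = rho] is what [strained_onto] requires, and its bound [2 * m * L] is then
   [rho / 2]. *)
pose L := rho / (4 * m%:R).
have L0 : 0 < L by rewrite divr_gt0 // mulr_gt0.
have mL : 4 * m%:R * L = rho by rewrite /L mulrC divfK // gt_eqF // mulr_gt0.
have L16 : 0 < (L / 16) ^+ m by rewrite exprn_gt0 // divr_gt0.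
have [F [UF Fd Fs]] : exists F : nat -> set X, [/\ cball d p (rho / 2) `<=` \bigcup_i F i,
    (forall i, (diam d (F i) <= 1%:E)%E) &
    (\sum_(i <oo) hcontent d m%:R (F i) < ((L / 16) ^+ m)%:E)%E].
  apply: hausdorff_delta_cover; apply: le_lt_trans (hausdorff_delta_le _ _ _ ltr01) _.
  by rewrite -H0 lte_fin.
pose D k := if pselect (F k !=set0) then fine (diam d (F k)) else 0.
have DP k x y : F k x -> F k y -> d x y <= D k.
  move=> Fx Fy; rewrite /D; case: pselect => [_|[]] /=; last by exists x.
  have := Fd k; have := dist_le_diam d Fx Fy.
  by case: (diam d (F k)).
have D0 k : 0 <= D k.
  rewrite /D; case: pselect => //= -[x Fx].
  by rewrite fine_ge0 // (diam_ge0 dm Fx).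
have hD k : hcontent d m%:R (F k) = (D k ^+ m)%:E.
  rewrite /hcontent /D; case: pselect => F0; case: pselect => Fn /=.
  - by exfalso; case: Fn => x; rewrite F0.
  - by rewrite expr0n gtn_eqF.
  - case: Fn => x Fx; have := Fd k; have := diam_ge0 dm Fx.
    by case: (diam d (F k)) => [a| |] //= a0 _; rewrite powR_mulrn.
  - by exfalso; apply: F0; apply/seteqP; split => // x Fx; apply: Fn; exists x.
have /choice [c hc] : forall k, exists c, F k !=set0 -> F k c.
  move=> k; have [[c Fc]|n0] := pselect (F k !=set0); first by exists c.
  by exists p.
pose s k j := d (e j false) (c k).
(* [D k] may vanish and [meagre_point] needs a positive margin; these enlargements add at most
   [(L / 4) ^ m] to the total. *)
pose ep k : R := L / 16 / (2 ^ k.+1)%:R.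
have ep0 k : 0 < ep k.
  by apply: divr_gt0; [exact: divr_gt0|rewrite ltr0n expn_gt0].
pose l j := d (e j false) p.
have mea : meagre m s (fun k => D k + ep k) l (fun=> L).
  rewrite /meagre.
  have bd k : cube_inter m l (fun=> L) (s k) (D k + ep k) <=
      4 ^+ m * D k ^+ m + (L / 4) ^+ m / (2 ^ k.+1)%:R.
    apply: (@le_trans _ _ ((2 * (D k + ep k)) ^+ m)).
      rewrite -[X in _ <= _ ^+ X]card_ord -prodr_const; apply: ler_prod => j _.
      rewrite seg_inter_ge0 ?(ltW L0) //=; apply: seg_inter_le.
      by rewrite addr_ge0 // ltW.
    rewrite exprMn; apply: (@le_trans _ _ (2 ^+ m * (2 ^+ m * (D k ^+ m + ep k ^+ m)))).
      by apply: ler_wpM2l; [rewrite exprn_ge0|apply: exprD_le2 => //; exact: ltW].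
    rewrite mulrA -exprMn -natrM mulrDr lerD2l.
    have q0 : 0 < (2 ^ k.+1)%:R :> R by rewrite ltr0n expn_gt0.
    have q1 : (2 ^ k.+1)%:R ^+ m >= (2 ^ k.+1)%:R :> R.
      by rewrite -[X in X <= _]expr1 ler_eXn2l // ltr1n -[1%N](expn0 2) ltn_exp2l.
    rewrite /ep expr_div_n mulrA -exprMn (_ : (2 * 2)%:R * (L / 16) = L / 4); last by field.
    apply: ler_wpM2l; first by rewrite exprn_ge0 // divr_ge0 // ltW.
    by rewrite lef_pV2 ?posrE // exprn_gt0.
  apply: le_lt_trans (_ : _ <= \sum_(k <oo) ((4 ^+ m * D k ^+ m)%:E +
     ((L / 4) ^+ m / (2 ^ k.+1)%:R)%:E))%E _.
    apply: lee_nneseries => [k _ _|k _]; last by rewrite -EFinD lee_fin.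
    by rewrite lee_fin cube_inter_ge0 // => *; exact: ltW.
  have L4 : 0 <= (L / 4) ^+ m by rewrite exprn_ge0 // divr_ge0 // ltW.
  apply: le_lt_trans (epsilon_trick _ _ L4) _.
    by move=> k; rewrite lee_fin mulr_ge0 // exprn_ge0.
  have -> : (\sum_(i <oo) (4 ^+ m * D i ^+ m)%:E = (4 ^+ m)%:E * \sum_(i <oo) hcontent d m%:R (F i))%E.
    rewrite -nneseriesZl; last by move=> *; exact: hcontent_ge0.
    by apply: eq_eseriesr => k _; rewrite hD EFinM.
  apply: (@le_lt_trans _ _ ((4 ^+ m)%:E * ((L / 16) ^+ m)%:E + ((L / 4) ^+ m)%:E)%E).
    by rewrite leeD2rE // lee_pmul2l ?lte_fin ?exprn_gt0 //; exact: ltW.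
  (* What remains is [2 * (L / 4) ^ m < L ^ m], true since [4 ^ m >= 4]. *)
  rewrite -EFinM -EFinD lte_fin -exprMn (_ : 4 * (L / 16) = L / 4); last by field.
  rewrite prodr_const card_ord expr_div_n.
  have h4 : (4 : R) <= 4 ^+ m by rewrite -[X in X <= _]expr1 ler_eXn2l // ltr1n.
  have Lm : 0 < L ^+ m by rewrite exprn_gt0.
  rewrite -mulrDl ltr_pdivrMr; last by lra.
  by have := ler_wpM2l (ltW Lm) h4; lra.
have [v vl vk] := meagre_point L0 ep0 mea.
have [x px Fx] : exists2 x, d p x <= 2 * m%:R * L & forall i, (i < m)%N -> d (e i false) x = v i.
  apply: (strained_onto G cpl del0 del1 md m0 S (ltW L0)); first by rewrite mL.
  move=> i im; have := vl i im; rewrite /l => /andP[h1 h2].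
  by rewrite ger0_norm ?subr_ge0 //; lra.
have [k _ Fkx] : (\bigcup_i F i) x by apply: UF; rewrite /cball /= ; lra.
have [j jm] := vk k; rewrite addrK -(Fx j jm) /s.
have Fc : F k (c k) by apply: hc; exists x.
apply/negP; rewrite -leNgt; apply: le_trans (DP _ _ _ Fkx Fc).
have t1 := dist_tri dm x (e j false) (c k); have t2 := dist_tri dm (c k) (e j false) x.
rewrite (distC dm (c k) x) in t2.
by rewrite ler_norml; apply/andP; split; lra.
Qed.

Lemma grid_cell (R : realType) (N : nat) (eta t : R) : 0 <= t -> t <= N.+1%:R * eta ->
  exists k : 'I_N.+1, k%:R * eta <= t <= k%:R * eta + eta.
Proof.
move=> t0; elim: N => [|N IH] h.
  by exists ord0; rewrite mul0r t0 add0r -[eta]mul1r.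
have [/IH [k hk]|lt] := leP t (N.+1%:R * eta).
  by exists (widen_ord (leqnSn _) k).
by exists ord_max; rewrite /= (ltW lt) -[X in _ + X]mul1r -mulrDl natr1.
Qed.

(** The cells of a grid of mesh [eta] pull back to sets of diameter at most [eta / del], and their
    number times [(eta / del) ^ m] does not depend on the mesh. *)
Lemma chart_hausdorff_lty (R : realType) (X : Type) (d : X -> X -> R) m del p rho (F : nat -> X -> R) :
  is_metric d -> 0 < del -> 0 < rho ->
  (forall i x, (i < m)%N -> `|F i x - F i p| <= d p x) ->
  (forall x y, cball d p rho x -> cball d p rho y -> x <> y ->
     exists2 i, (i < m)%N & del * d x y < `|F i x - F i y|) ->
  (hausdorff d m%:R (cball d p rho) < +oo)%E.
Proof.
move=> dm del0 rho0 F1 Finj.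
suff : (hausdorff d m%:R (cball d p rho) <= ((2 * rho / del) ^+ m)%:E)%E.
  by move=> h; apply: le_lt_trans h _; rewrite ltry.
apply: (hausdorff_le_finite_cover dm) => // eps eps0.
have [N hN] : exists N : nat, 2 * rho / del / eps < N%:R.
  by exists (Num.bound (2 * rho / del / eps)); apply: archi_boundP; rewrite !divr_ge0 ?mulr_ge0 // ltW.
have N0 : 0 < N.+1%:R :> R by rewrite ltr0n.
pose eta := 2 * rho / N.+1%:R.
have eta0 : 0 < eta by rewrite divr_gt0 // mulr_gt0.
pose cell (g : {ffun 'I_m -> 'I_N.+1}) : set X := [set x | cball d p rho x /\
   forall i : 'I_m, (g i)%:R * eta <= F i x - (F i p - rho) <= (g i)%:R * eta + eta].
pose g0 : {ffun 'I_m -> 'I_N.+1} := [ffun=> ord0].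
exists (N.+1 ^ m)%N, (eta / del), (fun i => cell (nth g0 (enum {ffun 'I_m -> 'I_N.+1}) i)); split.
- apply/andP; split; first by rewrite divr_ge0 // ltW.
  rewrite (_ : eta / del = 2 * rho / del / N.+1%:R); last by rewrite /eta mulrAC.
  rewrite ler_pdivrMr // [eps * _]mulrC -ler_pdivrMr //.
  by apply: ltW; apply: lt_le_trans hN _; rewrite ler_nat.
- move=> x px.
  have /choice [g hg] : forall i : 'I_m, exists k : 'I_N.+1,
      k%:R * eta <= F i x - (F i p - rho) <= k%:R * eta + eta.
    move=> i; have := F1 i x (ltn_ord i); rewrite ler_norml => /andP[h1 h2].
    have px' : d p x <= rho := px.
    apply: grid_cell; first lra.
    by rewrite /eta mulrC divfK ?gt_eqF //; lra.
  exists (index [ffun i => g i] (enum {ffun 'I_m -> 'I_N.+1})).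
    rewrite -[X in (_ < X ^ _)%N]card_ord -[X in (_ < _ ^ X)%N]card_ord -card_ffun cardE.
    by rewrite index_mem mem_enum.
  rewrite /= nth_index ?mem_enum //; split => // i; rewrite ffunE; exact: hg.
- move=> k x y [px hx] [py hy].
  have [->|xy] := pselect (x = y); first by rewrite (distxx dm) divr_ge0 // ltW.
  have [i im h] := Finj x y px py xy.
  rewrite ler_pdivlMr // mulrC; apply: ltW; apply: lt_le_trans h _.
  have /andP[a1 a2] := hx (Ordinal im); have /andP[b1 b2] := hy (Ordinal im).
  by rewrite /= in a1 a2 b1 b2; rewrite ler_norml; apply/andP; split; lra.
- rewrite powR_mulrn; last by rewrite divr_ge0 // ltW.
  rewrite natrX -exprMn.
  by rewrite mulrA /eta [_ * (2 * rho / _)]mulrC divfK // gt_eqF.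
Qed.

(** * Contractions and the transfer of measure between balls *)

Lemma contraction_map (R : realType) (X : Type) (d : X -> X -> R) (r K : R) (o : X) (t : R) :
  alex_local d r K -> 0 <= t <= 1 ->
  exists phi : X -> X, forall y, between d o (phi y) y /\ d o (phi y) = t * d o y.
Proof.
move=> [dm geo _ _ _] /andP[t0 t1];
suff /choice [phi h] : forall y, exists z, between d o z y /\ d o z = t * d o y by exists phi.
move=> y.
have y0 := dist_ge0 dm o y.
have [|q [h1 h2]] := geo o y (t * d o y) (mulr_ge0 t0 y0); first by rewrite ler_piMl.
by exists q.
Qed.

Lemma contraction_half (R : realType) (X : Type) (d : X -> X -> R) (r K : R) (o : X) (t : R)
    (phi : X -> X) : alex_local d r K -> 0 <= t <= 1 ->
  (forall y, between d o (phi y) y /\ d o (phi y) = t * d o y) ->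
  forall y z, d o y <= r -> d o z <= r -> t / 2 * d y z <= d (phi y) (phi z).
Proof.
move=> [dm _ _ _ [Kr [ce _ _ _ _]]] t01 h y z yr zr.
have [h1 h2] := h y; have [h3 h4] := h z.
apply: le_trans (ce o y z _ _ t r t01 (lexx _) yr zr h1 h3 h2 h4).
apply: ler_wpM2r; first exact: dist_ge0 dm _ _.
by apply: ler_wpM2l; [case/andP: t01|lra].
Qed.

Lemma contraction_hausdorff (R : realType) (X : Type) (d : X -> X -> R) (r K s : R) (o : X)
    (t R0 : R) (A : set X) : alex_local d r K -> 0 <= s -> 0 < t -> t <= 1 -> R0 <= r ->
  A `<=` cball d o R0 ->
  (((t / 2) `^ s)%:E * hausdorff d s A <= hausdorff d s (cball d o (t * R0)))%E.
Proof.
move=> G s0 t0 t1 Rr AR; case: (G) => dm _ _ _ _.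
have t01 : 0 <= t <= 1 by rewrite ltW.
have [phi hphi] := contraction_map o G t01.
apply: (hausdorff_expand dm (phi := phi)) => //; first by rewrite divr_gt0.
  move=> x Ax; rewrite /cball /=; have [_ ->] := hphi x.
  by rewrite ler_pM2l //; exact: AR.
move=> x y Ax Ay; apply: (contraction_half G t01 hphi).
  exact: le_trans (AR _ Ax) Rr.
exact: le_trans (AR _ Ay) Rr.
Qed.

Lemma sub_cball (R : realType) (X : Type) (d : X -> X -> R) x y (a b : R) :
  is_metric d -> d y x + a <= b -> cball d x a `<=` cball d y b.
Proof.
move=> dm h z; rewrite /cball /= => xz; have := dist_tri dm x y z; lra.
Qed.

Lemma chain_ind (R : realType) (X : Type) (d : X -> X -> R) (r K : R) (p : X) (P : X -> Prop) :
  alex_local d r K -> (forall x, d p x <= r / 2 -> P x) ->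
  (forall x y, P y -> d y x <= r / 2 -> P x) -> forall x, P x.
Proof.
move=> [dm geo r0 _ _] P0 Ps.
suff h k : forall x, d p x <= k%:R * (r / 2) -> P x.
  move=> x; apply: (h (Num.bound (d p x / (r / 2)))).
  rewrite -ler_pdivrMr ?divr_gt0 //; apply: ltW; apply: archi_boundP.
  by rewrite divr_ge0 ?(dist_ge0 dm) // divr_ge0 // ltW.
elim: k => [|k IH] x px.
  by apply: P0; apply: le_trans px _; rewrite mul0r divr_ge0 // ltW.
have [le|gt] := leP (d p x) (r / 2); first exact: P0.
have [y [bt xy]] := geo x p (r / 2) ltac:(by rewrite divr_ge0 // ltW)
   ltac:(by rewrite (distC dm); exact: ltW).
apply: (Ps x y); last by rewrite (distC dm) xy.
apply: IH; move: bt px; rewrite /between xy (distC dm y p) (distC dm x p) -[k.+1]addn1 natrD mulrDl mul1r.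
lra.
Qed.

(** Contraction of a large ball into a small one bounds the measure of the former by a multiple of
    that of the latter. [Q] stands for vanishing or for finiteness of the measure. *)
Lemma hausdorff_ball_transfer (R : realType) (X : Type) (d : X -> X -> R) (r K s rho : R) p
    (Q : \bar R -> Prop) :
  alex_local d r K -> 0 <= s -> 0 < rho ->
  (forall c (a b : \bar R), 0 < c -> (0 <= a)%E -> (c%:E * a <= b)%E -> Q b -> Q a) ->
  Q (hausdorff d s (cball d p rho)) -> forall x, Q (hausdorff d s (cball d x (r / 2))).
Proof.
move=> G s0 rho0 Qc Qp; case: (G) => dm geo r0 _ _.
have pow0 t : 0 < t -> 0 < (t / 2) `^ s by move=> t0; rewrite powR_gt0 // divr_gt0.
have Qm A B : A `<=` B -> Q (hausdorff d s B) -> Q (hausdorff d s A).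
  move=> AB; apply: (Qc 1) => //; first exact: hausdorff_ge0.
  by rewrite mul1e; exact: le_hausdorff.
pose t := Num.min 1 (rho / r).
have t0 : 0 < t by rewrite lt_min ltr01 divr_gt0.
have t1 : t <= 1 by rewrite ge_min lexx.
have tr : t * r <= rho by rewrite -ler_pdivlMr // ge_min lexx orbT.
have Qr : Q (hausdorff d s (cball d p r)).
  apply: (Qc _ _ (hausdorff d s (cball d p (t * r))) (pow0 _ t0)); first exact: hausdorff_ge0.
    exact: (contraction_hausdorff G).
  by apply: Qm Qp => x; rewrite /cball /= => h; exact: le_trans tr.
apply: (chain_ind (p := p) G).
  by move=> x px; apply: Qm Qr; apply: sub_cball => //; lra.
move=> x y Qy yx.
apply: (Qc _ _ (hausdorff d s (cball d y (1 / 2 * r))) (pow0 (1 / 2) _)); rewrite ?divr_gt0 //.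
- exact: hausdorff_ge0.
- apply: (contraction_hausdorff G) => //; [lra|].
  by apply: sub_cball => //; lra.
by rewrite (_ : 1 / 2 * r = r / 2) //; field.
Qed.

(** Here contractions serve the other way: a ball of positive measure is contracted into an
    arbitrarily small ball around a nearby point. *)
Lemma hausdorff_ball_gt0 (R : realType) (X : Type) (d : X -> X -> R) (r K s rho : R) p :
  alex_local d r K -> 0 <= s -> rho <= r / 2 ->
  (0 < hausdorff d s (cball d p rho))%E ->
  forall x e, 0 < e -> (0 < hausdorff d s (cball d x e))%E.
Proof.
move=> G s0 rhor Hp; case: (G) => dm geo r0 _ _.
have step x y a : (0 < hausdorff d s (cball d y a))%E -> a <= r / 2 -> d y x <= r / 2 ->
    forall e, 0 < e -> (0 < hausdorff d s (cball d x e))%E.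
  move=> Hy ar yx e e0; pose t := Num.min 1 (e / r).
  have t0 : 0 < t by rewrite lt_min ltr01 divr_gt0.
  have t1 : t <= 1 by rewrite ge_min lexx.
  have tr : t * r <= e by rewrite -ler_pdivlMr // ge_min lexx orbT.
  have sub : cball d y a `<=` cball d x r.
    by apply: sub_cball => //; rewrite (distC dm x y); lra.
  apply: lt_le_trans (le_hausdorff d s (A := cball d x (t * r)) _).
    apply: lt_le_trans (contraction_hausdorff G s0 t0 t1 (lexx r) sub).
    by rewrite mule_gt0 // lte_fin powR_gt0 // divr_gt0.
  by move=> z; rewrite /cball /= => h; exact: le_trans tr.
apply: (chain_ind (p := p) G); first by move=> x px; exact: (step x p rho).
move=> x y Hy yx; apply: (step x y (r / 2)) => //.
by apply: Hy; rewrite divr_gt0.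
Qed.

(** Vanishing in dimension [s1] supplies a countable cover by sets of diameter at most [a], that is,
    a form of separability. *)
Lemma hausdorff_setT_eq0 (R : realType) (X : Type) (d : X -> X -> R) (s s1 a : R) :
  is_metric d -> 0 <= s -> 0 < a -> hausdorff d s1 setT = 0%E ->
  (forall x, hausdorff d s (cball d x a) = 0%E) -> hausdorff d s setT = 0%E.
Proof.
move=> dm s0 a0 H1 Hb.
have [F [UF Fd _]] : exists F : nat -> set X, [/\ setT `<=` \bigcup_i F i,
    (forall i, (diam d (F i) <= a%:E)%E) & (\sum_(i <oo) hcontent d s1 (F i) < 1%:E)%E].
  apply: hausdorff_delta_cover; apply: le_lt_trans (hausdorff_delta_le _ _ _ a0) _.
  by rewrite H1 lte_fin.
have HF i : hausdorff d s (F i) = 0%E.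
  have [[c Fc]|/set0P/negP] := pselect (F i !=set0); last first.
    by rewrite negbK => /eqP ->; exact: hausdorff_set0.
  apply/eqP; rewrite eq_le hausdorff_ge0 // andbT -(Hb c); apply: le_hausdorff => x Fx.
  by have := le_trans (dist_le_diam d Fc Fx) (Fd i); rewrite lee_fin.
apply/eqP; rewrite eq_le hausdorff_ge0 // andbT.
apply: le_trans (le_hausdorff d s UF) _; apply: le_trans (hausdorff_sigma d F s0) _.
by rewrite eseries0.
Qed.

(** The Hausdorff dimension is an infimum and by itself gives neither positive nor finite
    [n]-dimensional measure; both come from a strainer of maximal length [m], and [m = n] is a
    consequence. *)
Lemma alex_regular (R : realType) (X : Type) (d : X -> X -> R) (r K : R) n (x0 x1 : X) :
  alex_local d r K -> complete_metric d -> hausdorff_dim d = (n%:R)%:E -> x0 <> x1 ->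
  [/\ (0 < n)%N, (forall x, (hausdorff d n%:R (cball d x (r / 2)) < +oo)%E) &
      forall x e, 0 < e -> (0 < hausdorff d n%:R (cball d x e))%E].
Proof.
move=> G cpl dimn x01; case: (G) => dm geo r0 K1 _.
have K0 : 0 < K by lra.
pose P m := forall del, 0 < del -> exists p rho e, strained d r m del p rho e.
have null s : n%:R < s -> hausdorff d s setT = 0%E.
  move=> ns; have : (hausdorff_dim d < s%:E)%E by rewrite dimn lte_fin.
  move=> /ereal_inf_lt [_ [s' [s'0 Hs'] <-]]; rewrite lte_fin => lt.
  by apply: (hausdorff_eq0_dim dm s'0 lt); rewrite Hs'.
pose dl m : R := 1 / (8 * m.+1%:R).
have dlP m : [/\ 0 < dl m, dl m <= 1 & 8 * m%:R * dl m <= 1].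
  have p0 : 0 < 8 * m.+1%:R :> R by rewrite mulr_gt0 ?ltr0n.
  have p1 : 1 <= m.+1%:R :> R by rewrite ler1n.
  have p2 : m%:R <= m.+1%:R :> R by rewrite ler_nat.
  split; first by rewrite divr_gt0.
    by rewrite /dl ler_pdivrMr //; lra.
  by rewrite /dl mulrA mulr1 ler_pdivrMr //; lra.
have Pn m : P m -> (m <= n)%N.
  move=> Pm; rewrite leqNgt; apply/negP => nm.
  have [d0 d1 d8] := dlP m; have [p [rho [e S]]] := Pm _ d0.
  have := strained_hausdorff_gt0 G cpl d0 d1 d8 (leq_ltn_trans (leq0n _) nm) S.
  apply/negP; rewrite -leNgt.
  have <- := null m%:R ltac:(by rewrite ltr_nat).
  by apply: le_hausdorff => x.
have [m Pm nPm] : exists2 m, P m & ~ P m.+1.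
  apply: contrapT => h.
  have : forall m, P m.
    elim=> [|m IH]; last by apply: contrapT => nP; apply: h; exists m.
    move=> del _; exists x0, (r / 16), (fun _ _ => x0); split => //.
    - by rewrite divr_gt0.
    - by rewrite mulrC divfK ?pnatr_eq0.
  by move=> /(_ n.+1) /Pn; rewrite ltnn.
have [d1 [d10 nd1]] : exists d1, 0 < d1 /\ forall p rho e, ~ strained d r m.+1 d1 p rho e.
  apply: contrapT => h; apply: nPm => del del0; apply: contrapT => hn.
  by apply: h; exists del; split => // p rho e S; apply: hn; exists p, rho, e.
have [dl0 dl1 dl8] := dlP m.
(* Small enough for [strained_onto], and such that [strained_step] would reach the impossible
   quality [d1] with [m.+1] pairs; hence its assumption on [x] and [y] must fail, which is [inj]. *)
pose del := Num.min (dl m) (Num.min 1 d1 / (70 * K)).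
have K70 : 0 < 70 * K by rewrite mulr_gt0.
have mn0 : 0 < Num.min 1 d1 by rewrite lt_min ltr01.
have del0 : 0 < del by rewrite lt_min dl0 divr_gt0.
have deldl : del <= dl m by rewrite ge_min lexx.
have Kdel : 70 * K * del <= Num.min 1 d1.
  by rewrite mulrC -ler_pdivlMr // ge_min lexx orbT.
have [p [rho [e S]]] := Pm _ del0; case: (S) => rho0 rhor _ _ _.
have rho40 : 0 < rho / 4 by rewrite divr_gt0.
have inj x y : cball d p (rho / 4) x -> cball d p (rho / 4) y -> x <> y ->
     exists2 i, (i < m)%N & del * d x y < `|d (e i false) x - d (e i false) y|.
  move=> px py xy; apply: contrapT => h.
  have xy0 : 0 < d x y.
    by rewrite lt_def (dist_ge0 dm) andbT; apply/eqP => /(dist_eq0 dm).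
  have Kdel1 : 70 * K * del <= 1 by apply: le_trans Kdel _; rewrite ge_min lexx.
  have [i im|z [rho' [e' S']]] := strained_step G del0 Kdel1 S px py xy0.
    by rewrite leNgt; apply/negP => lt; apply: h; exists i.
  apply: (nd1 z rho' e'); apply: (le_strained dm _ S').
  by apply: le_trans Kdel _; rewrite ge_min lexx orbT.
(* For [m = 0], [inj] would leave only one point in the ball, but a geodesic from [p] has other
   points near [p]. *)
have m0 : (0 < m)%N.
  rewrite lt0n; apply/eqP => m0.
  have [q pq] : exists q, p <> q.
    have [p0|] := pselect (p = x0); last by exists x0.
    by exists x1; rewrite p0.
  have pq0 : 0 < d p q by rewrite lt_def (dist_ge0 dm) andbT; apply/eqP => /(dist_eq0 dm).
  pose u := Num.min (rho / 4) (d p q).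
  have u0 : 0 < u by rewrite lt_min rho40.
  have [z [_ pz]] := geo p q u (ltW u0) ltac:(by rewrite ge_min lexx orbT).
  have [|||i] := inj p z; rewrite /cball /= ?(distxx dm) ?pz ?m0 //.
  - exact: ltW.
  - by rewrite ge_min lexx.
  - by move=> h; move: u0; rewrite -pz h (distxx dm) ltxx.
have Fl i x : (i < m)%N -> `|d (e i false) x - d (e i false) p| <= d p x.
  move=> _; have t1 := dist_tri dm p (e i false) x; have t2 := dist_tri dm x (e i false) p.
  by rewrite (distC dm x p) in t2; rewrite ler_norml; apply/andP; split; lra.
have fin := chart_hausdorff_lty dm del0 rho40 Fl inj.
(* If [m < n], finite [m]-dimensional measure near [p] would make the [(m + 1 / 2)]-dimensional
   measure vanish there, then on all balls of radius [r / 2] and on the space, against the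
   dimension. *)
have mn : m = n.
  apply/eqP; rewrite eqn_leq Pn //= leqNgt; apply/negP => mn.
  pose s : R := m%:R + 1 / 2.
  have ms : m%:R < s by rewrite /s; lra.
  have s0 : 0 <= s by apply: le_trans (ltW ms).
  have nul : hausdorff d s (cball d p (rho / 4)) = 0%E.
    exact: (hausdorff_eq0_dim dm _ ms fin).
  have Hb := hausdorff_ball_transfer (Q := fun v => v = 0%E) G s0 rho40 _ nul.
  have HT : hausdorff d s setT = 0%E.
    apply: (@hausdorff_setT_eq0 _ _ _ s (n%:R + 1) (r / 2)) => //; first by rewrite divr_gt0.
      by apply: null; rewrite ltrDl.
    apply: Hb => c a b c0 a0 le b0.
    apply/eqP; rewrite eq_le a0 andbT -(@lee_pmul2l _ c%:E) ?lte_fin //.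
    by rewrite mule0 -b0.
  have : (hausdorff_dim d <= s%:E)%E by apply: ereal_inf_lbound; exists s.
  rewrite dimn lee_fin; apply/negP; rewrite -ltNge /s.
  have : m.+1%:R <= n%:R :> R by rewrite ler_nat.
  by rewrite -[m.+1]addn1 natrD; lra.
rewrite -mn; split => //.
- apply: (hausdorff_ball_transfer (Q := fun v => (v < +oo)%E) G (ler0n _ _) rho40 _ fin).
  move=> c a b c0 a0 le; apply: contraTT; rewrite -!leNgt !leye_eq => /eqP ay.
  by move: le; rewrite ay gt0_muley ?lte_fin // leye_eq.
- have d8 : 8 * m%:R * del <= 1.
    by apply: le_trans dl8; apply: ler_wpM2l => //; rewrite mulr_ge0.
  have pos := strained_hausdorff_gt0 G cpl del0 (le_trans deldl dl1) d8 m0 S.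
  by apply: (hausdorff_ball_gt0 G _ _ pos) => //; lra.
Qed.

(** * Volume estimates *)

(** Used with [x > 0] to make powers small, and with negative [x] to bound powers of a number above
    1. *)
Lemma bernoulli_inv (R : realType) (x : R) k : x <= 1 -> (1 - x) ^+ k * (1 + k%:R * x) <= 1.
Proof.
move=> x1; elim: k => [|k IH]; first by rewrite expr0 mul0r addr0 mulr1.
rewrite exprSr -[k.+1]addn1 natrD; apply: le_trans IH.
rewrite -mulrA; apply: ler_wpM2l; first by rewrite exprn_ge0 // subr_ge0.
have : 0 <= k%:R * x ^+ 2 by rewrite mulr_ge0 // sqr_ge0.
have := sqr_ge0 x; lra.
Qed.

Lemma le0_of_geometric (R : realType) (x V q : R) : 0 <= q < 1 -> 0 <= V ->
  (forall k, x <= q ^+ k * V) -> x <= 0.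
Proof.
move=> /andP[q0 q1] V0 h; rewrite leNgt; apply/negP => x0.
pose y := 1 - q; have y0 : 0 < y by rewrite subr_gt0.
pose k := Num.bound (V / (x * y)).
have hk : V / (x * y) < k%:R by apply: archi_boundP; rewrite divr_ge0 // mulr_ge0 // ltW.
have b := @bernoulli_inv R y k ltac:(by rewrite /y; lra).
have e : 1 - y = q by rewrite /y; ring.
rewrite e in b.
have c0 : 0 < 1 + k%:R * y by rewrite ltr_pwDl // mulr_ge0 // ltW.
have : x * (1 + k%:R * y) <= V.
  apply: le_trans (ler_wpM2r (ltW c0) (h k)) _.
  by rewrite mulrAC ler_piMl.
rewrite ltr_pdivrMr ?mulr_gt0 // in hk.
lra.
Qed.

Section Volume.
Variables (R : realType) (X : Type) (d : X -> X -> R) (r K : R) (n : nat).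
Hypothesis G : alex_local d r K.
Let H := hausdorff d n%:R.
Hypothesis Hfin : forall x, (H (cball d x (r / 2)) < +oo)%E.
Hypothesis Hpos : forall x e, 0 < e -> (0 < H (cball d x e))%E.

Let dm : is_metric d. Proof. by case: G. Qed.
Let r0 : 0 < r. Proof. by case: G. Qed.
Let dC := distC dm.
Let tri := dist_tri dm.

(* real-valued; meaningful only on subsets of balls of radius at most [r / 2] *)
Definition vol (A : set X) : R := fine (H A).

Lemma volE x A : A `<=` cball d x (r / 2) -> H A = (vol A)%:E.
Proof.
move=> Ax; rewrite /vol fineK // ge0_fin_numE ?hausdorff_ge0 //.
by apply: le_lt_trans (Hfin x); exact: le_hausdorff.
Qed.

Lemma vol_ge0 A : 0 <= vol A.
Proof. by rewrite fine_ge0 // hausdorff_ge0. Qed.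

Lemma le_vol x A B : A `<=` B -> B `<=` cball d x (r / 2) -> vol A <= vol B.
Proof.
move=> AB Bx; rewrite -lee_fin -(volE (subset_trans AB Bx)) -(volE Bx).
exact: le_hausdorff.
Qed.

Lemma cballS x a b : a <= b -> cball d x a `<=` cball d x b.
Proof. by move=> ab y; rewrite /cball /= => /le_trans; apply. Qed.

Lemma vol_cball_gt0 x a : 0 < a -> a <= r / 2 -> 0 < vol (cball d x a).
Proof. by move=> a0 ar; rewrite -lte_fin -(volE (@cballS x _ _ ar)); exact: Hpos. Qed.

Lemma vol_expand x (phi : X -> X) (A B : set X) c : 0 < c ->
  (forall y, A y -> B (phi y)) ->
  (forall y z, A y -> A z -> c * d y z <= d (phi y) (phi z)) ->
  A `<=` cball d x (r / 2) -> B `<=` cball d x (r / 2) -> c ^+ n * vol A <= vol B.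
Proof.
move=> c0 AB h Ax Bx; rewrite -lee_fin EFinM -(volE Ax) -(volE Bx) -powR_mulrn ?(ltW c0) //.
by apply: (hausdorff_expand dm (phi := phi)).
Qed.

Lemma vol_doubling x a t : 0 < t -> t <= 1 -> 0 <= a -> a <= r / 2 ->
  (t / 2) ^+ n * vol (cball d x a) <= vol (cball d x (t * a)).
Proof.
move=> t0 t1 a0 ar.
have t01 : 0 <= t <= 1 by rewrite ltW.
have [phi hphi] := contraction_map x G t01.
have ta : t * a <= a by rewrite ler_piMl.
apply: (@vol_expand x phi); first by rewrite divr_gt0.
- by move=> y; rewrite /cball /=; have [_ ->] := hphi y; rewrite ler_pM2l.
- move=> y z ya za; apply: (contraction_half G t01 hphi);
    apply: le_trans (_ : a <= r) => //; have := r0; lra.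
- exact: cballS.
- by apply: cballS; apply: le_trans ar.
Qed.

Lemma vol_setU x A B : A `<=` cball d x (r / 2) -> B `<=` cball d x (r / 2) ->
  vol (A `|` B) <= vol A + vol B.
Proof.
move=> Ax Bx; have ABx : A `|` B `<=` cball d x (r / 2) by move=> y [/Ax|/Bx].
rewrite -lee_fin EFinD -(volE Ax) -(volE Bx) -(volE ABx).
exact: hausdorff_setU.
Qed.

Lemma vol_separated x A B e : 0 < e -> (forall y z, A y -> B z -> e <= d y z) ->
  A `<=` cball d x (r / 2) -> B `<=` cball d x (r / 2) -> vol A + vol B <= vol (A `|` B).
Proof.
move=> e0 AB Ax Bx; have ABx : A `|` B `<=` cball d x (r / 2) by move=> y [/Ax|/Bx].
rewrite -lee_fin EFinD -(volE Ax) -(volE Bx) -(volE ABx).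
exact: (hausdorff_separated _ e0).
Qed.

Definition Ucup (A : nat -> set X) N : set X := [set y | exists2 i, (i < N)%N & A i y].

Lemma UcupS A N : Ucup A N.+1 = Ucup A N `|` A N.
Proof.
apply/seteqP; split => y /=.
  by case=> i; rewrite ltnS leq_eqVlt => /orP[/eqP ->|iN] Ay; [right|left; exists i].
by case=> [[i iN Ay]|Ay]; [exists i => //; exact: ltnW|exists N].
Qed.

Lemma vol_Ucup x A N : (forall i, A i `<=` cball d x (r / 2)) ->
  vol (Ucup A N) <= \sum_(i < N) vol (A i).
Proof.
move=> Ax; have Ux M : Ucup A M `<=` cball d x (r / 2) by move=> y [i _ /Ax].
elim: N => [|N IH].
  rewrite big_ord0 (_ : Ucup A 0 = set0); last by apply/seteqP; split => // y [].
  by rewrite /vol /H hausdorff_set0.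
rewrite UcupS big_ord_recr /=; apply: le_trans (vol_setU (Ux N) (Ax N)) _.
by rewrite lerD2r.
Qed.

Lemma vol_Ucup_separated x A N e : 0 < e ->
  (forall i j y z, (i < j)%N -> (j < N)%N -> A i y -> A j z -> e <= d y z) ->
  (forall i, (i < N)%N -> A i `<=` cball d x (r / 2)) ->
  \sum_(i < N) vol (A i) <= vol (Ucup A N).
Proof.
move=> e0; elim: N => [|N IH] sep Ax; first by rewrite big_ord0 vol_ge0.
have Ux : Ucup A N `<=` cball d x (r / 2) by move=> y [i iN]; apply: Ax; exact: ltnW.
rewrite UcupS big_ord_recr /=.
apply: (le_trans _ (vol_separated e0 _ Ux (Ax N (leqnn _)))).
  rewrite lerD2r; apply: IH => [i j y z ij jN|i iN]; first by apply: sep => //; exact: ltnW.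
  by apply: Ax; exact: ltnW.
by move=> y z [i iN Ay] Az; exact: (sep i N).
Qed.

Definition separated_family (A : set X) b N (f : nat -> X) : Prop :=
  (forall i, (i < N)%N -> A (f i)) /\
  forall i j, (i < j)%N -> (j < N)%N -> b <= d (f i) (f j).

(** Packing: the balls of radius [b] around the points are separated by [2 * b], each has at least
    [(b / (4 * a)) ^ n] times the volume of the ball of radius [a], and all lie in the ball of
    radius [2 * a], which is at most [4 ^ n] times as large. *)
Lemma separated_family_bound x a b A N f : 0 < b -> b <= a -> a <= r / 8 ->
  A `<=` cball d x a -> separated_family A (4 * b) N f -> N%:R <= (16 * a / b) ^+ n.
Proof.
move=> b0 ba ar Ax [fA fs].
have rr := r0.
have a0 : 0 < a by lra.
have V0 : 0 < vol (cball d x a) by apply: vol_cball_gt0 => //; lra.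
have b4a : 0 < b / (4 * a) by rewrite divr_gt0 // mulr_gt0.
have low i : (i < N)%N -> (b / (4 * a)) ^+ n * vol (cball d x a) <= vol (cball d (f i) b).
  move=> iN; have fx := Ax _ (fA i iN); rewrite /cball /= in fx.
  have t0 : 0 < b / (2 * a) by rewrite divr_gt0 // mulr_gt0.
  have t1 : b / (2 * a) <= 1 by rewrite ler_pdivrMr ?mulr_gt0 //; lra.
  have := @vol_doubling (f i) (2 * a) _ t0 t1 ltac:(lra) ltac:(lra).
  rewrite divfK ?gt_eqF ?mulr_gt0 // (_ : b / (2 * a) / 2 = b / (4 * a)); last first.
    by field; rewrite gt_eqF.
  apply: le_trans; apply: ler_wpM2l; first by rewrite exprn_ge0 // ltW.
  apply: (@le_vol (f i)); last by apply: cballS; lra.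
  by apply: sub_cball => //; rewrite dC; lra.
have sub i : (i < N)%N -> cball d (f i) b `<=` cball d x (2 * a).
  by move=> iN; apply: sub_cball => //; have := Ax _ (fA i iN); rewrite /cball /=; lra.
have up : vol (Ucup (fun i => cball d (f i) b) N) <= 4 ^+ n * vol (cball d x a).
  have h : vol (Ucup (fun i => cball d (f i) b) N) <= vol (cball d x (2 * a)).
    apply: (@le_vol x); last by apply: cballS; lra.
    by move=> y [i iN]; exact: sub.
  apply: (le_trans h).
  have := @vol_doubling x (2 * a) (1 / 2) ltac:(lra) ltac:(lra) ltac:(lra) ltac:(lra).
  rewrite (_ : 1 / 2 * (2 * a) = a); last by field.
  rewrite (_ : 1 / 2 / 2 = 4^-1 :> R); last by field.
  by rewrite exprVn ler_pdivrMl // exprn_gt0.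
have sum := @vol_Ucup_separated x (fun i => cball d (f i) b) N (2 * b) ltac:(lra) _ _.
have {sum}sum : \sum_(i < N) vol (cball d (f i) b) <= vol (Ucup (fun i => cball d (f i) b) N).
  apply: sum => [i j y z ij jN|i iN].
    rewrite /cball /= => yi zj; have := fs i j ij jN.
    have := tri y (f i) (f j); have := tri z y (f j); rewrite (dC z); lra.
  by apply: subset_trans (sub i iN) _; apply: cballS; lra.
have : N%:R * ((b / (4 * a)) ^+ n * vol (cball d x a)) <= 4 ^+ n * vol (cball d x a).
  apply: le_trans up; apply: le_trans sum.
  rewrite mulr_natl -[X in _ *+ X]card_ord -sumr_const; apply: ler_sum => i _; exact: low.
rewrite mulrA ler_pM2r // => h.
rewrite -(ler_pM2r (exprn_gt0 n b4a)); apply: (le_trans h).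
rewrite -exprMn (_ : 16 * a / b * (b / (4 * a)) = 4) //.
by field; rewrite !gt_eqF.
Qed.

Lemma maximal_separated x a b A : 0 < b -> b <= a -> a <= r / 8 -> A `<=` cball d x a ->
  exists N f, separated_family A (4 * b) N f /\
    forall y, A y -> exists2 i, (i < N)%N & d (f i) y < 4 * b.
Proof.
move=> b0 ba ar Ax; apply: contrapT => h.
have ext N : exists f, separated_family A (4 * b) N f.
  elim: N => [|N [f [fA fs]]]; first by exists (fun=> x).
  have [y Ay hy] : exists2 y, A y & forall i, (i < N)%N -> 4 * b <= d (f i) y.
    apply: contrapT => nh; apply: h; exists N, f; split => // y Ay.
    apply: contrapT => ny; apply: nh; exists y => // i iN.
    by rewrite leNgt; apply/negP => lt; apply: ny; exists i.
  exists (fun i => if (i < N)%N then f i else y); split=> [i|i j ij].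
    by rewrite ltnS; case: ifP => // iN _; exact: fA.
  rewrite ltnS leq_eqVlt => /orP[/eqP jN|jN].
    by rewrite jN ltnn -jN ij; apply: hy; rewrite -jN.
  by rewrite jN (ltn_trans ij jN); exact: fs.
have [f sf] := ext (Num.bound ((16 * a / b) ^+ n)).
have := separated_family_bound b0 ba ar Ax sf.
apply/negP; rewrite -ltNge; apply: archi_boundP.
by rewrite exprn_ge0 // divr_ge0 ?mulr_ge0 // ltW //; lra.
Qed.

(** Around a maximal [4 * b]-separated set, of at most [(16 * a / b) ^ n] points, sets of diameter
    at most [8 * b] cover the ball; [128 = 16 * 8] for every [b]. *)
Lemma vol_cball_le x a : 0 < a -> a <= r / 8 -> vol (cball d x a) <= 128 ^+ n * a ^+ n.
Proof.
move=> a0 ar; have rr := r0.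
rewrite -lee_fin -(@volE x); last by apply: cballS; lra.
apply: (hausdorff_le_finite_cover dm) => // e e0.
pose b := Num.min a (e / 8).
have b0 : 0 < b by rewrite lt_min a0 divr_gt0.
have ba : b <= a by rewrite ge_min lexx.
have be : b <= e / 8 by rewrite ge_min lexx orbT.
have [N [f [sf cov]]] := maximal_separated b0 ba ar (@subset_refl _ (cball d x a)).
exists N, (8 * b), (fun i => cball d (f i) (4 * b)); split.
- by rewrite mulr_ge0 ?(ltW b0) //=; lra.
- by move=> y /cov [i iN h]; exists i => //; exact: ltW.
- move=> i y z; rewrite /cball /= => h1 h2; have := tri (f i) y z; rewrite (dC y (f i)); lra.
have := separated_family_bound b0 ba ar (@subset_refl _ (cball d x a)) sf => h.
rewrite powR_mulrn ?mulr_ge0 ?(ltW b0) //.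
apply: le_trans (ler_wpM2r _ h) _; first by rewrite exprn_ge0 // mulr_ge0 // ltW.
rewrite -!exprMn (_ : 16 * a / b * (8 * b) = 128 * a) //.
by field; rewrite gt_eqF.
Qed.

Definition nbd (A : set X) (e : R) : set X := [set y | exists2 z, A z & d z y <= e].

(** Each point of a maximal separated subset of [A] comes with a hole, a ball of radius
    [eps * s / 4] inside the larger neighbourhood that misses the smaller one. Balls of radius
    [10 * s] around these points cover the larger neighbourhood, so the holes fill a fixed share of
    it; [eps / 88] comes from contracting a ball of radius [11 * s] into a hole. *)
Lemma porous_step c a A eps s : 0 < a -> a <= r / 64 -> A `<=` cball d c a ->
  0 < eps -> eps <= 1 -> 0 < s -> s <= a / 2 ->
  (forall z, A z -> exists2 y, d z y <= s & forall z', A z' -> eps * s <= d y z') ->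
  vol (nbd A (eps * s / 4)) <= (1 - (eps / 88) ^+ n) * vol (nbd A (2 * s)).
Proof.
move=> a0 ar Ac e0 e1 s0 sa hole; have rr := r0.
have s2 : 0 < 2 * s by rewrite mulr_gt0.
have s2a : 2 * s <= a by rewrite mulrC -ler_pdivlMr.
have ar8 : a <= r / 8 by lra.
have [N [f [[fA fs] cov]]] := maximal_separated s2 s2a ar8 Ac.
have /choice [g hg] : forall i, exists y, (i < N)%N ->
    d (f i) y <= s /\ forall z', A z' -> eps * s <= d y z'.
  move=> i; case: (ltnP i N) => iN; last by exists c.
  by have [y h1 h2] := hole _ (fA i iN); exists y.
have es0 : 0 < eps * s by rewrite mulr_gt0.
have ess : eps * s <= s by rewrite ler_piMl // ltW.
pose B i := cball d (g i) (eps * s / 4).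
have nbdc e : e <= a -> nbd A e `<=` cball d c (r / 2).
  move=> ea y [z /Ac]; rewrite /cball /= => h1 h2; have := tri z c y; lra.
have gc i : (i < N)%N -> d c (g i) <= a + s.
  move=> iN; have [h1 _] := hg i iN; have := Ac _ (fA i iN); rewrite /cball /= => h2.
  have := tri (f i) c (g i); lra.
have Bc i : (i < N)%N -> B i `<=` cball d c (r / 2).
  by move=> iN; apply: sub_cball => //; have := gc i iN; lra.
have Bn i : (i < N)%N -> B i `<=` nbd A (2 * s).
  move=> iN y; rewrite /B /cball /= => h; exists (f i); first exact: fA.
  have [h1 _] := hg i iN; have := tri (g i) (f i) y; lra.
have sumB : \sum_(i < N) vol (B i) <= vol (Ucup B N).
  apply: (@vol_Ucup_separated c _ _ s s0) => // i j y z ij jN.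
  rewrite /B /cball /= => yi zj.
  have [h1 _] := hg i (ltn_trans ij jN); have [h2 _] := hg j jN; have := fs i j ij jN.
  have := tri (g i) (f i) (f j); have := tri y (g i) (f j); have := tri z y (f j).
  have := tri (g j) z (f j); rewrite (dC z (g j)) (dC (g j) (f j)); lra.
have Uc : Ucup B N `<=` cball d c (r / 2) by move=> y [i iN]; exact: Bc.
have add : vol (nbd A (eps * s / 4)) + vol (Ucup B N) <= vol (nbd A (2 * s)).
  have nc1 : nbd A (eps * s / 4) `<=` cball d c (r / 2) by apply: nbdc; lra.
  apply: (le_trans (vol_separated (e := eps * s / 2) _ _ nc1 Uc)); first by rewrite divr_gt0.
    move=> y z [w Aw wy] [i iN]; rewrite /B /cball /= => zi.
    have [_ h2] := hg i iN; have := h2 w Aw; have := tri z (g i) w; have := tri y z w.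
    by rewrite (dC y w) (dC z y); lra.
  apply: (@le_vol c); last by apply: nbdc; lra.
  move=> y [[z Az zy]|[i iN]]; last exact: Bn.
  by exists z => //; apply: le_trans zy _; lra.
have eps88 : 0 < eps / 88 by rewrite divr_gt0.
have big i : (i < N)%N -> (eps / 88) ^+ n * vol (cball d (f i) (10 * s)) <= vol (B i).
  move=> iN; have [h1 _] := hg i iN.
  have sub : cball d (f i) (10 * s) `<=` cball d (g i) (11 * s).
    by apply: sub_cball => //; rewrite dC; lra.
  have s11 : 11 * s <= r / 2 by lra.
  have := @vol_doubling (g i) (11 * s) (eps / 44) ltac:(lra) ltac:(lra) ltac:(lra) s11.
  rewrite (_ : eps / 44 * (11 * s) = eps * s / 4); last by field.
  rewrite (_ : eps / 44 / 2 = eps / 88); last by field.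
  apply: le_trans; apply: ler_wpM2l; first by rewrite exprn_ge0 // ltW.
  by apply: (@le_vol (g i)) => //; exact: cballS.
have cover : vol (nbd A (2 * s)) <= \sum_(i < N) vol (cball d (f i) (10 * s)).
  pose B' i := if (i < N)%N then cball d (f i) (10 * s) else set0.
  have B'c i : B' i `<=` cball d c (r / 2).
    rewrite /B'; case: ifP => [iN|_]; last exact: sub0set.
    apply: sub_cball => //.
    by have := Ac _ (fA i iN); rewrite /cball /=; lra.
  have -> : \sum_(i < N) vol (cball d (f i) (10 * s)) = \sum_(i < N) vol (B' i).
    by apply: eq_bigr => i _; rewrite /B' ltn_ord.
  apply: le_trans (vol_Ucup N B'c); apply: (@le_vol c); last by move=> y [i _ /B'c].
  move=> y [z Az zy]; have [i iN fz] := cov z Az; exists i => //; rewrite /B' iN /cball /=.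
  have := tri z (f i) y; lra.
have key : (eps / 88) ^+ n * vol (nbd A (2 * s)) <= vol (Ucup B N).
  apply: le_trans sumB; apply: le_trans (ler_wpM2l _ cover) _.
    by rewrite exprn_ge0 // ltW.
  by rewrite mulr_sumr; apply: ler_sum => i _; exact: big.
rewrite mulrBl mul1r; lra.
Qed.

Lemma porous_vol c a A eps s1 : 0 < a -> a <= r / 64 -> A `<=` cball d c a ->
  0 < eps -> eps <= 1 -> 0 < s1 -> s1 <= a / 2 ->
  (forall z s, A z -> 0 < s -> s <= s1 ->
     exists2 y, d z y <= s & forall z', A z' -> eps * s <= d y z') ->
  vol A = 0.
Proof.
move=> a0 ar Ac e0 e1 s0 sa hole; have rr := r0.
(* [porous_step] with [s = sg k / 2] leads from the radius [2 * s = sg k] to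
   [eps * s / 4 = sg k.+1]. *)
pose sg k : R := 2 * s1 * (eps / 8) ^+ k.
have e8 : 0 <= eps / 8 <= 1 by lra.
have sg0 k : 0 < sg k by rewrite mulr_gt0 ?exprn_gt0 //; lra.
have sgle k : sg k <= 2 * s1.
  by rewrite /sg ger_pMr ?exprn_ile1 //; lra.
have nbdc e : e <= a -> nbd A e `<=` cball d c (r / 2).
  move=> ea y [z /Ac]; rewrite /cball /= => h1 h2; have := tri z c y; lra.
have eps88 : 0 < eps / 88 by rewrite divr_gt0.
have q1 : (eps / 88) ^+ n <= 1 by rewrite exprn_ile1 //; lra.
have qp : 0 < (eps / 88) ^+ n by rewrite exprn_gt0.
have it k : vol (nbd A (sg k)) <= (1 - (eps / 88) ^+ n) ^+ k * vol (nbd A (sg 0%N)).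
  elim: k => [|k IH]; first by rewrite expr0 mul1r.
  have := @porous_step c a A eps (sg k / 2) a0 ar Ac e0 e1.
  have sgk := sgle k; have sgk0 := sg0 k.
  rewrite (_ : eps * (sg k / 2) / 4 = sg k.+1); last by rewrite /sg exprSr; field.
  rewrite (_ : 2 * (sg k / 2) = sg k); last by field.
  move=> h; apply: (le_trans (h _ _ _)); [lra|lra| |].
    by move=> z Az; apply: hole => //; lra.
  by rewrite exprS -mulrA; apply: ler_wpM2l => //; lra.
apply/eqP; rewrite eq_le vol_ge0 andbT.
apply: (@le0_of_geometric _ _ (vol (nbd A (sg 0%N))) (1 - (eps / 88) ^+ n)).
- by apply/andP; split; lra.
- exact: vol_ge0.
move=> k; apply: le_trans (it k); apply: (@le_vol c).
  by move=> y Ay; exists y => //; rewrite (distxx dm) ltW.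
by apply: nbdc; have := sgle k; lra.
Qed.

End Volume.

(** * Affine functions *)

Definition btw_affine (R : realType) (X : Type) (d : X -> X -> R) (f : X -> R) : Prop :=
  forall y q z, between d y q z -> d y z * f q = d q z * f y + d y q * f z.

(** Only [x] is fixed: this bounds the slopes of [f] at [x] along all geodesics from [x], whatever
    their length. *)
Definition lip_at (R : realType) (X : Type) (d : X -> X -> R) (f : X -> R) (x : X) (A : R) : Prop :=
  forall y, `|f y - f x| <= A * d x y.

Section Affine.
Variables (R : realType) (X : Type) (d : X -> X -> R) (r K : R) (n : nat).
Hypothesis G : alex_local d r K.
Let H := hausdorff d n%:R.
Hypothesis Hfin : forall x, (H (cball d x (r / 2)) < +oo)%E.
Hypothesis Hpos : forall x e, 0 < e -> (0 < H (cball d x e))%E.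

Let dm : is_metric d. Proof. by case: G. Qed.
Let geo : geodesic_points d. Proof. by case: G. Qed.
Let r0 : 0 < r. Proof. by case: G. Qed.
Let dC := distC dm.
Let tri := dist_tri dm.
Let dge0 := dist_ge0 dm.
Local Notation vol := (vol d n).

Lemma affine_contraction f o t phi : btw_affine d f ->
  (forall y, between d o (phi y) y /\ d o (phi y) = t * d o y) ->
  forall y, f (phi y) = (1 - t) * f o + t * f y.
Proof.
move=> af h y; have [bt e] := h y.
have [oy0|oyn0] := eqVneq (d o y) 0.
  have <- : o = phi y by apply: (dist_eq0 dm); rewrite e oy0 mulr0.
  by rewrite (dist_eq0 dm oy0); ring.
have := af _ _ _ bt; rewrite e.
have -> : d (phi y) y = (1 - t) * d o y by move: bt; rewrite /between e; lra.
move=> h2; apply: (mulfI oyn0); rewrite h2; ring.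
Qed.

(** The slope along a geodesic is constant, so an initial piece of length [rho / 2] decides. *)
Lemma lip_at_of_local f p rho L : btw_affine d f -> 0 < rho ->
  (forall x y, d p x <= rho -> d p y <= rho -> `|f y - f x| <= L * d x y) ->
  forall x, d p x <= rho / 2 -> lip_at d f x L.
Proof.
move=> af rho0 h x px y.
have [xy|xy] := leP (d x y) (rho / 2).
  by apply: h; [|have := tri x p y]; lra.
have [q [bt xq]] := geo (y := x) (z := y) (u := rho / 2) ltac:(lra) (ltW xy).
have := h x q ltac:(lra) ltac:(have := tri x p q; lra); rewrite xq => hq.
have e := af _ _ _ bt; rewrite xq in e.
have qy : d q y = d x y - rho / 2 by move: bt; rewrite /between xq; lra.
have e2 : rho / 2 * (f y - f x) = d x y * (f q - f x) by rewrite qy in e; lra.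
have rho20 : 0 < rho / 2 by lra.
rewrite -(ler_pM2l rho20) -[X in X * `|_|](ger0_norm (ltW rho20)) -normrM e2 normrM.
rewrite (ger0_norm (dge0 _ _)).
have := ler_wpM2l (dge0 x y) hq; lra.
Qed.

Section Measurable.
Variable f : X -> R.
Hypothesis af : btw_affine d f.
Hypothesis mf : hmeasurable_fun d n%:R f.

(** The shells between consecutive bounds on [f] are cut off the arbitrary set [E] one at a time by
    Caratheodory's condition. Their outer measures thus have a finite sum, whose tails tend to 0. *)
Lemma level_tail (E : set X) (eps : R) : (H E < +oo)%E -> 0 < eps ->
  exists k : nat, (H (E `&` [set x | (k%:R <= `|f x|)%R]) < eps%:E)%E.
Proof.
move=> HE eps0.
pose A (k : nat) := f @^-1` [set` `](- k%:R), k%:R[%R].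
have AP k x : A k x <-> `|f x| < k%:R by rewrite /A /= in_itv /= ltr_norml.
have Am k : hmeasurable_set d n%:R (A k) by apply: mf; exact: interval_open.
have AS k : A k `<=` A k.+1.
  by move=> x /AP h; apply/AP; apply: lt_le_trans h _; rewrite ler_nat.
pose a k := H (E `&` (A k.+1 `\` A k)).
have a0 k : (0 <= a k)%E by exact: hausdorff_ge0.
have part N : (\sum_(0 <= k < N) a k <= H (E `&` A N))%E.
  elim: N => [|N IH]; first by rewrite big_geq // hausdorff_ge0.
  rewrite big_nat_recr //= /H (Am N (E `&` A N.+1)); apply: leeD.
    apply: (le_trans IH); apply: le_hausdorff => x [Ex AN]; split => //; split => //; exact: AS.
  by apply: le_hausdorff => x [Ex [h1 h2]]; split.
have fin : (\sum_(0 <= k <oo) a k < +oo)%E.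
  apply: le_lt_trans HE; apply: lime_le; first exact: is_cvg_nneseries.
  by near=> N; apply: (le_trans (part N)); apply: le_hausdorff => x [].
have := nneseries_tail_cvg fin (fun k _ => a0 k) => /fine_cvgP [finN /cvgrPdist_lt /(_ _ eps0) small].
have [N Nf Ns] : exists2 N, (\sum_(N <= k <oo) a k)%E \is a fin_num &
    `|0 - fine (\sum_(N <= k <oo) a k)%E| < eps.
  have [N _ h] : \forall N \near \oo, (\sum_(N <= k <oo) a k)%E \is a fin_num /\
    `|0 - fine (\sum_(N <= k <oo) a k)%E| < eps.
    by near=> N; split; near: N.
  by have [] := h N (leqnn N); exists N.
exists N; apply: le_lt_trans (_ : _ <= \sum_(N <= k <oo) a k)%E _; last first.
  rewrite -(fineK Nf) lte_fin; move: Ns; rewrite sub0r normrN ger0_norm //.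
  by rewrite fine_ge0 // nneseries_ge0.
rewrite -nneseries_addn //.
apply: le_trans (hausdorff_sigma d _ (ler0n _ _)); apply: le_hausdorff => x [Ex /= fx].
have ex : exists k, `|f x| < k.+1%:R.
  exists (Num.bound (f x)); apply: lt_le_trans (archi_boundP (normr_ge0 (f x))) _.
  by rewrite /Num.bound normr_id ler_nat.
(* By minimality the point lies in the shell [A k.+1] minus [A k]; for [k = 0] this holds because
   [A 0] is empty. *)
have [k hk kmin] := ex_minnP ex.
have Nk : (N <= k)%N.
  rewrite leqNgt; apply/negP => kN.
  by have := lt_le_trans hk (_ : _ <= N%:R); rewrite ler_nat => /(_ kN); rewrite ltNge fx.
exists (k - N)%N => //; rewrite subnK //; split => //; split; first exact/AP.
case: k hk kmin Nk => [|k] hk kmin Nk /AP; first by rewrite ltNge normr_ge0.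
by move=> /kmin; rewrite ltnn.
Unshelve. all: by end_near.
Qed.

(** The sets [A i] are arbitrary, but the sublevel set of [f] below [b N] satisfies Caratheodory's
    condition and cuts the last of them off the union of the others. *)
Lemma vol_level x A N b : (forall i, (i < N)%N -> A i `<=` cball d x (r / 2)) ->
  (forall i j y, (i < j)%N -> (j < N)%N -> A i y -> f y < b j) ->
  (forall i y, (i < N)%N -> A i y -> b i <= f y) ->
  \sum_(i < N) vol (A i) <= vol (Ucup A N).
Proof.
elim: N => [|N IH] Ax up low; first by rewrite big_ord0; exact: vol_ge0.
have Ux : Ucup A N.+1 `<=` cball d x (r / 2) by move=> y [i iN]; exact: Ax.
have Ux' : Ucup A N `<=` cball d x (r / 2) by move=> y [i iN]; apply: Ax; exact: ltnW.
have AN := Ax N (leqnn _).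
rewrite big_ord_recr /=; apply: (@le_trans _ _ (vol (Ucup A N) + vol (A N))).
  rewrite lerD2r; apply: IH => [i iN|i j y ij jN|i y iN].
  - by apply: Ax; exact: ltnW.
  - by apply: up => //; exact: ltnW.
  - by apply: low; exact: ltnW.
rewrite -lee_fin EFinD -(volE Hfin Ux) -(volE Hfin Ux') -(volE Hfin AN).
rewrite (mf (interval_open (a := -oo%O) (b := BLeft (b N)) _ _) (Ucup A N.+1)) //.
apply: leeD; apply: le_hausdorff => y.
  move=> [i iN Ay]; split; first by exists i => //; exact: ltnW.
  by rewrite /= in_itv /=; exact: (up i N).
move=> Ay; split; first by exists N.
by rewrite /= in_itv /= => h; have := low N y (leqnn _) Ay; rewrite leNgt h.
Qed.

Lemma locally_bounded p : exists rho M, 0 < rho /\ forall x, d p x <= rho -> `|f x| <= M.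
Proof.
have rr := r0; pose a := r / 4.
have a0 : 0 < a by rewrite divr_gt0.
have ar : a <= r / 2 by rewrite /a; lra.
pose V := vol (cball d p (a / 4)).
have V0 : 0 < V by apply: (vol_cball_gt0 Hfin Hpos); lra.
have q0 : 0 < (1 / 4 : R) ^+ n by rewrite exprn_gt0.
have q1 : (1 / 4 : R) ^+ n <= 1 by rewrite exprn_ile1 //; lra.
(* A contraction by [1 / 2] keeps at least [(1 / 4) ^ n] of the volume, so the midpoints of [x] with
   the points of a set of volume [V / 2] cannot all lie in a set of volume below [eps]. *)
pose eps := (1 / 4) ^+ n * V / 4.
have eps0 : 0 < eps by rewrite divr_gt0 // mulr_gt0.
have epsV : eps <= V / 4 by rewrite /eps ler_pM2r // ler_piMl // ltW.
pose E := cball d p a.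
have Er : E `<=` cball d p (r / 2) by exact: cballS.
have HE : (H E < +oo)%E by apply: le_lt_trans (Hfin p); exact: le_hausdorff.
have [k hk] := level_tail HE eps0.
set T := E `&` _ in hk.
have Tr : T `<=` cball d p (r / 2) by move=> y [/Er].
have volT : vol T < eps by rewrite -lte_fin -(volE Hfin Tr).
exists (a / 4), (3 * k%:R); split; first lra.
move=> x px.
pose W := cball d p (a / 4) `&` [set y | `|f y| < k%:R].
have Wr : W `<=` cball d p (r / 2) by move=> y [h _]; apply: cballS h; lra.
have volW : V / 2 <= vol W.
  have : V <= vol (W `|` T).
    apply: (@le_vol _ _ _ _ _ Hfin p); last by move=> y [/Wr|/Tr].
    move=> y py; have [lt|ge] := ltP `|f y| k%:R; first by left.
    by right; split => //; apply: cballS py; lra.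
  have := vol_setU Hfin Wr Tr; lra.
have t01 : 0 <= (1 / 2 : R) <= 1 by lra.
have [phi hphi] := contraction_map x G t01.
have phia y : W y -> d p (phi y) <= a.
  move=> [py _]; have [_ e] := hphi y; rewrite /cball /= in py.
  have := tri x p (phi y); have := tri p x y; rewrite e (dC x p); lra.
have [w Ww nT] : exists2 w, W w & ~ T (phi w).
  apply: contrapT => h.
  have WT y : W y -> T (phi y) by move=> Wy; apply: contrapT => nT; apply: h; exists y.
  have := @vol_expand _ _ _ _ _ _ G Hfin p phi W T (1 / 4) ltac:(lra) WT _ Wr Tr.
  have ex y z : W y -> W z -> 1 / 4 * d y z <= d (phi y) (phi z).
    move=> [py _] [pz _]; rewrite /cball /= in py pz.
    have := contraction_half G t01 hphi (y := y) (z := z).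
    rewrite (_ : 1 / 2 / 2 = 1 / 4 :> R); last by field.
    apply; [have := tri p x y|have := tri p x z]; rewrite (dC x p) /a in px py pz *; lra.
  have qV := mulr_gt0 q0 V0; move=> /(_ ex) h1; have h2 := ler_wpM2l (ltW q0) volW.
  rewrite /eps in volT; lra.
have fphi : `|f (phi w)| < k%:R.
  by rewrite ltNge; apply/negP => h; apply: nT; split => //; exact: phia.
(* [f x = 2 * f (phi w) - f w], hence the bound [3 * k]. *)
have := affine_contraction af hphi w; case: Ww => _ /= fw e.
move: fphi fw; rewrite e !ltr_norml ler_norml => /andP[h1 h2] /andP[h3 h4].
by apply/andP; split; lra.
Qed.

Lemma locally_lipschitz p : exists rho L, [/\ 0 < rho, 0 <= L &
  forall x y, d p x <= rho -> d p y <= rho -> `|f y - f x| <= L * d x y].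
Proof.
have rr := r0; have [rho1 [M1 [rho10 hM1]]] := locally_bounded p.
pose a := Num.min rho1 (r / 64).
have a0 : 0 < a by rewrite lt_min rho10 divr_gt0.
have ar : a <= r / 64 by rewrite ge_min lexx orbT.
pose M := Num.max 1 M1.
have M0 : 1 <= M by rewrite le_max lexx.
have hM x : d p x <= a -> `|f x| <= M.
  move=> px; apply: (@le_trans _ _ M1); last by rewrite le_max lexx orbT.
  by apply: hM1; apply: le_trans px _; rewrite ge_min lexx.
clearbody M a.
pose Q := cball d p a.
have V0 : 0 < vol Q by apply: (vol_cball_gt0 Hfin Hpos); lra.
have [c c0 volc] : exists2 c : R, 0 < c &
    forall x b, 0 < b -> b <= r / 8 -> vol (cball d x b) <= c ^+ n * b ^+ n.
  by exists 128 => //; exact: (vol_cball_le G Hfin Hpos).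
(* [N] does not depend on [x] and [y]: in the final comparison of volumes the powers of [s]
   cancel. *)
pose N := Num.bound ((16 * c * a) ^+ n / vol Q).
have hN : (16 * c * a) ^+ n / vol Q < N.+1%:R.
  apply: lt_le_trans (archi_boundP _) _; last by rewrite ler_nat.
  by rewrite divr_ge0 ?exprn_ge0 ?mulr_ge0 ?(ltW c0) ?(ltW a0) ?(ltW V0).
pose L := N.+1%:R * M / a.
have N0 : 0 < N.+1%:R :> R by rewrite ltr0n.
have L0 : 0 < L by rewrite divr_gt0 // mulr_gt0 //; lra.
suff key x y : d p x <= a / 4 -> d p y <= a / 4 -> f y - f x <= L * d x y.
  exists (a / 4), L; split; [lra|exact: ltW|move=> x y px py].
  have := key x y px py; have := key y x py px; rewrite (dC y x) ler_norml => h1 h2.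
  by apply/andP; split; lra.
move=> px py; rewrite leNgt; apply/negP => big.
set s := d x y in big.
have s0 : 0 < s.
  rewrite lt_def dge0 andbT; apply/eqP => sxy.
  by move: big; rewrite sxy (dist_eq0 dm sxy) mulr0 subrr ltxx.
have sa : s <= a / 2 by have := tri p x y; rewrite (dC x p) -/s; lra.
(* With this ratio the copies of [Q], contracted towards points of the geodesic, stay within [2 * s]
   of [x]. *)
pose t := s / (4 * a).
have t0 : 0 < t by rewrite divr_gt0 // mulr_gt0.
have ta : t * a = s / 4 by rewrite /t; field; rewrite gt_eqF.
have t8 : t <= 1 / 8 by rewrite ler_pdivrMr ?mulr_gt0 //; lra.
have t01 : 0 <= t <= 1 by apply/andP; split; lra.
pose u (i : nat) : R := i%:R / N.+1%:R.
have u01 i : (i <= N.+1)%N -> 0 <= u i <= 1.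
  by move=> iN; rewrite divr_ge0 //= ler_pdivrMr // mul1r ler_nat.
have /choice [w hw] : forall i, exists q, (i <= N.+1)%N -> between d x q y /\ d x q = u i * s.
  move=> i; case: (leqP i N.+1) => iN; last by exists x.
  have /andP[h1 h2] := u01 i iN.
  have [|q] := geo (y := x) (z := y) (u := u i * s) (mulr_ge0 h1 (dge0 _ _)).
    by rewrite -/s ler_piMl // ltW.
  by exists q.
have fw i : (i <= N.+1)%N -> f (w i) = f x + u i * (f y - f x).
  move=> iN; have [bt e] := hw i iN; have := af bt; rewrite e -/s.
  have -> : d (w i) y = s - u i * s by move: bt; rewrite /between e -/s; lra.
  move=> h; apply: (mulfI (lt0r_neq0 s0)); rewrite h; ring.
have /choice [phi hphi] : forall i, exists phi : X -> X, forall z,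
    between d (w i) (phi z) z /\ d (w i) (phi z) = t * d (w i) z.
  by move=> i; exact: contraction_map G t01.
have xw i : (i <= N.+1)%N -> d x (w i) <= s.
  move=> iN; have [_ ->] := hw i iN; have /andP[h1 h2] := u01 i iN.
  by rewrite ler_piMl // ltW.
have wQ i z : (i <= N.+1)%N -> Q z -> d (w i) z <= 2 * a.
  move=> iN; rewrite /Q /cball /= => pz; have := xw i iN.
  have := tri x (w i) z; have := tri p x z; rewrite (dC (w i) x) (dC x p); lra.
pose A i := phi i @` Q.
have Asub i : (i <= N.+1)%N -> A i `<=` cball d x (2 * s).
  move=> iN _ [z Qz <-]; have [_ e] := hphi i z; have := xw i iN.
  have := tri (w i) x (phi i z); rewrite e /cball /=.
  have := ler_wpM2l (ltW t0) (wQ i z iN Qz); lra.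
have sr : 2 * s <= r / 8 by lra.
have Ar i : (i < N.+2)%N -> A i `<=` cball d x (r / 2).
  by rewrite ltnS => iN; apply: subset_trans (Asub i iN) _; apply: cballS; lra.
have Avol i : (i < N.+2)%N -> (t / 2) ^+ n * vol Q <= vol (A i).
  rewrite ltnS => iN; apply: (@vol_expand _ _ _ _ _ _ G Hfin x (phi i)).
  - by rewrite divr_gt0.
  - by move=> z Qz; exists z.
  - move=> y' z Qy Qz; apply: (contraction_half G t01 (hphi i)).
      by have := wQ i y' iN Qy; lra.
    by have := wQ i z iN Qz; lra.
  - by apply: sub_cball => //; rewrite dC; lra.
  - by apply: Ar.
have fA i z : (i < N.+2)%N -> A i z ->
    `|f z - (1 - t) * (f x + u i * (f y - f x))| <= t * M.
  rewrite ltnS => iN [q Qq <-]; rewrite (affine_contraction af (hphi i)) fw //.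
  rewrite (_ : _ + t * f q - _ = t * f q); last by ring.
  by rewrite normrM (ger0_norm (ltW t0)); apply: ler_wpM2l; [exact: ltW|exact: hM].
pose b i := (1 - t) * (f x + u i * (f y - f x)) - t * M.
(* On a copy [f] varies by at most [2 * t * M]; the right-hand side is the shift of [f] from one
   copy to the next. *)
have gap : 2 * (t * M) < (1 - t) * ((f y - f x) / N.+1%:R).
  have e1 : s * (M / a) < (f y - f x) / N.+1%:R.
    rewrite ltr_pdivlMr //; apply: le_lt_trans big.
    by rewrite /L le_eqVlt; apply/orP; left; apply/eqP; ring.
  have e2 : 2 * (t * M) = s * (M / a) / 2 by rewrite /t; field; rewrite gt_eqF.
  have e3 : 0 < s * (M / a) by rewrite mulr_gt0 // divr_gt0 //; lra.
  rewrite e2; move: e1 e3; move: (s * (M / a)) ((f y - f x) / _) => Y Z e1 e3.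
  by apply: (@lt_le_trans _ _ (7 / 8 * Z)); [lra|apply: ler_wpM2r; lra].
have fyx : 0 < f y - f x by apply: lt_trans big; rewrite mulr_gt0.
have sum : \sum_(i < N.+2) vol (A i) <= vol (Ucup A N.+2).
  apply: (@vol_level x A N.+2 b) => // [i j z ij jN Az|i z iN Az].
    have := fA i z (ltn_trans ij jN) Az; rewrite ler_norml => /andP[_ h].
    have uij : u i + 1 / N.+1%:R <= u j.
      by rewrite /u -mulrDl ler_pM2r ?invr_gt0 // natr1 ler_nat.
    have h2 : u i * (f y - f x) + (f y - f x) / N.+1%:R <= u j * (f y - f x).
      by have := ler_wpM2r (ltW fyx) uij; rewrite mulrDl mul1r [_^-1 * _]mulrC.
    have t1 : 0 <= 1 - t by lra.
    have := ler_wpM2l t1 h2; rewrite /b; move: gap h; move: ((f y - f x) / _) => Z; lra.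
  by have := fA i z iN Az; rewrite ler_norml /b => /andP[h _]; lra.
have Uvol : vol (Ucup A N.+2) <= c ^+ n * (2 * s) ^+ n.
  apply: (@le_trans _ _ (vol (cball d x (2 * s)))).
    apply: (@le_vol _ _ _ _ _ Hfin x); first by move=> z [i iN]; exact: Asub.
    by apply: cballS; lra.
  by apply: volc => //; lra.
have : N.+2%:R * ((t / 2) ^+ n * vol Q) <= c ^+ n * (2 * s) ^+ n.
  apply: le_trans Uvol; apply: le_trans sum.
  rewrite mulr_natl -[X in _ *+ X]card_ord -sumr_const; apply: ler_sum => i _; exact: Avol.
have sn0 : 0 < (s / (8 * a)) ^+ n by rewrite exprn_gt0 // divr_gt0 // mulr_gt0.
rewrite (_ : t / 2 = s / (8 * a)); last by rewrite /t; field; rewrite gt_eqF.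
rewrite -exprMn (_ : c * (2 * s) = 16 * c * a * (s / (8 * a))); last by field; rewrite gt_eqF.
rewrite [(16 * c * a * _) ^+ n]exprMn mulrCA [X in _ <= X]mulrC ler_pM2l // => bad.
rewrite ltr_pdivrMr // in hN.
have : N.+1%:R * vol Q <= N.+2%:R * vol Q by rewrite ler_pM2r // ler_nat.
lra.
Qed.

End Measurable.

Lemma lip_propagate_up f c q b eta A rhoc Lc : btw_affine d f ->
  0 < rhoc -> 0 <= Lc ->
  (forall x y, d c x <= rhoc -> d c y <= rhoc -> `|f y - f x| <= Lc * d x y) ->
  0 < b -> 0 < eta -> eta <= r / 2 -> 0 <= A -> cball d q b `<=` cball d c eta ->
  (forall x, d q x <= b -> lip_at d f x A) ->
  forall y, f y - f c <= A * (1 + 2 * K * eta ^+ 2) * d c y.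
Proof.
move=> af rhoc0 Lc0 loc b0 eta0 etar A0 Qc lipQ y1; have rr := r0.
case: (G) => _ _ _ K1 [Kr [cexp _ _ _ _]].
have K0 : 0 < K by lra.
set x := K * eta ^+ 2.
have x0 : 0 <= x by rewrite mulr_ge0 ?sqr_ge0 // ltW.
have x8 : x <= 1 / 8.
  have e : eta ^+ 2 <= (r / 2) ^+ 2 by rewrite ler_sqr ?nnegrE ?divr_ge0 ?(ltW eta0) ?(ltW rr).
  have := ler_wpM2l (ltW K0) e; rewrite -/x expr_div_n; lra.
have -> : 2 * K * eta ^+ 2 = 2 * x by rewrite /x; ring.
set A2 := A * (1 + 2 * x).
have A20 : 0 <= A2 by rewrite mulr_ge0 //; lra.
rewrite leNgt; apply/negP => bad1.
have cy1 : 0 < d c y1.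
  rewrite lt_def dge0 andbT; apply/eqP => h.
  by move: bad1; rewrite h (dist_eq0 dm h) mulr0 subrr ltxx.
(* The end of the steep direction is brought into the ball where [f] has Lipschitz constant [Lc]; by
   affinity the slope [B] stays the same. *)
pose s0 := Num.min (rhoc / 4) (d c y1).
have s00 : 0 < s0 by rewrite lt_min cy1 divr_gt0.
have s0r : s0 <= rhoc / 4 by rewrite ge_min lexx.
have [y0 [bt cy0]] := geo (y := c) (z := y1) (u := s0) (ltW s00) ltac:(by rewrite ge_min lexx orbT).
pose B := (f y1 - f c) / d c y1.
have AB : A2 < B by rewrite ltr_pdivlMr.
have fy0 : f y0 - f c = B * s0.
  have e := af _ _ _ bt; rewrite cy0 in e.
  have e2 : d y0 y1 = d c y1 - s0 by move: bt; rewrite /between cy0; lra.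
  have BE : f y1 - f c = B * d c y1 by rewrite /B divfK // gt_eqF.
  apply: (mulfI (lt0r_neq0 cy1)); rewrite e2 in e.
  rewrite mulrA [d c y1 * B]mulrC -BE mulrBr e; ring.
clearbody B s0.
pose B1 := (A2 + B) / 2.
have B1B : B1 < B by rewrite /B1; lra.
have AB1 : A2 < B1 by rewrite /B1; lra.
pose a := Num.min (r / 64) s0.
have a0 : 0 < a by rewrite lt_min s00 divr_gt0.
have ar : a <= r / 64 by rewrite ge_min lexx.
have as0 : a <= s0 by rewrite ge_min lexx orbT.
(* The contracted ball [W] must be so close to [c] that the slope from each of its points towards
   [y0] is still at least [B1]. *)
pose tau := Num.min (a / 2) ((B - B1) * s0 / (Lc + B1)).
have LB : 0 < Lc + B1 by lra.
have tau0 : 0 < tau by rewrite lt_min !divr_gt0 // mulr_gt0 // subr_gt0.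
have taua : tau <= a / 2 by rewrite ge_min lexx.
have tauB : tau * (Lc + B1) <= (B - B1) * s0 by rewrite -ler_pdivlMr // ge_min lexx orbT.
pose t := Num.min 1 (tau / eta).
have t0 : 0 < t by rewrite lt_min ltr01 divr_gt0.
have t1 : t <= 1 by rewrite ge_min lexx.
have tet : t * eta <= tau by rewrite -ler_pdivlMr // ge_min lexx orbT.
have t01 : 0 <= t <= 1 by rewrite ltW.
clearbody t tau a.
have [phi hphi] := contraction_map c G t01.
pose Q := cball d q (Num.min b (r / 4)).
have bq0 : 0 < Num.min b (r / 4) by rewrite lt_min b0 divr_gt0.
have Qb z : Q z -> d q z <= b by move=> h; apply: le_trans h _; rewrite ge_min lexx.
have Qeta z : Q z -> d c z <= eta by move=> /Qb h; exact: (Qc z).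
pose W := phi @` Q.
have Wc : W `<=` cball d c tau.
  move=> _ [z Qz <-]; rewrite /cball /=; have [_ ->] := hphi z.
  by apply: le_trans tet; rewrite ler_pM2l //; exact: Qeta.
(* The contraction multiplies differences of [f] by exactly [t] and distances by at least
   [t * (1 - x)], and [A <= A2 * (1 - x)]. *)
have Wlip z z' : W z -> W z' -> f z' - f z <= A2 * d z z'.
  move=> [u Qu <-] [v Qv <-].
  have [h1 h2] := hphi u; have [h3 h4] := hphi v.
  have ex := cexp c u v _ _ t eta t01 ltac:(lra) (Qeta _ Qu) (Qeta _ Qv) h1 h3 h2 h4.
  rewrite -/x in ex.
  rewrite !(affine_contraction af hphi).
  have lv := lipQ u (Qb _ Qu) v; have fv := le_trans (ler_norm _) lv.
  have duv := dge0 u v.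
  have e1 := ler_wpM2l (ltW t0) fv.
  have e2 := ler_wpM2l A20 ex.
  have e3 : A <= A2 * (1 - x).
    rewrite /A2 -mulrA ler_peMr //; have := mulr_ge0 x0 (_ : 0 <= 1 - 2 * x); lra.
  have e4 := ler_wpM2r (mulr_ge0 (ltW t0) duv) e3.
  lra.
(* From [z] in [W], go a distance [s] towards [y0]. A point of [W] within [eps * s] of the end would
   force [B1 * s <= A2 * (1 + eps) * s + Lc * eps * s], which this [eps] excludes; so [W] is
   porous. *)
pose eps := Num.min 1 ((B1 - A2) / (2 * (A2 + Lc + 1))).
have AL : 0 < 2 * (A2 + Lc + 1) by lra.
have eps0 : 0 < eps by rewrite lt_min ltr01 divr_gt0 // subr_gt0.
have eps1 : eps <= 1 by rewrite ge_min lexx.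
have epsB : eps * (2 * (A2 + Lc + 1)) <= B1 - A2 by rewrite -ler_pdivlMr // ge_min lexx orbT.
clearbody eps.
have zero : vol W = 0.
  apply: (@porous_vol _ _ _ _ _ _ G Hfin Hpos c a W eps (a / 2)) => //; try lra.
    by apply: subset_trans Wc _; apply: cballS; lra.
  move=> z s Wz s_0 sa.
  have cz := Wc _ Wz; rewrite /cball /= in cz.
  have zy0 : s0 / 2 <= d z y0 by have := tri z c y0; rewrite cy0; lra.
  have zy0' : d z y0 <= s0 + tau by have := tri c z y0; rewrite (dC z c) cy0; lra.
  have [ys [bys zys]] := geo (y := z) (z := y0) (u := s) (ltW s_0) ltac:(lra).
  exists ys; first by rewrite zys.
  move=> g Wg; rewrite leNgt; apply/negP => close.
  have cg := Wc _ Wg; rewrite /cball /= in cg.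
  have D0 : 0 < d z y0 by lra.
  have slope : B1 * d z y0 <= f y0 - f z.
    have lz : f z - f c <= Lc * tau.
      apply: le_trans (ler_norm _) _; apply: le_trans (loc c z _ _) _.
      - by rewrite (distxx dm) ltW.
      - lra.
      - exact: ler_wpM2l.
    have B10 : 0 <= B1 by lra.
    have := ler_wpM2l B10 zy0'; lra.
  have fys : B1 * s <= f ys - f z.
    have e := af _ _ _ bys; rewrite zys in e.
    have e2 : d ys y0 = d z y0 - s by move: bys; rewrite /between zys; lra.
    rewrite -(ler_pM2l D0) mulrBr e e2.
    have := ler_wpM2l (ltW s_0) slope; lra.
  have cys : d c ys <= rhoc by have := tri z c ys; rewrite zys; lra.
  have fg : f ys - f g <= Lc * (eps * s).
    apply: le_trans (ler_norm _) _; apply: le_trans (loc g ys _ cys) _; first lra.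
    by rewrite dC; apply: ler_wpM2l => //; exact: ltW.
  have gz : f g - f z <= A2 * (s + eps * s).
    apply: le_trans (Wlip _ _ Wz Wg) _; apply: ler_wpM2l => //.
    have := tri ys z g; rewrite zys; lra.
  have e1 := ler_wpM2r (ltW s_0) epsB.
  have e2 : 0 < eps * s by rewrite mulr_gt0.
  have e3 : 0 < (B1 - A2) * s by rewrite mulr_gt0 // subr_gt0.
  lra.
have tp : 0 < t / 2 by rewrite divr_gt0.
have bqr : Num.min b (r / 4) <= r / 4 by rewrite ge_min lexx orbT.
have Qp : 0 < vol Q by apply: (vol_cball_gt0 Hfin Hpos) => //; lra.
have : (t / 2) ^+ n * vol Q <= vol W.
  apply: (@vol_expand _ _ _ _ _ _ G Hfin c phi) => //.
  - by move=> z Qz; exists z.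
  - move=> z z' Qz Qz'; apply: (contraction_half G t01 hphi).
      by have := Qeta _ Qz; lra.
    by have := Qeta _ Qz'; lra.
  - by move=> z Qz; have := Qeta _ Qz; rewrite /cball /=; lra.
  - by apply: subset_trans Wc _; apply: cballS; lra.
rewrite zero; apply/negP; rewrite -ltNge mulr_gt0 // exprn_gt0 //.
Qed.

End Affine.

Lemma lip_propagate (R : realType) (X : Type) (d : X -> X -> R) (r K : R) (n : nat)
    (f : X -> R) (c q : X) (b eta A : R) :
  alex_local d r K ->
  (forall x, (hausdorff d n%:R (cball d x (r / 2)) < +oo)%E) ->
  (forall x e, 0 < e -> (0 < hausdorff d n%:R (cball d x e))%E) ->
  btw_affine d f -> hmeasurable_fun d n%:R f ->
  0 < b -> 0 < eta -> eta <= r / 2 -> 0 <= A -> cball d q b `<=` cball d c eta ->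
  (forall x, d q x <= b -> lip_at d f x A) -> lip_at d f c (A * (1 + 2 * K * eta ^+ 2)).
Proof.
move=> G Hfin Hpos af mf b0 eta0 etar A0 qc lipQ y.
have [rho [L [rho0 L0 loc]]] := locally_lipschitz G Hfin Hpos af mf c.
have up := lip_propagate_up G Hfin Hpos af rho0 L0 loc b0 eta0 etar A0 qc lipQ y.
pose g x := - f x.
have gN x z : `|g z - g x| = `|f z - f x| by rewrite /g -opprD normrN.
have ag : btw_affine d g by move=> x u z bt; rewrite /g !mulrN (af _ _ _ bt); ring.
have := @lip_propagate_up _ _ _ _ _ _ G Hfin Hpos g c q b eta A rho L ag rho0 L0.
move=> /(_ _ b0 eta0 etar A0 qc _ y); rewrite /g opprK => dn.
rewrite ler_norml up andbT lerNl opprB addrC; apply: dn.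
  by move=> x z px pz; rewrite gN; exact: loc.
by move=> x qx z; rewrite gN; exact: lipQ.
Qed.

(* Crossing a distance [D] in [k] steps of length [D / k] multiplies the Lipschitz
   constant by at most [(1 + O(1 / k ^ 2)) ^ k], which tends to 1. *)
Lemma affine_lipschitz (R : realType) (X : Type) (d : X -> X -> R) (r K : R) (n : nat)
    (f : X -> R) (p : X) :
  alex_local d r K ->
  (forall x, (hausdorff d n%:R (cball d x (r / 2)) < +oo)%E) ->
  (forall x e, 0 < e -> (0 < hausdorff d n%:R (cball d x e))%E) ->
  btw_affine d f -> hmeasurable_fun d n%:R f -> lipschitz_fun d f.
Proof.
move=> G Hfin Hpos af mf; case: (G) => dm geo r0 K1 _.
have dC := distC dm; have tri := dist_tri dm; have dge0 := dist_ge0 dm.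
have [rho1 [L [rho10 L0 loc]]] := locally_lipschitz G Hfin Hpos af mf p.
have := lip_at_of_local G af rho10 loc.
have : 0 < rho1 / 2 by rewrite divr_gt0.
move: (rho1 / 2) => rho rho0 base {loc rho10 rho1}.
suff lip c : lip_at d f c (2 * L) by exists (2 * L) => x y; rewrite (dC x y); exact: lip.
pose D := d p c + 1; have D0 : 0 < D by rewrite ltr_pwDr.
(* For [k >= S] its three terms yield in turn [2 * eta <= rho], [6 * eta <= r] and
   [k * a <= 1 / 2]. *)
pose S := 2 * D / rho + 6 * D / r + 36 * K * D ^+ 2.
have S1 : 0 <= 2 * D / rho by rewrite divr_ge0 ?mulr_ge0 ?ltW.
have S2 : 0 <= 6 * D / r by rewrite divr_ge0 ?mulr_ge0 ?ltW.
have K0 : 0 < K by exact: lt_le_trans K1.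
have S3 : 0 <= 36 * K * D ^+ 2 by rewrite !mulr_ge0 ?sqr_ge0 ?ltW.
pose k := (Num.bound S).+1.
have k0 : 0 < k%:R :> R by rewrite ltr0n.
have Sk : S <= k%:R.
  apply: ltW; apply: lt_le_trans (archi_boundP _) _; last by rewrite ler_nat.
  by rewrite !addr_ge0.
pose eta := D / k%:R; have eta0 : 0 < eta by rewrite divr_gt0.
have keta : k%:R * eta = D by rewrite /eta mulrC divfK // gt_eqF.
have eta_rho : 2 * eta <= rho.
  rewrite /eta mulrA ler_pdivrMr // [rho * _]mulrC -ler_pdivrMr //.
  by apply: le_trans Sk; rewrite /S; move: S2 S3; clear; lra.
have eta_r : 3 * eta <= r / 2.
  have : 6 * eta <= r.
    rewrite /eta mulrA ler_pdivrMr // [r * _]mulrC -ler_pdivrMr //.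
    by apply: le_trans Sk; rewrite /S; move: S1 S3; clear; lra.
  by clear; lra.
pose a := 2 * K * (3 * eta) ^+ 2.
have a0 : 0 <= a by rewrite /a mulr_ge0 ?sqr_ge0 // mulr_ge0 // ltW.
have ka : k%:R * a <= 1 / 2.
  have e : k%:R * a = 18 * K * D ^+ 2 / k%:R.
    by rewrite /a -keta; field; rewrite gt_eqF.
  rewrite e ler_pdivrMr //; have : 36 * K * D ^+ 2 <= k%:R.
    by apply: le_trans Sk; rewrite /S; move: S1 S2; clear; lra.
  by clear; lra.
(* Let [q] be at distance [2 * eta] from [x] on the way to [p]. The ball of radius [eta] around [q]
   is a step closer to [p] than [x] and lies in the ball of radius [3 * eta] around [x]; hence
   [3 * eta] in [a]. *)
have chain j x : d p x <= j%:R * eta -> lip_at d f x (L * (1 + a) ^+ j).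
  have pow i : 1 <= (1 + a) ^+ i by rewrite exprn_ege1 // lerDl.
  elim: j x => [|j IH] x px.
    by rewrite expr0 mulr1; apply: base; rewrite mul0r in px; apply: le_trans px (ltW _).
  have [near_p|far] := leP (d p x) (2 * eta).
    move=> y; apply: le_trans (base x (le_trans near_p eta_rho) y) _.
    by rewrite ler_wpM2r // ler_peMr.
  have [||q [bt xq]] := geo x p (2 * eta); [by rewrite mulr_ge0 // ltW|by rewrite dC ltW|].
  have pq : d p q + eta <= j%:R * eta.
    move: px bt; rewrite /between xq (dC q p) (dC x p) -[j.+1]addn1 natrD; clear; lra.
  rewrite exprSr mulrA.
  apply: (@lip_propagate _ _ _ _ _ n f x q eta (3 * eta) _ G Hfin Hpos af mf) => //.
  - by rewrite mulr_gt0.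
  - by rewrite mulr_ge0 // exprn_ge0 // addr_ge0.
  - move=> z; rewrite /cball /= => qz; have := tri q x z; rewrite xq; move: qz; clear; lra.
  move=> z qz; apply: IH; apply: le_trans pq; have := tri q p z; move: qz; clear; lra.
have pc : d p c <= k%:R * eta by rewrite keta lerDl.
move=> y; apply: le_trans (chain k c pc y) _; apply: ler_wpM2r => //.
rewrite mulrC; apply: ler_wpM2r => //.
(* This bounds [(1 + a) ^ k] by [1 / (1 - k * a) <= 2]. *)
have := @bernoulli_inv R (- a) k ltac:(by apply: le_trans ler01; rewrite oppr_le0).
rewrite opprK mulrN => h.
have P0 : 0 <= (1 + a) ^+ k by rewrite exprn_ge0 // addr_ge0.
have := ler_wpM2l P0 ka; move: h; move: (k%:R * a) ((1 + a) ^+ k) => u P; clear; lra.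
Qed.

Theorem theorem1p2 (R : realType) (X : Type) (d : X -> X -> R) (n : nat) (kappa : R)
  (f : X -> R) :
  Alex d n kappa -> affine_fun d f -> hmeasurable_fun d (n%:R) f -> lipschitz_fun d f.
Proof.
move=> [dm cm gs dim curv] af mf.
(* Spaces with at most one point are set apart, since strainer pairs exist only if there are two
   distinct points. *)
have [[x0 [x1 x01]]|triv] := pselect (exists x0 x1 : X, x0 <> x1); last first.
  exists 0 => x y; rewrite mul0r (_ : x = y) ?subrr ?normr0 //.
  by apply: contrapT => xy; apply: triv; exists x, y.
have [r [K G]] := alex_localP dm gs curv.
have [_ Hfin Hpos] := alex_regular G cm dim x01.
exact: (affine_lipschitz x0 G Hfin Hpos (affine_between dm gs af) mf).
Qed.
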